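(* Let $f\colon\mathbb C\to\mathbb C$ be an entire transcendental function, let $\delta\in\mathbb C\setminus\{0\}$, and let $F\colon\mathbb C^2\to\mathbb C^2$ be the transcendental Hénon map $F(z,w)=(f(z)-\delta w,\,z)$. Then every Fatou component of $F$ is pseudoconvex.
   Context: An entire function $f\colon\mathbb C\to\mathbb C$ is transcendental if it is not a polynomial. View $\mathbb C^2\subset\mathbb P^2=\mathbb P^2(\mathbb C)$ via $(z,w)\mapsto[z:w:1]$. The ($\mathbb P^2$-)Fatou set of $F$ is the set of points of $\mathbb C^2$ that have an open neighborhood $U\subset\mathbb C^2$ on which the family of iterates $(F^n)_{n\ge 0}$ is normal as a family of maps into $\mathbb P^2$, i.e. every sequence of iterates has a subsequence converging uniformly on compact subsets of $U$ to a holomorphic map $U\to\mathbb P^2$. A Fatou component is a connected component of the Fatou set. *)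

(* Defs.v *)
From HB Require Import structures.
From mathcomp Require Import all_boot all_order all_algebra.
From mathcomp Require Import all_classical all_reals all_analysis.
From mathcomp Require Import complex ring.

Set Implicit Arguments.
Unset Strict Implicit.
Unset Printing Implicit Defensive.

Import Order.TTheory GRing.Theory Num.Theory.
Import numFieldNormedType.Exports.

Local Open Scope classical_set_scope.
Local Open Scope ring_scope.
Local Open Scope complex_scope.

(* [R[i]^o] is a normed module over [R[i]], so [derivable] and [differentiable]
   between such spaces mean complex differentiability. *)
Notation C1 R := (R[i]^o).
Notation C2 R := (R[i]^o * R[i]^o)%type.

Definition entire (R : realType) (f : C1 R -> C1 R) : Prop :=
  forall z, derivable f z 1.

Definition transcendental (R : realType) (f : C1 R -> C1 R) : Prop :=
  ~ exists p : {poly R[i]}, forall z, f z = p.[z].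

Definition henon (R : realType) (f : C1 R -> C1 R) (delta : R[i]) :
    C2 R -> C2 R :=
  fun p => (f p.1 - delta * p.2, p.1).

(* The projective plane, as the set of lines through 0 in C^3. *)
Definition P2 (R : realType) : Type :=
  {L : {vspace 'rV[R[i]]_3} | \dim L == 1%N}.

Definition affine_vec (R : realType) (p : C2 R) : 'rV[R[i]]_3 :=
  \row_(j < 3) nth 0 [:: p.1; p.2; 1] j.

Lemma dim_affine_vec (R : realType) (p : C2 R) :
  \dim <[affine_vec p]>%VS == 1%N.
Proof.
rewrite dim_vline; suff -> : affine_vec p != 0 by [].
apply/eqP => p0; have : affine_vec p 0 (inord 2) = 0 by rewrite p0 mxE.
by rewrite mxE inordK //= => /eqP; rewrite oner_eq0.
Qed.

(* (z, w) |-> [z : w : 1] *)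
Definition affine_chart (R : realType) (p : C2 R) : P2 R :=
  exist _ <[affine_vec p]>%VS (dim_affine_vec p).

Definition sqnorm (R : realType) (z : R[i]) : R :=
  complex.Re z ^+ 2 + complex.Im z ^+ 2.

(* |u /\ v| / (|u| |v|), the sine of the angle between u and v. *)
Definition chordal (R : realType) (u v : 'rV[R[i]]_3) : R :=
  Num.sqrt ((\sum_(i < 3) \sum_(j < 3 | (i < j)%N)
               sqnorm (u 0 i * v 0 j - u 0 j * v 0 i))
            / ((\sum_(i < 3) sqnorm (u 0 i)) * (\sum_(i < 3) sqnorm (v 0 i)))).

(* The chordal metric, computed on an arbitrary representative of each line
   (see [P2_distE]). Since P^2 is compact, every metric inducing its topology
   gives the same uniform convergence. *)
Definition P2_dist (R : realType) (L M : P2 R) : R :=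
  chordal (vpick (sval L)) (vpick (sval M)).

Lemma P2_distE (R : realType) (L M : P2 R) (u v : 'rV[R[i]]_3) :
  sval L = <[u]>%VS -> sval M = <[v]>%VS -> P2_dist L M = chordal u v.
Proof.
have sqnormM (x y : R[i]) : sqnorm (x * y) = sqnorm x * sqnorm y.
  by case: x y => [xr xi] [yr yi]; rewrite /sqnorm /=; ring.
have sqnorm_neq0 (x : R[i]) : x != 0 -> sqnorm x != 0.
  case: x => xr xi; apply: contra; rewrite /sqnorm /=.
  rewrite paddr_eq0 ?sqr_ge0 // !sqrf_eq0 => /andP[/eqP -> /eqP ->].
  exact: eqxx.
have repr (N : P2 R) w :
    sval N = <[w]>%VS -> exists2 a, a != 0 & vpick (sval N) = a *: w.
  case: N => N /= dN Nw.
  have : vpick N \in <[w]>%VS by rewrite -Nw memv_pick.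
  case/vlineP => a Ea; exists a => //; apply/eqP => a0.
  have /eqP : vpick N = 0 by rewrite Ea a0 scale0r.
  by rewrite vpick0 => /eqP N0; move: dN; rewrite N0 dimv0.
move=> /repr[a a0 Eu] /repr[b b0 Ev]; rewrite /P2_dist Eu Ev /chordal.
congr Num.sqrt.
have -> : \sum_(i < 3) \sum_(j < 3 | (i < j)%N)
      sqnorm ((a *: u) 0 i * (b *: v) 0 j - (a *: u) 0 j * (b *: v) 0 i)
    = sqnorm (a * b) * \sum_(i < 3) \sum_(j < 3 | (i < j)%N)
        sqnorm (u 0 i * v 0 j - u 0 j * v 0 i).
  rewrite mulr_sumr; apply: eq_bigr => i _; rewrite mulr_sumr.
  by apply: eq_bigr => j _; rewrite -sqnormM !mxE; congr sqnorm; ring.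
have sumZ c (w : 'rV[R[i]]_3) : \sum_(i < 3) sqnorm ((c *: w) 0 i)
    = sqnorm c * \sum_(i < 3) sqnorm (w 0 i).
  by rewrite mulr_sumr; apply: eq_bigr => i _; rewrite mxE sqnormM.
rewrite !sumZ mulrACA -sqnormM -mulf_div divff ?mul1r //.
by rewrite sqnorm_neq0 // mulf_neq0.
Qed.

(* A map to P^2 is holomorphic when, locally, it is [h 0 : h 1 : h 2] with
   holomorphic h j without common zeros; the values outside U are irrelevant.
   The h j have no common zero because every [P2] has dimension 1. *)
Definition P2_holomorphic_on (R : realType) (U : set (C2 R))
    (G : C2 R -> P2 R) : Prop :=
  forall p, U p -> exists h : 'I_3 -> C2 R -> C1 R,
    \forall q \near p,
      (forall j, differentiable (h j) q) /\
      sval (G q) = <[\row_j h j q]>%VS.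

Definition P2_cvg_compacts (R : realType) (U : set (C2 R))
    (g : nat -> C2 R -> P2 R) (G : C2 R -> P2 R) : Prop :=
  forall K : set (C2 R), compact K -> K `<=` U ->
  forall e : R, 0 < e ->
    \forall n \near \oo, forall p, K p -> P2_dist (g n p) (G p) < e.

Definition P2_normal_on (R : realType) (U : set (C2 R))
    (Fam : set (C2 R -> P2 R)) : Prop :=
  forall g : nat -> C2 R -> P2 R, (forall n, Fam (g n)) ->
  exists (k : nat -> nat) (G : C2 R -> P2 R),
    [/\ {homo k : m n / (m < n)%N},
        P2_holomorphic_on U G &
        P2_cvg_compacts U (g \o k) G].

Definition fatou_set (R : realType) (F : C2 R -> C2 R) : set (C2 R) :=
  [set p | exists U : set (C2 R),
     [/\ open U, U p &
         P2_normal_on U [set @affine_chart R \o iter n F | n in [set: nat]]]].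

Definition fatou_component (R : realType) (F : C2 R -> C2 R)
    (Omega : set (C2 R)) : Prop :=
  exists2 p, fatou_set F p & Omega = connected_component (fatou_set F) p.

Definition circle_mean (R : realType) (u : C2 R -> \bar R) (a b : C2 R) : \bar R :=
  (((2 * pi)^-1)%:E *
   \int[lebesgue_measure]_(t in `[0%R, (2 * pi)%R]%classic)
     u (a + ((cos t +i* sin t) : R[i]) *: b)%R)%E.

(* Upper semicontinuous with values in [-oo, +oo[, and subharmonic on complex
   lines, in the form of the sub-mean value inequality on every closed disc
   { a + c b : |c| <= 1 } contained in Omega. *)
Definition plurisubharmonic_on (R : realType) (Omega : set (C2 R))
    (u : C2 R -> \bar R) : Prop :=
  [/\ forall p, Omega p -> (u p < +oo)%E,
      forall p (c : R), Omega p -> (u p < c%:E)%E ->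
        \forall q \near within Omega (nbhs p), (u q < c%:E)%E &
      forall a b : C2 R,
        (forall c : R[i], `|c| <= 1 -> Omega (a + c *: b)) ->
        (u a <= circle_mean u a b)%E].

(* Existence of a continuous plurisubharmonic exhaustion function. *)
Definition pseudoconvex (R : realType) (Omega : set (C2 R)) : Prop :=
  open Omega /\
  exists phi : C2 R -> R,
    [/\ {within Omega, continuous phi},
        plurisubharmonic_on Omega (EFin \o phi) &
        forall c : R, compact (Omega `&` [set p | phi p <= c])].

(* Main.v *)
Require Import Defs.
From HB Require Import structures.
From mathcomp Require Import all_boot all_order all_algebra.
From mathcomp Require Import all_classical all_reals all_analysis.
From mathcomp Require Import complex ring lra.

Set Implicit Arguments.
Unset Strict Implicit.
Unset Printing Implicit Defensive.

Import Order.TTheory GRing.Theory Num.Theory.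
Import numFieldNormedType.Exports.

Local Open Scope classical_set_scope.
Local Open Scope ring_scope.
Local Open Scope complex_scope.

(** The Fatou set S satisfies a continuity principle: if q is holomorphic on the
    closed unit disc and S contains the points a + c b for |c| <= 1 and the points
    a + c b + e^{-q(c)} v for |c| = 1 and |v| <= t, then S contains the ball of radius
    t |e^{-q(0)}| around a.  Granting this, let rho be the distance to the complement
    of a component, capped at 1.  If - ln rho <= Re q on the boundary of a disc, then
    the principle, for all t < 1, gives - ln rho <= Re q at its centre.  Real parts of
    holomorphic functions approximate continuous functions on the circle (harmonic
    extension), so - ln rho is plurisubharmonic, and max(|p|, - ln rho(p)) is an
    exhaustion.

    For the continuity principle, take a sequence of iterates in homogeneous coordinates
    [1 : z : w], converging on the given discs.  Near every point, one coordinate has no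
    zeros and the coordinates before it are negligible with respect to it.  By Hurwitz,
    this is clear unless the limit passes through [0 : 0 : 1].  There, if z/w had a
    non-constant limit, z would take every value on small discs, because w tends to
    infinity; comparing with the limit of the next iterate [1 : f(z) - delta w : z],
    the difference quotient (f(z) - f(0))/z would be bounded and f affine by Liouville,
    or delta would be 0.  The dominant coordinate is unique, hence the same on the
    (connected) union of the given discs.  Moving the discs continuously, the minimum
    principle keeps it zero-free, and the maximum principle carries the uniform
    convergence of the ratios from the boundaries of the discs to their centres. *)

(** The obstacle is that maps into P^2 obey no maximum principle, so convergence on the boundaries
    of discs does not by itself spread inwards. It does for holomorphic functions, and [typ E j]
    reduces the one case to the other: a single zero-free coordinate on all discs turns the iterates
    into bounded functions. Bounded ratios alone would allow several [j] at one point; negligibility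
    of the earlier coordinates is what excludes this. Coordinate 0 never vanishes, which is what
    Hurwitz needs; the coordinate [z] may vanish, and this is why limits through [[0 : 0 : 1]]
    require the dynamics.

    The factor [e^{-q}] is holomorphic and zero-free, so a disc pushed by it stays holomorphic,
    while its modulus is at most [rho] exactly when [- ln rho <= Re q]. Cauchy theory is built on
    means over the unit circle, obtained from rectangles through the exponential. *)

(** * Real-valued norms and differentiability estimates *)

Section RealNorm.
Variables (R : realType).
Implicit Types (V W : normedModType R[i]).

(** Norms of modules over [R[i]] are elements of [R[i]], which is only partially ordered; the real
    part makes them available to [lra], suprema and logarithms. *)
Definition rnorm V (v : V) : R := complex.Re `|v|.

Lemma rnormE V (v : V) : `|v| = (rnorm v)%:C.
Proof. by rewrite /rnorm RRe_real// realE normr_ge0. Qed.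

Lemma rnorm_ge0 V (v : V) : 0 <= rnorm v.
Proof. by rewrite -ler0c -rnormE. Qed.

Lemma rnorm0 V : rnorm (0 : V) = 0.
Proof. by rewrite /rnorm normr0. Qed.

Lemma rnorm_eq0 V (v : V) : (rnorm v == 0) = (v == 0).
Proof. by rewrite -(normr_eq0 v) rnormE -(inj_eq (@complexI R)). Qed.

Lemma rnorm_gt0 V (v : V) : (0 < rnorm v) = (v != 0).
Proof. by rewrite lt0r rnorm_ge0 andbT rnorm_eq0. Qed.

Lemma rnormN V (v : V) : rnorm (- v) = rnorm v.
Proof. by rewrite /rnorm normrN. Qed.

Lemma rnormD V (v w : V) : rnorm (v + w) <= rnorm v + rnorm w.
Proof. by rewrite -lecR rmorphD/= -!rnormE ler_normD. Qed.

Lemma rnormB V (v w : V) : rnorm (v - w) <= rnorm v + rnorm w.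
Proof. by rewrite (le_trans (rnormD _ _))// rnormN. Qed.

Lemma rdistC V (v w : V) : rnorm (v - w) = rnorm (w - v).
Proof. by rewrite /rnorm distrC. Qed.

Lemma rnormBD V (w v u : V) : rnorm (v - u) <= rnorm (v - w) + rnorm (w - u).
Proof. by rewrite -[v - u](subrKA w) rnormD. Qed.

Lemma rnorm_lbB V (v w : V) : rnorm v - rnorm w <= rnorm (v - w).
Proof. by rewrite lerBlDr -[X in rnorm X <= _](subrK w) rnormD. Qed.

Lemma rnormZ V (a : R[i]) (v : V) : rnorm (a *: v) = rnorm (a : C1 R) * rnorm v.
Proof. by apply: (@complexI R); rewrite rmorphM/= -!rnormE normrZ. Qed.

Lemma rnormM (a b : C1 R) : rnorm (a * b : C1 R) = rnorm a * rnorm b.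
Proof. exact: rnormZ. Qed.

Lemma rnorm1 : rnorm (1 : C1 R) = 1.
Proof. by rewrite /rnorm normr1. Qed.

Lemma rnormV (a : C1 R) : rnorm (a^-1 : C1 R) = (rnorm a)^-1.
Proof.
have [->|a0] := eqVneq a 0; first by rewrite invr0 rnorm0 invr0.
have n0 : rnorm a != 0 by rewrite rnorm_eq0.
by apply: (mulfI n0); rewrite -rnormM mulfV// mulfV// rnorm1.
Qed.

Lemma rnormX (a : C1 R) n : rnorm (a ^+ n : C1 R) = rnorm a ^+ n.
Proof.
by elim: n => [|n IH]; rewrite ?expr0 ?rnorm1// !exprS rnormM IH.
Qed.

Lemma rnorm_real (x : R) : rnorm (x%:C : C1 R) = `|x|.
Proof. by rewrite /rnorm normc_def/= expr0n/= addr0 sqrtr_sqr. Qed.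

Lemma rnormEsq (a : C1 R) :
  rnorm a ^+ 2 = complex.Re a ^+ 2 + complex.Im a ^+ 2.
Proof. by rewrite /rnorm normc_def/= sqr_sqrtr// addr_ge0 ?sqr_ge0. Qed.

Lemma ler_Re_rnorm (a : C1 R) : `|complex.Re a| <= rnorm a.
Proof.
by rewrite -(@ler_pXn2r _ 2)// ?nnegrE ?rnorm_ge0// rnormEsq real_normK ?num_real// lerDl sqr_ge0.
Qed.

Lemma ler_Im_rnorm (a : C1 R) : `|complex.Im a| <= rnorm a.
Proof.
by rewrite -(@ler_pXn2r _ 2)// ?nnegrE ?rnorm_ge0// rnormEsq real_normK ?num_real// lerDr sqr_ge0.
Qed.

Lemma rnorm_le_ReIm (a : C1 R) : rnorm a <= `|complex.Re a| + `|complex.Im a|.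
Proof.
rewrite -(@ler_pXn2r _ 2)// ?nnegrE ?rnorm_ge0// ?addr_ge0// rnormEsq.
rewrite sqrrD !real_normK ?num_real//.
have : 0 <= `|complex.Re a| * `|complex.Im a| *+ 2 by rewrite mulrn_wge0 ?mulr_ge0.
lra.
Qed.

Lemma rnorm_pair (p : C2 R) : rnorm p = Num.max (rnorm p.1) (rnorm p.2).
Proof.
rewrite /rnorm.
have -> : `|p| = Order.max `|p.1| `|p.2| by [].
rewrite !rnormE /Order.max !ltcR -!/(rnorm _); by case: ifP.
Qed.

Lemma nbhs_rnorm V (p : V) (A : set V) :
  nbhs p A <-> exists2 e : R, 0 < e & forall q, rnorm (q - p) < e -> A q.
Proof.
split => [/nbhs_normP[e /= e0 eA]|[e e0 eA]].
  have eE : e = (complex.Re e)%:C by rewrite RRe_real// realE ltW.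
  exists (complex.Re e); first by rewrite -ltcR -eE.
  by move=> q qe; apply: eA => /=; rewrite distrC rnormE eE ltcR.
apply/nbhs_normP; exists e%:C; first by rewrite /= ltcR.
by move=> q /=; rewrite distrC rnormE ltcR => /eA.
Qed.

Lemma cvg_rnorm V W (f : V -> W) (p : V) :
  {for p, continuous f} <->
  forall e : R, 0 < e -> exists2 d : R, 0 < d &
    forall q, rnorm (q - p) < d -> rnorm (f q - f p) < e.
Proof.
split => [fc e e0|H].
  have : nbhs (f p) [set y | rnorm (y - f p) < e] by apply/nbhs_rnorm; exists e.
  by move/fc => /nbhs_rnorm.
move=> A /nbhs_rnorm[e e0 eA]; apply/nbhs_rnorm.
by have [d d0 dH] := H e e0; exists d => // q /dH /eA.
Qed.

Lemma rnorm_continuous V : continuous (@rnorm V).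
Proof.
move=> p; apply/cvgrPdist_lt => e e0; apply/nbhs_rnorm; exists e => // q qe.
rewrite ltr_norml; apply/andP; split.
  by have := rnorm_lbB q p; lra.
by have := rnorm_lbB p q; rewrite rdistC; lra.
Qed.

Lemma differentiable_rnorm V W (u : V -> W) (p : V) : differentiable u p ->
  forall e : R, 0 < e -> exists2 d : R, 0 < d &
    forall h, rnorm h < d -> rnorm (u (p + h) - u p - 'd u p h) <= e * rnorm h.
Proof.
move=> du; have [_ duE] := (diff_locallyP p u).1 du.
move=> e e0; have /eqaddoP/(_ (e%:C)) := duE.
rewrite ltcR => /(_ e0) /nbhs_rnorm [d d0 H]; exists d => // h hd.
have := H h; rewrite subr0 => /(_ hd) /=.
rewrite !rnormE -rmorphM/= lecR; congr (_ <= _); congr rnorm.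
by rewrite !fctE /= [h + p]addrC opprD addrA.
Qed.

(** On a general normed module a linear map need not be continuous, hence the bound [C]. Once [L] is
    continuous, [diff_unique] identifies it with the differential. *)
Lemma rnorm_differentiable V W (u : V -> W) (p : V) (L : {linear V -> W}) (C : R) :
  (forall v, rnorm (L v) <= C * rnorm v) ->
  (forall e : R, 0 < e -> exists2 d : R, 0 < d &
    forall h, rnorm h < d -> rnorm (u (p + h) - u p - L h) <= e * rnorm h) ->
  differentiable u p.
Proof.
move=> LC H.
have Lc : continuous L.
  move=> x; apply/cvg_rnorm => e e0; exists (e / (`|C| + 1)).
    by rewrite divr_gt0// ltr_wpDl.
  move=> q qe; rewrite -linearB; apply: (le_lt_trans (LC _)).
  apply: (@le_lt_trans _ _ ((`|C| + 1) * rnorm (q - x))).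
    by apply: ler_wpM2r; [exact: rnorm_ge0|rewrite (le_trans (ler_norm _))// lerDl].
  by rewrite mulrC -ltr_pdivlMr// ltr_wpDl.
have E : u \o shift p = cst (u p) + L +o_ (0 : V) id.
  apply/eqaddoP => e e0; have eE : e = (complex.Re e)%:C by rewrite RRe_real// realE ltW.
  have e0' : 0 < complex.Re e by rewrite -ltcR -eE.
  have [d d0 dH] := H _ e0'; apply/nbhs_rnorm; exists d => // h; rewrite subr0 => /dH.
  rewrite !rnormE eE -rmorphM/= lecR; congr (_ <= _); congr rnorm.
  by rewrite !fctE /= [h + p]addrC opprD addrA.
have dE := diff_unique Lc E.
by apply/diff_locallyP; rewrite dE.
Qed.

End RealNorm.

(** * Cauchy's theorem on rectangles *)

Section IntervalIntegral.
Variable R : realType.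
Implicit Types (f g : R -> R) (a b c e : R).

Definition itg a b f : R := \int[lebesgue_measure]_(x in `[a, b]) f x.

Definition integrable_itv a b f :=
  (@lebesgue_measure R).-integrable `[a, b] (EFin \o f).

Definition cont_itv a b f := forall x, a <= x <= b -> forall e, 0 < e ->
  exists2 d : R, 0 < d & forall x', a <= x' <= b -> `|x' - x| < d -> `|f x' - f x| < e.

Lemma cont_itv_integrable a b f : cont_itv a b f -> integrable_itv a b f.
Proof.
move=> H; apply: continuous_compact_integrable; first exact: segment_compact.
apply/subspace_continuousP => x; rewrite /= in_itv/= => xab.
apply/cvgrPdist_lt => e e0; have [d d0 dH] := H x xab e e0.
rewrite near_withinE; apply/nbhs_ballP; exists d => // y /=.
rewrite /ball/= distrC => yd; rewrite in_itv/= => yab.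
by rewrite distrC; exact: dH.
Qed.

Lemma integrable_itvS a b c e f : a <= c -> e <= b ->
  integrable_itv a b f -> integrable_itv c e f.
Proof.
move=> ac eb; apply: integrableS => //.
by apply: subset_itv; rewrite bnd_simp.
Qed.

Lemma integrable_itvB a b f g : integrable_itv a b f -> integrable_itv a b g ->
  integrable_itv a b (fun x => f x - g x).
Proof.
move=> fi gi; rewrite /integrable_itv.
rewrite (_ : EFin \o _ = ((EFin \o f) \- (EFin \o g))%E); last by [].
exact: integrableB.
Qed.

Lemma itgB a b f g : integrable_itv a b f -> integrable_itv a b g ->
  itg a b (fun x => f x - g x) = itg a b f - itg a b g.
Proof. by move=> *; rewrite /itg RintegralB. Qed.

Lemma itg_split a c b f : a <= c -> c <= b -> integrable_itv a b f ->
  itg a b f = itg a c f + itg c b f.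
Proof.
move=> ac cb fi; rewrite /itg.
have := @Rintegral_itvB R f (BLeft a) (BRight b) c fi.
rewrite !bnd_simp => /(_ ac cb) E.
rewrite -(@Rintegral_itv_obnd_cbnd _ c); first by rewrite -E; ring.
apply: integrableS fi => //.
by apply: subset_itv; rewrite bnd_simp.
Qed.

Lemma itg_le a b f g : integrable_itv a b f -> integrable_itv a b g ->
  (forall x, a <= x <= b -> f x <= g x) -> itg a b f <= itg a b g.
Proof.
by move=> fi gi H; apply: le_Rintegral => // x /=; rewrite in_itv/=; exact: H.
Qed.

Lemma cont_itv_cst a b c : cont_itv a b (fun=> c).
Proof. by move=> x _ e e0; exists 1 => // *; rewrite subrr normr0. Qed.

Lemma itg_cst a b c : a <= b -> itg a b (fun=> c) = c * (b - a).
Proof.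
move=> ab; rewrite /itg Rintegral_cst//= lebesgue_measure_itv/= lte_fin.
by have [_|ba] := ltP a b => //=; rewrite (@le_anti _ _ a b) ?ab// subrr.
Qed.

Lemma itg_near a b c e f : a <= b -> integrable_itv a b f ->
  (forall x, a <= x <= b -> `|f x - c| <= e) ->
  `|itg a b f - c * (b - a)| <= e * (b - a).
Proof.
move=> ab fi H.
have i1 k : integrable_itv a b (fun=> k) by apply/cont_itv_integrable/cont_itv_cst.
have Hu : itg a b f <= (c + e) * (b - a).
  by rewrite -itg_cst//; apply: itg_le => // x /H; rewrite ler_norml; lra.
have Hl : (c - e) * (b - a) <= itg a b f.
  by rewrite -itg_cst//; apply: itg_le => // x /H; rewrite ler_norml; lra.
by rewrite ler_norml; apply/andP; split; lra.
Qed.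

Lemma eq_itg a b f g : (forall x, a <= x <= b -> f x = g x) ->
  itg a b f = itg a b g.
Proof.
by move=> fg; apply: eq_Rintegral => x; rewrite inE/= in_itv/=; exact: fg.
Qed.

End IntervalIntegral.

Section Goursat.
Variables (R : realType) (P Q : R -> R -> R).

(* [P + i Q] is complex differentiable at [(x, y)] relatively to the rectangle. *)
Definition cr_at (a1 a2 b1 b2 x y : R) := exists al be : R,
  forall e, 0 < e -> exists2 d : R, 0 < d & forall x' y',
    a1 <= x' <= a2 -> b1 <= y' <= b2 -> `|x' - x| < d -> `|y' - y| < d ->
    `|P x' y' - P x y - (al * (x' - x) - be * (y' - y))|
      <= e * (`|x' - x| + `|y' - y|) /\
    `|Q x' y' - Q x y - (be * (x' - x) + al * (y' - y))|
      <= e * (`|x' - x| + `|y' - y|).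

Variables a1 a2 b1 b2 : R.
Hypothesis a12 : a1 <= a2.
Hypothesis b12 : b1 <= b2.
Hypothesis hol : forall x y, a1 <= x <= a2 -> b1 <= y <= b2 -> cr_at a1 a2 b1 b2 x y.

Lemma cr_cont x y : a1 <= x <= a2 -> b1 <= y <= b2 ->
  forall e, 0 < e -> exists2 d : R, 0 < d & forall x' y',
    a1 <= x' <= a2 -> b1 <= y' <= b2 -> `|x' - x| < d -> `|y' - y| < d ->
    `|P x' y' - P x y| < e /\ `|Q x' y' - Q x y| < e.
Proof.
move=> hx hy e e0; have [al [be /(_ 1 ltr01)[d d0 H]]] := hol hx hy.
pose K := `|al| + `|be| + 1; have K0 : 0 < K by rewrite /K ltr_wpDl ?addr_ge0.
exists (Num.min d (e / (2 * K))); first by rewrite lt_min d0 divr_gt0// mulr_gt0.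
move=> x' y' hx' hy'; rewrite !lt_min => /andP[xd xe] /andP[yd ye].
have [H1 H2] := H x' y' hx' hy' xd yd.
set u := x' - x in H1 H2 xd xe *; set v := y' - y in H1 H2 yd ye *.
have uv : K * (`|u| + `|v|) < e.
  have : 2 * K * `|u| < e by rewrite mulrC -ltr_pdivlMr ?mulr_gt0.
  have : 2 * K * `|v| < e by rewrite mulrC -ltr_pdivlMr ?mulr_gt0.
  lra.
have au : `|al * u| <= `|al| * `|u| by rewrite normrM.
have av : `|al * v| <= `|al| * `|v| by rewrite normrM.
have bu : `|be * u| <= `|be| * `|u| by rewrite normrM.
have bv : `|be * v| <= `|be| * `|v| by rewrite normrM.
have t1 : 0 <= `|al| * `|u| by rewrite mulr_ge0.
have t2 : 0 <= `|al| * `|v| by rewrite mulr_ge0.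
have t3 : 0 <= `|be| * `|u| by rewrite mulr_ge0.
have t4 : 0 <= `|be| * `|v| by rewrite mulr_ge0.
rewrite /K in uv; have n1 (A B C D : R) : `|A - B| <= C -> `|B| <= D -> `|A| <= C + D.
  by move=> AB BD; rewrite -[A](subrK B) (le_trans (ler_normD _ _))// lerD.
split.
  apply: (le_lt_trans (n1 _ _ _ _ H1 (ler_normB _ _))); move: uv au bv t1 t2 t3 t4; clear; lra.
apply: (le_lt_trans (n1 _ _ _ _ H2 (ler_normD _ _))); move: uv av bu t1 t2 t3 t4; clear; lra.
Qed.

(** The real part of the counterclockwise contour integral of [(P + i Q) d(x + i y)]. *)
Definition bdry x1 x2 y1 y2 :=
  itg x1 x2 (fun x => P x y1 - P x y2) - itg y1 y2 (fun y => Q x2 y - Q x1 y).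

Lemma P_integrable y : b1 <= y <= b2 -> integrable_itv a1 a2 (P^~ y).
Proof.
move=> hy; apply: cont_itv_integrable => x hx e /(cr_cont hx hy)[d d0 H].
by exists d => // x' hx' xd; have [|] := H x' y hx' hy xd; rewrite ?subrr ?normr0.
Qed.

Lemma Q_integrable x : a1 <= x <= a2 -> integrable_itv b1 b2 (Q x).
Proof.
move=> hx; apply: cont_itv_integrable => y hy e /(cr_cont hx hy)[d d0 H].
by exists d => // y' hy' yd; have [|_] := H x y' hx hy' _ yd; rewrite ?subrr ?normr0.
Qed.

Lemma bdryE x1 x2 y1 y2 : a1 <= x1 -> x1 <= x2 -> x2 <= a2 ->
    b1 <= y1 -> y1 <= y2 -> y2 <= b2 ->
  bdry x1 x2 y1 y2 = itg x1 x2 (P^~ y1) - itg x1 x2 (P^~ y2)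
                     - (itg y1 y2 (Q x2) - itg y1 y2 (Q x1)).
Proof.
move=> h1 h2 h3 h4 h5 h6; rewrite /bdry !itgB//.
- by apply: (integrable_itvS h4 h6); apply: Q_integrable; lra.
- by apply: (integrable_itvS h4 h6); apply: Q_integrable; lra.
- by apply: (integrable_itvS h1 h3); apply: P_integrable; lra.
- by apply: (integrable_itvS h1 h3); apply: P_integrable; lra.
Qed.

Lemma bdry_quarter x1 x2 y1 y2 xm ym : a1 <= x1 -> x1 <= xm -> xm <= x2 -> x2 <= a2 ->
    b1 <= y1 -> y1 <= ym -> ym <= y2 -> y2 <= b2 ->
  bdry x1 x2 y1 y2 = bdry x1 xm y1 ym + bdry xm x2 y1 ym
                   + bdry x1 xm ym y2 + bdry xm x2 ym y2.
Proof.
move=> h1 h2 h2' h3 h4 h5 h5' h6.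
have [h7 h8] : a1 <= xm /\ xm <= a2 by split; lra.
have [h9 h10] : b1 <= ym /\ ym <= b2 by split; lra.
have h11 := le_trans h2 h2'; have h12 := le_trans h5 h5'.
rewrite !bdryE//.
have iP y : b1 <= y <= b2 -> itg x1 x2 (P^~ y) = itg x1 xm (P^~ y) + itg xm x2 (P^~ y).
  move=> hy; apply: itg_split => //.
  by apply: (integrable_itvS h1 h3); apply: P_integrable.
have iQ x : a1 <= x <= a2 -> itg y1 y2 (Q x) = itg y1 ym (Q x) + itg ym y2 (Q x).
  move=> hx; apply: itg_split => //.
  by apply: (integrable_itvS h4 h6); apply: Q_integrable.
rewrite !iP ?iQ//.
- by ring.
- by rewrite h1 (le_trans h11).
- by rewrite (le_trans h1).
- by rewrite (le_trans h4).
- by rewrite h4 (le_trans h12).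
Qed.

(** The first-order part contributes [be * (x2 - x1) * (y2 - y1)] to each of the two integrals of
    [bdry], and these cancel. At each point of the sides the remainder is at most [e / 2] times the
    half perimeter. *)
Lemma bdry_small x y : a1 <= x <= a2 -> b1 <= y <= b2 ->
  forall e, 0 < e -> exists2 d : R, 0 < d & forall x1 x2 y1 y2,
    a1 <= x1 -> x1 <= x <= x2 -> x2 <= a2 -> b1 <= y1 -> y1 <= y <= y2 -> y2 <= b2 ->
    x2 - x1 < d -> y2 - y1 < d ->
    `|bdry x1 x2 y1 y2| <= e * ((x2 - x1) + (y2 - y1)) ^+ 2.
Proof.
move=> hx hy e e0; have [al [be H]] := hol hx hy.
have e20 : 0 < e / 2 by rewrite divr_gt0.
have [d d0 {}H] := H _ e20; exists d => // x1 x2 y1 y2 h1 hx' h2 h3 hy' h4 xd yd.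
set w := x2 - x1 in xd *; set h := y2 - y1 in yd *.
have pt x' y' : x1 <= x' <= x2 -> y1 <= y' <= y2 ->
    `|P x' y' - P x y - (al * (x' - x) - be * (y' - y))| <= e / 2 * (w + h) /\
    `|Q x' y' - Q x y - (be * (x' - x) + al * (y' - y))| <= e / 2 * (w + h).
  move=> kx ky.
  have ux : `|x' - x| <= w by rewrite /w ler_norml; lra.
  have uy : `|y' - y| <= h by rewrite /h ler_norml; lra.
  have [| | | |K1 K2] := H x' y'; try lra.
  have : e / 2 * (`|x' - x| + `|y' - y|) <= e / 2 * (w + h) by rewrite ler_pM2l// lerD.
  by move=> K; split; apply: le_trans K.
have iP : `|itg x1 x2 (fun x => P x y1 - P x y2) - be * h * (x2 - x1)| <= e * (w + h) * (x2 - x1).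
  apply: itg_near; first lra.
    apply: (integrable_itvS h1 h2); apply: integrable_itvB; apply: P_integrable; lra.
  move=> x' kx; have [|+ _] := pt x' y1 kx; first lra.
  have [|+ _] := pt x' y2 kx; first lra.
  by rewrite !ler_norml /h; lra.
have iQ : `|itg y1 y2 (fun y => Q x2 y - Q x1 y) - be * w * (y2 - y1)| <= e * (w + h) * (y2 - y1).
  apply: itg_near; first lra.
    apply: (integrable_itvS h3 h4); apply: integrable_itvB; apply: Q_integrable; lra.
  move=> y' ky; have [|_ +] := pt x1 y' _ ky; first lra.
  have [|_ +] := pt x2 y' _ ky; first lra.
  by rewrite !ler_norml /w; lra.
move: iP iQ; rewrite /bdry -/w -/h !ler_norml => /andP[? ?] /andP[? ?].
by apply/andP; split; nra.
Qed.

(** Goursat's subdivision: some quarter always keeps at least a quarter of the boundary integral, so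
    level [n] keeps [eta / 4 ^+ n]; at the point common to all the rectangles, [bdry_small] gives a
    smaller bound. *)
Lemma goursat : bdry a1 a2 b1 b2 = 0.
Proof.
apply/eqP/negPn/negP => J0; set eta := `|bdry a1 a2 b1 b2|.
have eta0 : 0 < eta by rewrite normr_gt0.
pose w n : R := (a2 - a1) / 2 ^+ n; pose h n : R := (b2 - b1) / 2 ^+ n.
have wS n : w n = w n.+1 + w n.+1 by rewrite /w exprSr; field; rewrite expf_neq0.
have hS n : h n = h n.+1 + h n.+1 by rewrite /h exprSr; field; rewrite expf_neq0.
have w0 n : 0 <= w n by rewrite divr_ge0 ?exprn_ge0 ?subr_ge0.
have h0 n : 0 <= h n by rewrite divr_ge0 ?exprn_ge0 ?subr_ge0.
pose J n (s : R * R) := bdry s.1 (s.1 + w n) s.2 (s.2 + h n).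
(* The offset of the first quarter with a large enough integral. The last quarter is taken by
   default, which [step_in] justifies by the triangle inequality. *)
pose pick n (s : R * R) : R * R :=
  if `|J n s| <= 4 * `|J n.+1 s| then (0, 0) else
  if `|J n s| <= 4 * `|J n.+1 (s.1 + w n.+1, s.2)| then (w n.+1, 0) else
  if `|J n s| <= 4 * `|J n.+1 (s.1, s.2 + h n.+1)| then (0, h n.+1)
  else (w n.+1, h n.+1).
pose step n s : R * R := (s.1 + (pick n s).1, s.2 + (pick n s).2).
pose st := fix st n := if n is m.+1 then step m (st m) else (a1, b1).
pose inside n (s : R * R) := [/\ a1 <= s.1, s.1 + w n <= a2, b1 <= s.2 & s.2 + h n <= b2].
have stE n : st n.+1 = step n (st n) by [].
have pick_in n s : 0 <= (pick n s).1 <= w n.+1 /\ 0 <= (pick n s).2 <= h n.+1.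
  by rewrite /pick; do 3?[case: ifP => _]; rewrite /= ?lexx ?w0 ?h0.
have step_in n s : inside n s -> [/\ inside n.+1 (step n s),
   s.1 <= (step n s).1 <= s.1 + w n.+1, s.2 <= (step n s).2 <= s.2 + h n.+1 &
   `|J n s| <= 4 * `|J n.+1 (step n s)|].
  case=> i1 i2 i3 i4; have := w0 n.+1; have := h0 n.+1; have := wS n; have := hS n.
  move=> e1 e2 p1 p2; have [/andP[q1 q2] /andP[q3 q4]] := pick_in n s.
  have JE : J n s = J n.+1 s + J n.+1 (s.1 + w n.+1, s.2) + J n.+1 (s.1, s.2 + h n.+1)
    + J n.+1 (s.1 + w n.+1, s.2 + h n.+1).
    rewrite /J/= (@bdry_quarter _ _ _ _ (s.1 + w n.+1) (s.2 + h n.+1)) ?e1 ?e2 ?addrA ?lerDl//.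
      by rewrite -addrA -e2 i2.
    by rewrite -addrA -e1 i4.
  rewrite /step; split => /=.
  - split => /=; rewrite ?ler_wpDr//.
      by rewrite (le_trans _ i2)// e2 -addrA lerD2l lerD2r.
    by rewrite (le_trans _ i4)// e1 -addrA lerD2l lerD2r.
  - by rewrite lerDl q1 lerD2l.
  - by rewrite lerDl q3 lerD2l.
  rewrite /pick; case: ifPn => [|k1]; first by rewrite !addr0 -surjective_pairing.
  case: ifPn => [|k2]; first by rewrite addr0.
  case: ifPn => [|k3]; first by rewrite addr0.
  rewrite leNgt; apply/negP => k4; move: k1 k2 k3; rewrite -!ltNge.
  have : `|J n s| <= `|J n.+1 s| + `|J n.+1 (s.1 + w n.+1, s.2)|
    + `|J n.+1 (s.1, s.2 + h n.+1)| + `|J n.+1 (s.1 + w n.+1, s.2 + h n.+1)|.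
    rewrite {1}JE (le_trans (ler_normD _ _))// lerD2r (le_trans (ler_normD _ _))// lerD2r.
    exact: ler_normD.
  move: k4; clear; lra.
have st_in n : inside n (st n).
  elim: n => [|n IH]; first by rewrite /inside /w /h /= !divr1; split; lra.
  by rewrite stE; case: (step_in n _ IH).
have stJ n : eta <= 4 ^+ n * `|J n (st n)|.
  elim: n => [|n IH]; first by rewrite expr0 mul1r /J /w /h /= !divr1 ![_ + (_ - _)]addrC !subrK.
  apply: (le_trans IH); rewrite exprSr -mulrA ler_pM2l ?exprn_gt0// stE.
  by case: (step_in n _ (st_in n)).
have mono n m : (n <= m)%N -> (st n).1 <= (st m).1 /\ (st m).1 + w m <= (st n).1 + w n /\
    (st n).2 <= (st m).2 /\ (st m).2 + h m <= (st n).2 + h n.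
  move=> /subnKC <-; elim: (m - n)%N => [|k [IH1 [IH2 [IH3 IH4]]]]; first by rewrite addn0.
  rewrite addnS stE; have [_ + + _] := step_in _ _ (st_in (n + k)%N).
  move=> /andP[k1 k2] /andP[k3 k4]; rewrite (le_trans IH1)// (le_trans IH3)//; split => //; split; last split => //.
    by rewrite (le_trans _ IH2)// (wS (n + k)%N) addrA lerD2r.
  by rewrite (le_trans _ IH4)// (hS (n + k)%N) addrA lerD2r.
have lim (u v : nat -> R) : (forall n m, u n <= v m) -> exists x, forall n, u n <= x <= v n.
  move=> uv; exists (sup (range u)) => n; apply/andP; split.
    by apply: ub_le_sup; [exists (v 0%N) => _ [m _ <-]; exact: uv|exists n].
  by apply: ge_sup; [exists (u 0%N); exists 0%N|move=> _ [m _ <-]; exact: uv].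
have [x hx] : exists x, forall n, (st n).1 <= x <= (st n).1 + w n.
  apply: (lim (fun n => (st n).1)) => n m.
  have [k1 [k2 _]] := mono _ _ (leq_maxl n m); have [k3 [k4 _]] := mono _ _ (leq_maxr n m).
  have := w0 (maxn n m); lra.
have [y hy] : exists y, forall n, (st n).2 <= y <= (st n).2 + h n.
  apply: (lim (fun n => (st n).2)) => n m.
  have [_ [_ [k1 k2]]] := mono _ _ (leq_maxl n m); have [_ [_ [k3 k4]]] := mono _ _ (leq_maxr n m).
  have := h0 (maxn n m); lra.
have := hx 0%N; have := hy 0%N; rewrite /w /h /= !divr1 => hy0 hx0.
have hx0' : a1 <= x <= a2 by lra.
have hy0' : b1 <= y <= b2 by lra.
(* [w n + h n <= S / 2 ^+ n], where the [1] keeps [S] positive for a degenerate rectangle; [e] makes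
   [e * (S / 2 ^+ n) ^+ 2] half of [eta / 4 ^+ n]. *)
pose S := (a2 - a1) + (b2 - b1) + 1; have S0 : 0 < S by rewrite /S; lra.
pose e := eta / (2 * S ^+ 2); have e0 : 0 < e by rewrite divr_gt0// mulr_gt0// exprn_gt0.
have [d d0 H] := bdry_small hx0' hy0' e0.
have [n nd] : exists n : nat, S / 2 ^+ n < d.
  have [n] := archimedean.Num.Theory.archi_boundP (divr_ge0 (ltW S0) (ltW d0)).
  exists (archimedean.Num.bound (S / d)).
  rewrite ltr_pdivrMr ?exprn_gt0// -ltr_pdivrMl// mulrC.
  apply: (lt_le_trans (archimedean.Num.Theory.archi_boundP _)); first by rewrite divr_ge0// ltW.
  by rewrite -natrX ler_nat ltnW// ltn_expl.
have pn : 0 < 2 ^+ n :> R by rewrite exprn_gt0.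
have wd : w n < d by apply: le_lt_trans nd; rewrite ler_pM2r ?invr_gt0// /S; lra.
have hd : h n < d by apply: le_lt_trans nd; rewrite ler_pM2r ?invr_gt0// /S; lra.
have [i1 i2 i3 i4] := st_in n.
have addK (u v : R) : u + v - u = v by rewrite addrC addKr.
have := H _ _ _ _ i1 (hx n) i2 i3 (hy n) i4; rewrite !addK => /(_ wd hd).
rewrite -/(J n (st n)) => K.
have := stJ n; apply/negP; rewrite -ltNge.
have E : 4 ^+ n = 2 ^+ n * 2 ^+ n :> R by rewrite -exprMn; congr (_ ^+ _); lra.
have E2 : w n + h n <= S / 2 ^+ n by rewrite /w /h /S -mulrDl ler_pM2r ?invr_gt0//; lra.
have E3 : e * (w n + h n) ^+ 2 <= eta / 2 / 4 ^+ n.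
  have -> : eta / 2 / 4 ^+ n = e * (S / 2 ^+ n) ^+ 2.
    by rewrite /e E; field; rewrite !gt_eqF.
  rewrite ler_pM2l// ler_pXn2r ?nnegrE ?addr_ge0// divr_ge0//; exact: ltW.
have : 4 ^+ n * `|J n (st n)| <= 4 ^+ n * (eta / 2 / 4 ^+ n).
  by rewrite ler_pM2l ?exprn_gt0//; apply: le_trans E3.
rewrite [X in _ <= X]mulrC divfK ?gt_eqF ?exprn_gt0// => /le_lt_trans; apply.
by rewrite ltr_pdivrMr// ltr_pMr// ltr1n.
Qed.

End Goursat.

(** * Compactness and uniform continuity *)

Section Compactness.
Variable R : realType.

Lemma complex_continuous : continuous (fun p : R * R => (p.1 +i* p.2 : C1 R)).
Proof.
move=> p A /nbhs_rnorm[e e0 eA]; apply/nbhs_ballP; exists (e / 2).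
  by rewrite /= divr_gt0.
move=> q [/= h1 h2]; apply: eA; apply: le_lt_trans (rnorm_le_ReIm _) _.
by move: h1 h2; rewrite /ball/= (distrC p.1) (distrC p.2); lra.
Qed.

Lemma compact_C1_ball (r : R) : compact [set c : C1 R | rnorm c <= r].
Proof.
have cK : compact [set c : C1 R | `|complex.Re c| <= r /\ `|complex.Im c| <= r].
  have -> : [set c : C1 R | `|complex.Re c| <= r /\ `|complex.Im c| <= r] =
      (fun p : R * R => (p.1 +i* p.2 : C1 R)) @` (`[- r, r] `*` `[- r, r]).
    apply/seteqP; split=> [[x y] /= [hx hy]|_ [[x y] /= [hx hy] <-]].
      by exists (x, y) => //=; rewrite !in_itv/= -!ler_norml.
    by move: hx hy; rewrite /= !in_itv/= -!ler_norml.
  apply: continuous_compact; last by apply: compact_setX; exact: segment_compact.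
  by apply: continuous_subspaceT; exact: complex_continuous.
apply: subclosed_compact cK _; last first.
  by move=> c /= h; split; apply: le_trans h; rewrite (ler_Re_rnorm, ler_Im_rnorm).
have -> : [set c : C1 R | rnorm c <= r] = @rnorm R (C1 R) @^-1` [set x | x <= r] by [].
by apply: closed_comp; [move=> ? _; exact: rnorm_continuous|exact: closed_le].
Qed.

Lemma compact_C2_ball (r : R) : compact [set p : C2 R | rnorm p <= r].
Proof.
have -> : [set p : C2 R | rnorm p <= r] =
    [set c : C1 R | rnorm c <= r] `*` [set c : C1 R | rnorm c <= r].
  by apply/seteqP; split => [[x y]|[x y] []] /=; rewrite rnorm_pair ge_max/=;
     [case/andP|move=> -> ->].
by apply: compact_setX; exact: compact_C1_ball.
Qed.

(** [compact_near_coveringP] for the filter at infinity: a threshold on [n] that is local in [x]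
    becomes common to [K]. Radii are passed through it as [1 / (n + 1)] and norm bounds as [n]. *)
Lemma compact_uniform (V : normedModType R[i]) (K : set V) (P : nat -> V -> Prop) :
  compact K ->
  (forall x, K x -> exists2 d : R, 0 < d & exists N, forall x' n,
     K x' -> rnorm (x' - x) < d -> (N <= n)%N -> P n x') ->
  exists N, forall n x, (N <= n)%N -> K x -> P n x.
Proof.
move=> /compact_near_coveringP cK H.
have [] := cK _ \oo (fun n x => K x -> P n x) _.
  move=> x /H[d d0 [N NP]]; exists ([set x' | rnorm (x' - x) < d], [set n | (N <= n)%N]).
    by split; [apply/nbhs_rnorm; exists d|exists N].
  by move=> [x' n] /= [xd Nn] Kx'; exact: NP.
by move=> N _ NP; exists N => n x Nn Kx; apply: (NP n Nn).
Qed.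

Lemma inv_lt_archi (d : R) : 0 < d -> exists N : nat, forall n, (N <= n)%N -> n.+1%:R^-1 < d.
Proof.
move=> d0; have dV : 0 <= d^-1 by rewrite invr_ge0 ltW.
exists (archimedean.Num.bound d^-1) => n Nn.
rewrite -[X in _ < X]invrK ltf_pV2 ?posrE ?invr_gt0 ?ltr0n//.
apply: (lt_le_trans (archimedean.Num.Theory.archi_boundP dV)).
by rewrite ler_nat (leq_trans Nn).
Qed.

Definition cont_on (V W : normedModType R[i]) (K : set V) (f : V -> W) :=
  forall x, K x -> forall e : R, 0 < e -> exists2 d : R, 0 < d &
    forall x', K x' -> rnorm (x' - x) < d -> rnorm (f x' - f x) < e.

Lemma heine (V W : normedModType R[i]) (K : set V) (f : V -> W) :
  compact K -> cont_on K f -> forall e : R, 0 < e -> exists2 d : R, 0 < d &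
    forall x x', K x -> K x' -> rnorm (x' - x) < d -> rnorm (f x' - f x) < e.
Proof.
move=> cK fc e e0.
have [] := @compact_uniform V K (fun n x => forall x', K x' ->
    rnorm (x' - x) < n.+1%:R^-1 -> rnorm (f x' - f x) < e) cK _.
  move=> x Kx; have e20 : 0 < e / 2 by rewrite divr_gt0.
  have [d d0 dH] := fc x Kx _ e20; have d20 : 0 < d / 2 by rewrite divr_gt0.
  exists (d / 2) => //; have [N NP] := inv_lt_archi d20; exists N.
  move=> x' n Kx' xd Nn y Ky yx'.
  have h1 : rnorm (f x' - f x) < e / 2 by apply: dH => //; lra.
  have h2 : rnorm (f y - f x) < e / 2.
    apply: dH => //; have := rnormBD x' y x; have := lt_trans yx' (NP n Nn); lra.
  have := rnormBD (f x) (f y) (f x'); rewrite (rdistC (f x) (f x')); lra.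
move=> N NP; exists (N.+1%:R^-1); first by rewrite invr_gt0.
by move=> x x' Kx Kx'; apply: (NP N) => //.
Qed.

Lemma cont_on_bounded (V W : normedModType R[i]) (K : set V) (f : V -> W) :
  compact K -> cont_on K f -> exists2 M : R, 0 < M & forall x, K x -> rnorm (f x) <= M.
Proof.
move=> cK fc.
have [] := @compact_uniform V K (fun n x => rnorm (f x) <= n%:R) cK _.
  move=> x Kx; have [d d0 dH] := fc x Kx 1 ltr01; exists d => //.
  have h0 : 0 <= rnorm (f x) + 1 by rewrite addr_ge0 ?rnorm_ge0.
  exists (archimedean.Num.bound (rnorm (f x) + 1)) => x' n Kx' xd Nn.
  have := archimedean.Num.Theory.archi_boundP h0.
  have : (archimedean.Num.bound (rnorm (f x) + 1))%:R <= n%:R :> R by rewrite ler_nat.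
  have := dH x' Kx' xd; have := rnorm_lbB (f x') (f x); lra.
move=> N NP; exists N.+1%:R; first by rewrite ltr0n.
by move=> x Kx; apply: (NP N.+1).
Qed.

Lemma continuous_cont_on (V W : normedModType R[i]) (K : set V) (f : V -> W) :
  (forall x, K x -> {for x, continuous f}) -> cont_on K f.
Proof.
move=> fc x Kx e e0; have [d d0 H] := (cvg_rnorm f x).1 (fc x Kx) e e0.
by exists d => // x' _; exact: H.
Qed.

End Compactness.

(** * The complex exponential *)

Section ComplexExp.
Variable R : realType.

Definition cis (t : R) : C1 R := cos t +i* sin t.

Lemma rnorm_cis t : rnorm (cis t) = 1.
Proof. by apply/eqP; rewrite -(@eqrXn2 _ 2)// ?rnorm_ge0// rnormEsq/= cos2Dsin2 expr1n. Qed.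

Lemma cis0 : cis 0 = 1.
Proof. by rewrite /cis cos0 sin0. Qed.

Lemma cis2pi : cis (2 * pi) = 1.
Proof. by rewrite /cis mulr_natl cos2pi sin2pi. Qed.

Definition cexp (z : C1 R) : C1 R := (expR (complex.Re z))%:C * cis (complex.Im z).

Lemma cexpD z w : cexp (z + w) = cexp z * cexp w.
Proof.
case: z w => [a b] [c d]; rewrite /cexp /cis /= expRD cosD sinD.
by simpc; congr Complex; ring.
Qed.

Lemma rnorm_cexp z : rnorm (cexp z) = expR (complex.Re z).
Proof. by rewrite rnormM rnorm_cis mulr1 rnorm_real ger0_norm// expR_ge0. Qed.

Lemma cexp_neq0 z : cexp z != 0.
Proof. by rewrite -rnorm_gt0 rnorm_cexp expR_gt0. Qed.

Lemma is_derive_estimate (f : R -> R) (x l : R) : is_derive x 1 f l ->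
  forall e, 0 < e -> exists2 d : R, 0 < d &
    forall h, `|h| < d -> `|f (x + h) - f x - l * h| <= e * `|h|.
Proof.
move=> [df dl] e e0; have /eqaddoP/(_ e e0) := derivable_nbhs df.
move=> /nbhs_ballP[d /= d0 H]; exists d => // h hd.
have := H h; rewrite /ball/= sub0r normrN => /(_ hd); rewrite !fctE /= dl.
by rewrite /GRing.scale/= mulr1 (addrC h) (mulrC h) opprD addrA.
Qed.

Lemma cexp_near0 e : 0 < e -> exists2 d : R, 0 < d &
  forall h : C1 R, rnorm h < d -> rnorm (cexp h - 1 - h) <= e * rnorm h.
Proof.
move=> e0; pose k := Num.min (e / 16) 1.
have k0 : 0 < k by rewrite lt_min ltr01 divr_gt0.
have [k1 ke] : k <= 1 /\ 16 * k <= e.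
  by split; rewrite /k; [rewrite ge_min lexx orbT|rewrite mulrC -ler_pdivlMr// ge_min lexx].
have [d1 d10 H1] := is_derive_estimate (is_derive_expR 0) k0.
have [d2 d20 H2] := is_derive_estimate (is_derive_cos 0) k0.
have [d3 d30 H3] := is_derive_estimate (is_derive_sin 0) k0.
exists (Num.min (Num.min d1 d2) (Num.min d3 (k / 2))).
  by rewrite !lt_min d10 d20 d30 divr_gt0.
case=> x y; rewrite !lt_min => /andP[/andP[hd1 hd2] /andP[hd3 hd4]].
have hx : `|x| <= rnorm (x +i* y : C1 R) by exact: (@ler_Re_rnorm R (x +i* y)).
have hy : `|y| <= rnorm (x +i* y : C1 R) by exact: (@ler_Im_rnorm R (x +i* y)).
set r := rnorm _ in hd1 hd2 hd3 hd4 hx hy *.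
have {H1} := H1 x (le_lt_trans hx hd1).
have {H2} := H2 y (le_lt_trans hy hd2).
have {H3} := H3 y (le_lt_trans hy hd3).
rewrite !add0r expR0 cos0 sin0 oppr0 mul0r !mul1r !subr0 ?addr0 => s1 c1 e1.
have e2 : `|expR x| <= 3.
  have -> : expR x = (expR x - 1 - x) + 1 + x by ring.
  rewrite (le_trans (ler_normD _ _))// (le_trans (lerD (ler_normD _ _) (lexx _)))//.
  rewrite normr1; have := normr_ge0 x; nra.
apply: le_trans (rnorm_le_ReIm _) _; rewrite /cexp /cis /=; simpc => /=.
have -> : expR x * cos y - 1 - x = (expR x - 1 - x) + expR x * (cos y - 1) by ring.
have -> : expR x * sin y - y = expR x * (sin y - y) + (expR x - 1 - x) * y + x * y by ring.
have t1 : `|expR x * (cos y - 1)| <= 3 * (k * `|y|) by rewrite normrM ler_pM.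
have t2 : `|expR x * (sin y - y)| <= 3 * (k * `|y|) by rewrite normrM ler_pM.
have yk : `|y| <= k by lra.
have t3 : `|(expR x - 1 - x) * y| <= k * `|x| * k by rewrite normrM ler_pM.
have t4 : `|x * y| <= `|x| * (k / 2) by rewrite normrM ler_wpM2l//; lra.
have n1 := ler_normD (expR x - 1 - x) (expR x * (cos y - 1)).
have n2 := ler_normD (expR x * (sin y - y) + (expR x - 1 - x) * y) (x * y).
have n3 := ler_normD (expR x * (sin y - y)) ((expR x - 1 - x) * y).
have r0 : 0 <= r by apply: rnorm_ge0.
have q1 : k * `|y| <= k * r by rewrite ler_pM2l.
have q2 : k * `|x| <= k * r by rewrite ler_pM2l.
have q3 : k * `|x| * k <= k * r by rewrite (le_trans _ q2)// ler_piMr// mulr_ge0// ltW.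
have q4 : `|x| * (k / 2) <= k * r / 2 by rewrite mulrA ler_pM2r// mulrC.
have q5 : 16 * k * r <= e * r by rewrite ler_wpM2r.
have q6 : 0 <= k * r by rewrite mulr_ge0// ltW.
move: e1 t1 t2 t3 t4 n1 n2 n3 q1 q2 q3 q4 q5 q6; clear; lra.
Qed.

Lemma C1_differentiable (u : C1 R -> C1 R) (z D : C1 R) :
  (forall e : R, 0 < e -> exists2 d : R, 0 < d &
    forall h, rnorm h < d -> rnorm (u (z + h) - u z - D * h) <= e * rnorm h) ->
  differentiable u z.
Proof.
move=> H.
have lD : linear (fun h : C1 R => D * h : C1 R).
  by move=> a x y /=; rewrite mulrDr /GRing.scale/= mulrCA.
pose L : {linear C1 R -> C1 R} := HB.pack (fun h : C1 R => D * h : C1 R)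
  (GRing.isLinear.Build _ _ _ _ _ lD).
by apply: (@rnorm_differentiable R _ _ u z L (rnorm D)) => // v; rewrite /= rnormM.
Qed.

Lemma C1_differentiableE (u : C1 R -> C1 R) (z : C1 R) : differentiable u z ->
  exists D : C1 R, forall e : R, 0 < e -> exists2 d : R, 0 < d &
    forall h, rnorm h < d -> rnorm (u (z + h) - u z - D * h) <= e * rnorm h.
Proof.
move=> /differentiable_rnorm H; set L := 'd u z in H; exists (L 1) => e /H[d d0 dH]; exists d => // h /dH.
suff -> : L h = L 1 * h by [].
by have := linearZ_LR L h 1; rewrite /GRing.scale /= mulr1 mulrC.
Qed.

Lemma differentiable_cexp z : differentiable cexp z.
Proof.
apply: (@C1_differentiable _ _ (cexp z)) => e e0.
have k0 : 0 < e / rnorm (cexp z) by rewrite divr_gt0// rnorm_gt0 cexp_neq0.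
have [d d0 H] := cexp_near0 k0; exists d => // h /H.
have -> : cexp (z + h) - cexp z - cexp z * h = cexp z * (cexp h - 1 - h) :> C1 R.
  by rewrite cexpD; ring.
rewrite rnormM mulrAC ler_pdivlMr 1?mulrC//.
by rewrite rnorm_gt0 cexp_neq0.
Qed.

End ComplexExp.

(** * Means over the unit circle *)

Section CircleMean.
Variable R : realType.
Implicit Types (V W : C1 R -> R) (u : C1 R -> C1 R).

Definition circle := [set w : C1 R | rnorm w = 1].

Definition cmean V : R := (2 * pi)^-1 * itg 0 (2 * pi) (fun t => V (cis t)).

Definition circle_cont V := forall w, circle w -> forall e, 0 < e ->
  exists2 d : R, 0 < d & forall w', circle w' -> rnorm (w' - w) < d -> `|V w' - V w| < e.

Lemma cis_estimate (t : R) e : 0 < e -> exists2 d : R, 0 < d &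
  forall t', `|t' - t| < d -> rnorm (cis t' - cis t) < e.
Proof.
move=> e0; have zc : {for (0 +i* t : C1 R), continuous (@cexp R)}.
  by apply: differentiable_continuous; exact: differentiable_cexp.
have [d d0 H] := (cvg_rnorm _ _).1 zc _ e0; exists d => // t' td.
have cE s : cexp (0 +i* s : C1 R) = cis s by rewrite /cexp /= expR0 mul1r.
rewrite -!cE; apply: H; apply: le_lt_trans (rnorm_le_ReIm _) _.
by rewrite /= subrr normr0 add0r.
Qed.

Lemma circle_cont_integrable V : circle_cont V ->
  integrable_itv 0 (2 * pi) (fun t => V (cis t)).
Proof.
move=> Vc; apply: cont_itv_integrable => t _ e e0.
have [d d0 H] := Vc (cis t) (rnorm_cis t) e e0.
have [d' d'0 H'] := cis_estimate t d0; exists d' => // t' _ /H' k.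
by apply: H k; exact: rnorm_cis.
Qed.

Lemma twopi_gt0 : 0 < 2 * pi :> R.
Proof. by rewrite mulr_gt0// pi_gt0. Qed.

Lemma cmeanD V W : circle_cont V -> circle_cont W ->
  cmean (fun w => V w + W w) = cmean V + cmean W.
Proof.
move=> /circle_cont_integrable iV /circle_cont_integrable iW.
by rewrite /cmean -mulrDr; congr (_ * _); rewrite /itg RintegralD.
Qed.

Lemma cmeanZ c V : circle_cont V -> cmean (fun w => c * V w) = c * cmean V.
Proof.
move=> /circle_cont_integrable iV.
by rewrite /cmean mulrCA; congr (_ * _); rewrite /itg RintegralZl.
Qed.

Lemma cmean_cst c : cmean (fun=> c) = c.
Proof.
rewrite /cmean itg_cst; last exact: ltW twopi_gt0.
by rewrite subr0 mulrCA mulVf ?mulr1// gt_eqF// twopi_gt0.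
Qed.

Lemma circle_contD V W : circle_cont V -> circle_cont W -> circle_cont (fun w => V w + W w).
Proof.
move=> Vc Wc w hw e e0; have e20 : 0 < e / 2 by rewrite divr_gt0.
have [d d0 H] := Vc w hw _ e20; have [d' d'0 H'] := Wc w hw _ e20.
exists (Num.min d d'); first by rewrite lt_min d0.
move=> w' hw'; rewrite lt_min => /andP[/(H _ hw') h1 /(H' _ hw') h2].
rewrite opprD addrACA (le_lt_trans (ler_normD _ _))//; lra.
Qed.

Lemma circle_contZ c V : circle_cont V -> circle_cont (fun w => c * V w).
Proof.
move=> Vc w hw e e0; have c0 : 0 < `|c| + 1 by rewrite ltr_wpDl.
have [d d0 H] := Vc w hw _ (divr_gt0 e0 c0); exists d => // w' hw' /(H _ hw').
rewrite ltr_pdivlMr// -mulrBr normrM mulrC => k; apply: le_lt_trans k.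
by apply: ler_wpM2r => //; rewrite lerDl.
Qed.

Lemma circle_cont_cst c : circle_cont (fun=> c).
Proof. by move=> w _ e e0; exists 1 => // *; rewrite subrr normr0. Qed.

Lemma le_cmean V W : circle_cont V -> circle_cont W ->
  (forall w, circle w -> V w <= W w) -> cmean V <= cmean W.
Proof.
move=> /circle_cont_integrable iV /circle_cont_integrable iW H.
rewrite /cmean ler_pM2l ?invr_gt0 ?twopi_gt0//; apply: itg_le => // t _; apply: H.
exact: rnorm_cis.
Qed.

Lemma eq_cmean V W : (forall w, circle w -> V w = W w) -> cmean V = cmean W.
Proof.
by move=> H; rewrite /cmean; congr (_ * _); apply: eq_itg => t _; apply: H; exact: rnorm_cis.
Qed.

Lemma cmean_norm V B : circle_cont V -> (forall w, circle w -> `|V w| <= B) -> `|cmean V| <= B.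
Proof.
move=> Vc H; rewrite ler_norml; apply/andP; split.
  rewrite -[X in X <= _]cmean_cst; apply: le_cmean => //; first exact: circle_cont_cst.
  by move=> w /H; rewrite ler_norml => /andP[].
rewrite -[X in _ <= X]cmean_cst; apply: le_cmean => //; first exact: circle_cont_cst.
by move=> w /H; rewrite ler_norml => /andP[].
Qed.

(** The exponential maps the rectangle [[ln r1, ln r2] x [0, 2 pi]] onto the annulus. By periodicity
    the horizontal sides cancel in [bdry]; the vertical sides, where [bdry] integrates [Q], are the
    two circles, hence the imaginary parts. *)
Lemma annulus_mean u (r1 r2 : R) : 0 < r1 -> r1 <= r2 ->
  (forall c, r1 <= rnorm c <= r2 -> differentiable u c) ->
  cmean (fun w => complex.Im (u (r1%:C * w))) = cmean (fun w => complex.Im (u (r2%:C * w))).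
Proof.
move=> r10 r12 ud; have r20 := lt_le_trans r10 r12.
pose g (x y : R) : C1 R := u (cexp (x +i* y)).
have gE x y : g x y = u ((expR x)%:C * cis y) by [].
have gdiff x y : ln r1 <= x <= ln r2 -> 0 <= y <= 2 * pi -> cr_at
    (fun x y => complex.Re (g x y)) (fun x y => complex.Im (g x y))
    (ln r1) (ln r2) 0 (2 * pi) x y.
  move=> /andP[hx1 hx2] _.
  have dg : differentiable (u \o @cexp R) (x +i* y : C1 R).
    apply: differentiable_comp; first exact: differentiable_cexp.
    apply: ud; rewrite rnorm_cexp /=.
    by rewrite -[r1]lnK ?posrE// -[r2]lnK ?posrE// !ler_expR hx1.
  have [D H] := C1_differentiableE dg; exists (complex.Re D), (complex.Im D) => e e0.
  have [d d0 dH] := H e e0; exists (d / 2); first by rewrite divr_gt0.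
  move=> x' y' _ _ xd yd.
  have hh : rnorm ((x' - x) +i* (y' - y) : C1 R) <= `|x' - x| + `|y' - y|.
    exact: rnorm_le_ReIm.
  have hd : rnorm ((x' - x) +i* (y' - y) : C1 R) < d by lra.
  have xyE : (x +i* y : C1 R) + ((x' - x) +i* (y' - y)) = x' +i* y'.
    by apply/eqP; rewrite eq_complex /= ![_ + (_ - _)]addrC !subrK !eqxx.
  have := dH _ hd; rewrite /= xyE => K.
  have {}K : rnorm (g x' y' - g x y - D * ((x' - x) +i* (y' - y)) : C1 R) <=
     e * (`|x' - x| + `|y' - y|) by apply: le_trans K _; rewrite ler_pM2l.
  have RD : complex.Re (D * ((x' - x) +i* (y' - y)) : C1 R) =
     complex.Re D * (x' - x) - complex.Im D * (y' - y) by case: (D).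
  have ID : complex.Im (D * ((x' - x) +i* (y' - y)) : C1 R) =
     complex.Im D * (x' - x) + complex.Re D * (y' - y) by case: (D) => ? ? /=; rewrite addrC.
  split; apply: le_trans K.
    by rewrite -RD -!raddfB; exact: ler_Re_rnorm.
  by rewrite -ID -!raddfB; exact: ler_Im_rnorm.
have l12 : ln r1 <= ln r2 by rewrite ler_ln ?posrE.
have := goursat l12 (ltW twopi_gt0) gdiff; rewrite (bdryE gdiff)//; last exact: ltW twopi_gt0.
have -> : itg (ln r1) (ln r2) (fun x => complex.Re (g x 0)) =
    itg (ln r1) (ln r2) (fun x => complex.Re (g x (2 * pi))).
  by apply: eq_itg => x _; rewrite !gE cis0 cis2pi.
rewrite subrr sub0r => /eqP; rewrite oppr_eq0 subr_eq0 => /eqP E.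
rewrite /cmean; congr (_ * _); move: E; under eq_itg do rewrite gE lnK ?posrE//.
by move=> ->; apply: eq_itg => t _; rewrite gE lnK ?posrE.
Qed.

End CircleMean.

(** * Mean values on circles and the maximum principle *)

Section ContOn.
Variable R : realType.
Variables (V : normedModType R[i]) (K : set V).
Implicit Types (f g : V -> C1 R).

Lemma cont_onP (W : normedModType R[i]) (f : V -> W) :
  cont_on K f <-> forall x, K x -> f @ within K (nbhs x) --> f x.
Proof.
split=> [H x Kx A /nbhs_rnorm[e e0 eA]|H x Kx e e0].
  have [d d0 dH] := H x Kx e e0.
  rewrite /= nbhs_simpl /= /within/=; apply/nbhs_rnorm; exists d => // q qd Kq.
  by apply: eA; exact: dH.
have : nbhs (f x) [set y | rnorm (y - f x) < e] by apply/nbhs_rnorm; exists e.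
move=> /(H x Kx) /=; rewrite nbhs_simpl /= /within/= => /nbhs_rnorm[d d0 dH].
by exists d => // q Kq /dH; apply.
Qed.

Lemma cont_onD f g : cont_on K f -> cont_on K g -> cont_on K (fun x => f x + g x : C1 R).
Proof.
move=> /cont_onP Hf /cont_onP Hg; apply/cont_onP => x Kx.
by apply: cvgD; [exact: Hf|exact: Hg].
Qed.

Lemma cont_onN f : cont_on K f -> cont_on K (fun x => - f x : C1 R).
Proof. by move=> /cont_onP Hf; apply/cont_onP => x Kx; apply: cvgN; exact: Hf. Qed.

Lemma cont_onB f g : cont_on K f -> cont_on K g -> cont_on K (fun x => f x - g x : C1 R).
Proof. by move=> Hf Hg; apply: cont_onD => //; exact: cont_onN. Qed.

Lemma cont_onM f g : cont_on K f -> cont_on K g -> cont_on K (fun x => f x * g x : C1 R).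
Proof.
move=> /cont_onP Hf /cont_onP Hg; apply/cont_onP => x Kx.
by apply: (@cvgM R[i]); [exact: Hf|exact: Hg].
Qed.

Lemma cont_onV f : cont_on K f -> (forall x, K x -> f x != 0) ->
  cont_on K (fun x => (f x)^-1 : C1 R).
Proof.
move=> /cont_onP Hf f0; apply/cont_onP => x Kx.
by apply: (@cvgV R[i]); [exact: f0|exact: Hf].
Qed.

Lemma cont_on_cst (c : C1 R) : cont_on K (fun=> c).
Proof. by move=> x _ e e0; exists 1 => // *; rewrite subrr rnorm0. Qed.

Lemma cont_onX f n : cont_on K f -> cont_on K (fun x => f x ^+ n : C1 R).
Proof.
move=> Hf; elim: n => [|n IH].
  by have -> : (fun x => f x ^+ 0 : C1 R) = (fun=> 1) by []; exact: cont_on_cst.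
have -> : (fun x => f x ^+ n.+1 : C1 R) = (fun x => f x * f x ^+ n).
  by apply/funext => x; rewrite exprS.
exact: cont_onM.
Qed.

Lemma cont_onS (W : normedModType R[i]) (K' : set V) (f : V -> W) :
  K' `<=` K -> cont_on K f -> cont_on K' f.
Proof.
move=> KK H x Kx e e0; have [d d0 dH] := H x (KK x Kx) e e0.
by exists d => // x' Kx'; apply: dH; exact: KK.
Qed.

End ContOn.

Section ComplexMean.
Variable R : realType.
Implicit Types (g u : C1 R -> C1 R).

Lemma differentiable_exp (V : normedModType R[i]) (f : V -> C1 R) n (x : V) :
  differentiable f x -> differentiable (fun y => f y ^+ n : C1 R) x.
Proof.
move=> fd; elim: n => [|n IH].
  have -> : (fun y => f y ^+ 0 : C1 R) = (fun=> 1) by [].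
  exact: differentiable_cst.
have -> : (fun y => f y ^+ n.+1 : C1 R) = (fun y => f y * f y ^+ n).
  by apply/funext => y; rewrite exprS.
exact: differentiableM.
Qed.

Lemma C1_near_differentiable (f g : C1 R -> C1 R) (x : C1 R) : differentiable f x ->
  (exists2 d : R, 0 < d & forall y, rnorm (y - x) < d -> f y = g y) -> differentiable g x.
Proof.
move=> /C1_differentiableE[D HD] [d d0 fg]; apply: (@C1_differentiable _ _ _ D) => e e0.
have [k k0 H] := HD e e0; exists (Num.min d k); first by rewrite lt_min d0.
move=> h; rewrite lt_min => /andP[hd hk]; rewrite -!fg; first exact: H.
- by rewrite subrr rnorm0.
- by rewrite addrC addKr.
Qed.

Lemma cont_on_id (K : set (C1 R)) : cont_on K (fun x => x).
Proof. by move=> x _ e e0; exists e. Qed.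

Lemma circle_neq0 (w : C1 R) : circle w -> w != 0.
Proof. by move=> w1; rewrite -rnorm_gt0 w1. Qed.

Definition cmeanC g : C1 R :=
  cmean (fun w => complex.Re (g w)) +i* cmean (fun w => complex.Im (g w)).

Lemma circle_cont_Re g : cont_on (@circle R) g -> circle_cont (fun w => complex.Re (g w)).
Proof.
move=> H w hw e e0; have [d d0 dH] := H w hw e e0; exists d => // w' hw' /(dH _ hw').
by rewrite -raddfB; apply: le_lt_trans; exact: ler_Re_rnorm.
Qed.

Lemma circle_cont_Im g : cont_on (@circle R) g -> circle_cont (fun w => complex.Im (g w)).
Proof.
move=> H w hw e e0; have [d d0 dH] := H w hw e e0; exists d => // w' hw' /(dH _ hw').
by rewrite -raddfB; apply: le_lt_trans; exact: ler_Im_rnorm.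
Qed.

Lemma eq_cmeanC g h : (forall w, circle w -> g w = h w) -> cmeanC g = cmeanC h.
Proof. by move=> gh; congr Complex; apply: eq_cmean => w /gh ->. Qed.

Lemma cmeanC_cst c : cmeanC (fun=> c) = c.
Proof. by rewrite /cmeanC !cmean_cst; case: c. Qed.

Lemma cmeanCD g h : cont_on (@circle R) g -> cont_on (@circle R) h ->
  cmeanC (fun w => g w + h w) = cmeanC g + cmeanC h.
Proof.
move=> gc hc; rewrite /cmeanC; apply/eqP; rewrite eq_complex /=; apply/andP; split; apply/eqP.
  rewrite -cmeanD; [|exact: circle_cont_Re..].
  by apply: eq_cmean => w _; rewrite raddfD.
rewrite -cmeanD; [|exact: circle_cont_Im..].
by apply: eq_cmean => w _; rewrite raddfD.
Qed.

Lemma cmeanCZ c g : cont_on (@circle R) g -> cmeanC (fun w => c * g w) = c * cmeanC g.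
Proof.
move=> gc; have gR := circle_cont_Re gc; have gI := circle_cont_Im gc.
rewrite /cmeanC; case: c => a b.
have -> : cmean (fun w => complex.Re ((a +i* b) * g w)) =
    a * cmean (fun w => complex.Re (g w)) - b * cmean (fun w => complex.Im (g w)).
  rewrite -mulNr -(cmeanZ a gR) -(cmeanZ (- b) gI) -cmeanD; [|exact: circle_contZ..].
  by apply: eq_cmean => w _; case: (g w) => x y /=; rewrite mulNr.
have -> : cmean (fun w => complex.Im ((a +i* b) * g w)) =
    a * cmean (fun w => complex.Im (g w)) + b * cmean (fun w => complex.Re (g w)).
  rewrite -(cmeanZ a gI) -(cmeanZ b gR) -cmeanD; [|exact: circle_contZ..].
  by apply: eq_cmean => w _; case: (g w).
by [].
Qed.

Lemma cmeanC_conj g : cont_on (@circle R) g -> cmeanC (fun w => (g w)^*) = (cmeanC g)^*.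
Proof.
move=> gc; rewrite /cmeanC /=; congr Complex.
  by apply: eq_cmean => w _; case: (g w).
rewrite -mulN1r -cmeanZ; last exact: circle_cont_Im.
by apply: eq_cmean => w _; case: (g w) => x y /=; rewrite mulN1r.
Qed.

(** The factor 2 comes from bounding the real and imaginary means separately. *)
Lemma cmeanC_norm g B : cont_on (@circle R) g -> (forall w, circle w -> rnorm (g w) <= B) ->
  rnorm (cmeanC g) <= 2 * B.
Proof.
move=> gc H; apply: le_trans (rnorm_le_ReIm _) _; rewrite mulr_natl mulr2n /= lerD//.
  apply: cmean_norm; first exact: circle_cont_Re.
  by move=> w /H; apply: le_trans; exact: ler_Re_rnorm.
apply: cmean_norm; first exact: circle_cont_Im.
by move=> w /H; apply: le_trans; exact: ler_Im_rnorm.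
Qed.

Definition disc : set (C1 R) := [set c | rnorm c <= 1].

Lemma compact_disc : compact disc.
Proof. exact: compact_C1_ball. Qed.

Lemma circle_disc : @circle R `<=` disc.
Proof. by move=> w w1; rewrite /disc /= w1. Qed.

Lemma rnorm_scale (r : R) (w : C1 R) : 0 <= r -> rnorm (r%:C * w : C1 R) = r * rnorm w.
Proof. by move=> r0; rewrite rnormM rnorm_real ger0_norm. Qed.

(** The mean over the circle of radius [r] is continuous in [r] on [[0, 1]] and locally constant off
    [0], [rho] and [1]. The exceptional circle serves [cauchy], where the difference quotient is
    only known to be continuous at its base point. *)
Lemma Im_mean_value u (rho : R) : cont_on disc u ->
  (forall c, 0 < rnorm c < 1 -> rnorm c != rho -> differentiable u c) ->
  cmean (fun w => complex.Im (u w)) = complex.Im (u 0).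
Proof.
move=> uc ud; pose m (r : R) := cmean (fun w => complex.Im (u (r%:C * w))).
have sdisc (r : R) w : 0 <= r <= 1 -> circle w -> disc (r%:C * w).
  by move=> /andP[r0 r1] w1; rewrite /disc /= rnorm_scale// w1 mulr1.
have mc e : 0 < e -> exists2 d : R, 0 < d & forall r s, 0 <= r <= 1 -> 0 <= s <= 1 ->
    `|r - s| < d -> `|m r - m s| <= e.
  move=> e0; have [d d0 H] := heine compact_disc uc e0; exists d => // r s hr hs rs.
  have cm t : 0 <= t <= 1 -> circle_cont (fun w => complex.Im (u (t%:C * w))).
    move=> ht w hw k k0; have [d' d'0 H'] := uc _ (sdisc _ _ ht hw) k k0.
    exists d' => // w' hw' wd; rewrite -raddfB; apply: le_lt_trans (ler_Im_rnorm _) _.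
    apply: H'; first exact: sdisc.
    case/andP: ht => t0 t1; rewrite -mulrBr rnorm_scale//; apply: le_lt_trans wd.
    by rewrite ler_piMl// rnorm_ge0.
  have -> : m r - m s = cmean (fun w => complex.Im (u (r%:C * w)) + -1 * complex.Im (u (s%:C * w))).
    rewrite cmeanD; [|exact: cm|by apply: circle_contZ; exact: cm].
    by rewrite cmeanZ ?mulN1r//; exact: cm.
  apply: cmean_norm; first by apply: circle_contD; [|apply: circle_contZ]; exact: cm.
  move=> w hw; rewrite mulN1r -raddfB; apply: le_trans (ler_Im_rnorm _) _.
  apply/ltW/H; [exact: sdisc..|].
  by rewrite -mulrBl -rmorphB/= rnormM hw mulr1 rnorm_real.
have step s t : 0 <= s -> s < t -> t <= 1 ->
    (forall c, s < rnorm c < t -> differentiable u c) -> m s = m t.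
  move=> s0 st t1 sd; apply/eqP; rewrite -subr_eq0 -normr_le0; apply/ler_addgt0Pr => e e0.
  rewrite add0r; have [d d0 H] := mc _ (divr_gt0 e0 (ltr0Sn _ 1)).
  (* Strictly inside []s, t[], where [annulus_mean] applies, yet within [d / 2] of the end points,
     where continuity takes over. *)
  pose s' := Num.min (s + d / 2) (s + (t - s) / 3).
  pose t' := Num.max (t - d / 2) (t - (t - s) / 3).
  have [a1 a2] : s < s' /\ s' <= s + (t - s) / 3.
    by split; rewrite /s'; [rewrite lt_min; lra|rewrite ge_min lexx orbT].
  have a3 : s' <= s + d / 2 by rewrite /s' ge_min lexx.
  have [b1 b2] : t' < t /\ t - (t - s) / 3 <= t'.
    by split; rewrite /t'; [rewrite gt_max; lra|rewrite le_max lexx orbT].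
  have b3 : t - d / 2 <= t' by rewrite /t' le_max lexx.
  have E : m s' = m t'.
    apply: annulus_mean; [lra|lra|move=> c hc; apply: sd; lra].
  have h1 : `|m s - m s'| <= e / 2 by apply: H; [lra|lra|rewrite ltr_norml; lra].
  have h2 : `|m t' - m t| <= e / 2 by apply: H; [lra|lra|rewrite ltr_norml; lra].
  have -> : m s - m t = (m s - m s') + (m t' - m t) by rewrite E; ring.
  by apply: le_trans (ler_normD _ _) _; lra.
have m0 : m 0 = complex.Im (u 0).
  by rewrite /m -[RHS]cmean_cst; apply: eq_cmean => w _; rewrite mul0r.
have m1 : m 1 = cmean (fun w => complex.Im (u w)).
  by apply: eq_cmean => w _; rewrite mul1r.
rewrite -m0 -m1; have [/andP[r0 r1]|rP] := boolP (0 < rho < 1).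
  rewrite (step 0 rho (lexx _) r0 (ltW r1)); last first.
    by move=> c hc; apply: ud; [lra|apply/eqP; lra].
  by rewrite (step rho 1 (ltW r0) r1 (lexx _))// => c hc; apply: ud; [lra|apply/eqP; lra].
rewrite (step 0 1 (lexx _) ltr01 (lexx _))// => c hc; apply: ud => //.
by apply: contra rP => /eqP <-.
Qed.

Lemma mean_value u (rho : R) : cont_on disc u ->
  (forall c, 0 < rnorm c < 1 -> rnorm c != rho -> differentiable u c) ->
  cmeanC u = u 0.
Proof.
move=> uc ud.
have iE (z : C1 R) : complex.Im ('i * z : C1 R) = complex.Re z.
  by case: z => x y /=; rewrite mul0r mul1r add0r.
have := @Im_mean_value (fun c => 'i * u c : C1 R) rho; rewrite iE.
rewrite (eq_cmean (W := fun w => complex.Re (u w))); last by move=> w _; rewrite iE.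
move=> H; have ReE : cmean (fun w => complex.Re (u w)) = complex.Re (u 0).
  apply: H; first by apply: cont_onM uc; exact: cont_on_cst.
  by move=> c c1 cr; apply: differentiableM; [exact: differentiable_cst|exact: ud].
by rewrite /cmeanC ReE (Im_mean_value uc ud); case: (u 0).
Qed.

Lemma kernel_norm (p w : C1 R) : rnorm p < 1 -> circle w ->
  [/\ w - p != 0, 1 - rnorm p <= rnorm (w - p) & rnorm (w / (w - p) : C1 R) <= (1 - rnorm p)^-1].
Proof.
move=> p1 w1; have h : 1 - rnorm p <= rnorm (w - p) by have := rnorm_lbB w p; rewrite w1.
have h0 : 0 < rnorm (w - p) by apply: lt_le_trans h; rewrite subr_gt0.
split => //; first by rewrite -rnorm_gt0.
by rewrite rnormM w1 mul1r rnormV lef_pV2// posrE// subr_gt0.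
Qed.

Lemma kernel_cont (p : C1 R) : rnorm p < 1 -> cont_on (@circle R) (fun w => w / (w - p) : C1 R).
Proof.
move=> p1; apply: cont_onM; first exact: cont_on_id.
apply: cont_onV; first by apply: cont_onB; [exact: cont_on_id|exact: cont_on_cst].
by move=> w hw; case: (kernel_norm p1 hw).
Qed.

Lemma differentiable_linear_frac (a b z : C1 R) : a + b * z != 0 ->
  differentiable (fun c : C1 R => (a + b * c)^-1 : C1 R) z.
Proof.
have d : differentiable (fun c : C1 R => a + b * c : C1 R) z.
  apply: differentiableD; first exact: differentiable_cst.
  by apply: differentiableM; [exact: differentiable_cst|exact: ex_diff].
by move=> h; exact: differentiableV.
Qed.

(** On the circle [w / (w - p)] is the conjugate of [(1 - p^* w)^-1], which is holomorphic in the
    disc and equals 1 at 0. *)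
Lemma kernel_mean (p : C1 R) : rnorm p < 1 -> cmeanC (fun w => w / (w - p) : C1 R) = 1.
Proof.
move=> p1; pose q : C1 R := p^*.
have q1 : rnorm q = rnorm p by rewrite /rnorm normcJ.
have nz c : disc c -> 1 + (- q) * c != 0 :> C1 R.
  move=> hc; rewrite -rnorm_gt0; apply: (@lt_le_trans _ _ (1 - rnorm p)); first by rewrite subr_gt0.
  have := rnorm_lbB (1 : C1 R) (q * c : C1 R); rewrite rnorm1 rnormM q1 mulNr.
  have : rnorm p * rnorm c <= rnorm p by rewrite ler_piMr// rnorm_ge0.
  lra.
have := @mean_value (fun c => (1 + (- q) * c)^-1 : C1 R) 0.
rewrite mulr0 addr0 invr1 => H.
rewrite -[RHS]conjc1 -H.
- rewrite -cmeanC_conj.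
    apply: eq_cmeanC => w w1; rewrite conjc_inv.
    have -> : (1 + - q * w : C1 R)^* = 1 - p * w^* :> R[i].
      by rewrite /q; case: (p) (w) => a b [x y]; apply/eqP; rewrite eq_complex /=;
         apply/andP; split; apply/eqP; ring.
    have nw : `|w| = 1 :> R[i] by transitivity ((rnorm w)%:C); [exact: rnormE|rewrite w1].
    have ww : w * w^* = 1 by rewrite -sqr_normc nw expr1n.
    have w0 := circle_neq0 w1; have [k0 _ _] := kernel_norm p1 w1.
    have cw : w^* = w^-1 :> R[i] by apply: (mulfI w0); rewrite ww mulfV.
    transitivity ((1 - p * w^-1)^-1 : C1 R); last by rewrite -cw.
    have -> : 1 - p * w^-1 = (w - p) / w :> C1 R by field.
    by rewrite invf_div.
  apply: cont_onV => [|w hw]; last by apply: nz; exact: circle_disc.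
  by apply: cont_onD; [exact: cont_on_cst|apply: cont_onM; [exact: cont_on_cst|exact: cont_on_id]].
- apply: cont_onV => //.
  by apply: cont_onD; [exact: cont_on_cst|apply: cont_onM; [exact: cont_on_cst|exact: cont_on_id]].
- move=> c hc _; apply: differentiable_linear_frac; apply: nz; rewrite /disc /=; lra.
Qed.

(** Since [dw = i w dt], the Cauchy kernel for the normalised measure on the circle is
    [w / (w - p)]. The difference quotient [Q], completed by the derivative at [p], is continuous,
    and [c * Q c] has mean 0, its value at 0; the rest is [kernel_mean]. *)
Lemma cauchy u (p : C1 R) : cont_on disc u -> (forall c, rnorm c < 1 -> differentiable u c) ->
  rnorm p < 1 -> cmeanC (fun w => u w * (w / (w - p))) = u p.
Proof.
move=> uc ud p1; have [D HD] := C1_differentiableE (ud p p1).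
pose Q c : C1 R := if c == p then D else (u c - u p) / (c - p).
have Qq (c : C1 R) : c != p -> Q c = (u c - u p) / (c - p) by rewrite /Q => /negbTE ->.
have qc : cont_on (disc `&` [set c | c != p]) (fun c => (u c - u p) / (c - p) : C1 R).
  apply: (@cont_onM _ _ _ (fun c => u c - u p : C1 R) (fun c => (c - p)^-1 : C1 R)).
    by apply: cont_onB; [apply: cont_onS uc; exact: subIsetl|exact: cont_on_cst].
  apply: cont_onV => [|x [_ xp]]; last by rewrite subr_eq0.
  by apply: cont_onB; [exact: cont_on_id|exact: cont_on_cst].
have Qc : cont_on disc Q.
  move=> x xd e e0; have [->|xp] := eqVneq x p.
    have [d d0 dH] := HD _ (divr_gt0 e0 (ltr0Sn _ 1)); exists d => // c _ cd.
    rewrite {2}/Q eqxx; have [->|cp] := eqVneq c p; first by rewrite /Q eqxx subrr rnorm0.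
    have cp0 : 0 < rnorm (c - p) by rewrite rnorm_gt0 subr_eq0.
    rewrite Qq//; have -> : (u c - u p) / (c - p) - D = (u (p + (c - p)) - u p - D * (c - p)) / (c - p) :> C1 R.
      by rewrite (addrC p) subrK; field; rewrite subr_eq0.
    rewrite rnormM rnormV ltr_pdivrMr//; apply: le_lt_trans (dH _ cd) _.
    by rewrite ltr_pM2r// ltr_pdivrMr// ltr_pMr// ltr1n.
  have [d d0 dH] := qc x (conj xd xp) e e0.
  have xp0 : 0 < rnorm (x - p) by rewrite rnorm_gt0 subr_eq0.
  exists (Num.min d (rnorm (x - p))); first by rewrite lt_min d0.
  move=> c cd; rewrite lt_min => /andP[cd1 cd2].
  have cp : c != p by apply: contraTneq cd2 => ->; rewrite -leNgt rdistC.
  by rewrite !Qq//; apply: dH.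
have Gd (c : C1 R) : rnorm c < 1 -> c != p -> differentiable (fun c : C1 R => c * Q c : C1 R) c.
  move=> c1 cp; apply: differentiableM; first exact: ex_diff.
  have cp0 : 0 < rnorm (c - p) by rewrite rnorm_gt0 subr_eq0.
  have d1 : differentiable (fun c : C1 R => (u c - u p) * (- p + 1 * c)^-1 : C1 R) c.
    apply: differentiableM.
      by apply: differentiableB; [exact: ud|exact: differentiable_cst].
    by apply: differentiable_linear_frac; rewrite mul1r addrC subr_eq0.
  apply: C1_near_differentiable d1 _; exists (rnorm (c - p)) => // x xc.
  have xp : x != p by apply: contraTneq xc => ->; rewrite -leNgt rdistC.
  by rewrite Qq// mul1r (addrC (- p)).
have Gc : cont_on disc (fun c => c * Q c : C1 R) by apply: cont_onM => //; exact: cont_on_id.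
have := @mean_value _ (rnorm p) Gc; rewrite mul0r => H.
have kc := kernel_cont p1; have uc' := cont_onS circle_disc uc.
transitivity (cmeanC (fun w => w * Q w + u p * (w / (w - p)))).
  apply: eq_cmeanC => w w1; have [k0 _ _] := kernel_norm p1 w1.
  by rewrite Qq; [field|rewrite -subr_eq0].
rewrite cmeanCD; first last.
- by apply: cont_onM => //; exact: cont_on_cst.
- exact: cont_onS circle_disc Gc.
rewrite cmeanCZ// kernel_mean// mulr1 H ?add0r// => c hc cp; apply: Gd; first by lra.
by apply: contra cp => /eqP ->.
Qed.

Lemma cauchy_bound u (p : C1 R) M : cont_on disc u ->
  (forall c, rnorm c < 1 -> differentiable u c) -> rnorm p < 1 ->
  (forall w, circle w -> rnorm (u w) <= M) -> rnorm (u p) <= 2 * (M / (1 - rnorm p)).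
Proof.
move=> uc ud p1 uM; rewrite -(cauchy uc ud p1); apply: cmeanC_norm.
  by apply: cont_onM; [exact: cont_onS circle_disc uc|exact: kernel_cont].
move=> w w1; have [_ _ k] := kernel_norm p1 w1.
by rewrite rnormM ler_pM ?rnorm_ge0//; exact: uM.
Qed.

(* The constant lost in [cauchy_bound] is removed by applying it to powers of u. *)
Lemma max_modulus u (p : C1 R) M : cont_on disc u ->
  (forall c, rnorm c < 1 -> differentiable u c) -> disc p ->
  (forall w, circle w -> rnorm (u w) <= M) -> rnorm (u p) <= M.
Proof.
move=> uc ud pd uM; have [p1|p1] := ltP (rnorm p) 1; last first.
  by apply: uM; apply/eqP; rewrite eq_le p1 andbT.
have M0 : 0 <= M.
  by apply: le_trans (uM 1 _); rewrite ?rnorm_ge0//; exact: rnorm1.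
have X n : rnorm (u p) ^+ n <= 2 * (M ^+ n / (1 - rnorm p)).
  rewrite -rnormX; apply: (@cauchy_bound (fun c => u c ^+ n : C1 R)) => //.
  - exact: cont_onX.
  - by move=> c c1; apply: differentiable_exp; exact: ud.
  - by move=> w w1; rewrite rnormX lerXn2r ?nnegrE ?rnorm_ge0//; exact: uM.
rewrite leNgt; apply/negP => Mu.
have M1 : 0 < M.
  rewrite lt_neqAle M0 andbT; apply/eqP => ME; have := X 1; rewrite -ME !expr1 mul0r mulr0.
  by move=> h; move: Mu; rewrite -ME ltNge h.
pose q := rnorm (u p) / M; have q1 : 0 < q - 1 by rewrite subr_gt0 ltr_pdivlMr// mul1r.
pose B := 2 / (1 - rnorm p).
have qn n : 1 + n%:R * (q - 1) <= B.
  have qX : q ^+ n <= B.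
    rewrite /q expr_div_n ler_pdivrMr ?exprn_gt0// /B; apply: le_trans (X n) _.
    by rewrite mulrAC mulrA.
  apply: le_trans qX; elim: n => [|n IH]; first by rewrite mul0r addr0 expr0.
  rewrite exprS; have h : 0 <= n%:R * (q - 1) by rewrite mulr_ge0// ltW.
  apply: le_trans (_ : q * (1 + n%:R * (q - 1)) <= _); last first.
    by rewrite ler_pM2l//; lra.
  by rewrite -natr1; nra.
have B0 : 0 <= B / (q - 1).
  apply: divr_ge0; last exact: ltW.
  by have := qn 0; rewrite mul0r addr0; lra.
have := qn (archimedean.Num.bound (B / (q - 1))).
have := archimedean.Num.Theory.archi_boundP B0.
by rewrite ltr_pdivrMr//; lra.
Qed.

End ComplexMean.

(** * Taylor remainders, isolated zeros and Liouville's theorem *)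

Section Taylor.
Variable R : realType.
Implicit Types (u : C1 R -> C1 R) (p : C1 R) (M : R).

(* [u p = \sum_(j < k) p ^+ j * taylor_rem j u 0 + p ^+ k * taylor_rem k u p] *)
Definition taylor_rem k u p : C1 R := cmeanC (fun w => u w * w^-1 ^+ k * (w / (w - p))).

Lemma taylor_cont k u p : cont_on (@circle R) u -> rnorm p < 1 ->
  cont_on (@circle R) (fun w => u w * w^-1 ^+ k * (w / (w - p)) : C1 R).
Proof.
move=> uc p1; apply: cont_onM (kernel_cont p1); apply: cont_onM => //.
by apply: cont_onX; apply: cont_onV; [exact: cont_on_id|move=> w; exact: circle_neq0].
Qed.

Lemma taylor_norm k u p M : cont_on (@circle R) u -> rnorm p < 1 ->
  (forall w, circle w -> rnorm (u w) <= M) -> rnorm (taylor_rem k u p) <= 2 * (M / (1 - rnorm p)).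
Proof.
move=> uc p1 uM; apply: cmeanC_norm; first exact: taylor_cont.
move=> w w1; have [_ _ kn] := kernel_norm p1 w1.
rewrite rnormM; apply: ler_pM; rewrite ?rnorm_ge0//.
by rewrite rnormM rnormX rnormV w1 invr1 expr1n mulr1; exact: uM.
Qed.

Lemma taylor_half k u p M : cont_on (@circle R) u -> rnorm p <= 1 / 2 ->
  (forall w, circle w -> rnorm (u w) <= M) -> rnorm (taylor_rem k u p) <= 4 * M.
Proof.
move=> uc p1 uM; have M0 : 0 <= M.
  by apply: le_trans (uM 1 _); rewrite ?rnorm_ge0//; exact: rnorm1.
apply: le_trans (@taylor_norm k u p M uc _ uM) _; first by lra.
have -> : 4 * M = 2 * (M * 2) by ring.
rewrite ler_pM2l// ler_wpM2l// -[leRHS]invrK lef_pV2 ?posrE ?invr_gt0//; lra.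
Qed.

(** The kernel satisfies [w / (w - p) = 1 + p * w^-1 * (w / (w - p))]. *)
Lemma taylor_rec k u p : cont_on (@circle R) u -> rnorm p < 1 ->
  taylor_rem k u p = taylor_rem k u 0 + p * taylor_rem k.+1 u p.
Proof.
move=> uc p1; have z1 : rnorm (0 : C1 R) < 1 by rewrite rnorm0.
rewrite /taylor_rem -cmeanCZ -?cmeanCD; first last.
- exact: taylor_cont.
- by apply: cont_onM (taylor_cont _ uc p1); exact: cont_on_cst.
- exact: taylor_cont.
apply: eq_cmeanC => w w1; have w0 := circle_neq0 w1; have [k0 _ _] := kernel_norm p1 w1.
rewrite subr0 divff// exprS; set x := w^-1 ^+ k; field.
by rewrite k0 w0.
Qed.

Lemma taylor_cauchy u p : cont_on (@disc R) u ->
  (forall c, rnorm c < 1 -> differentiable u c) -> rnorm p < 1 -> u p = taylor_rem 0 u p.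
Proof.
move=> uc ud p1; rewrite -(cauchy uc ud p1); apply: eq_cmeanC => w _.
by rewrite expr0 mulr1.
Qed.

Lemma taylor_differentiable0 k u : cont_on (@circle R) u -> differentiable (taylor_rem k u) 0.
Proof.
move=> uc; have [M M0 uM] : exists2 M : R, 0 < M & forall w, circle w -> rnorm (u w) <= M.
  apply: cont_on_bounded uc; apply: subclosed_compact (@compact_disc R) (@circle_disc R).
  have -> : @circle R = @rnorm R (C1 R) @^-1` [set x | x = 1] by [].
  by apply: closed_comp; [move=> ? _; exact: rnorm_continuous|exact: closed_eq].
apply: (@C1_differentiable _ _ _ (taylor_rem k.+1 u 0)) => e e0.
exists (Num.min (1 / 2) (e / (4 * M))); first by rewrite lt_min !divr_gt0 ?mulr_gt0.
move=> h; rewrite lt_min => /andP[h1 h2].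
have h1' : rnorm h < 1 by lra.
rewrite add0r (taylor_rec k uc h1') (taylor_rec k.+1 uc h1').
rewrite (_ : _ - _ - _ = h * (h * taylor_rem k.+2 u h)); last by ring.
rewrite rnormM [leRHS]mulrC ler_wpM2l ?rnorm_ge0// rnormM.
apply: le_trans (_ : rnorm h * (4 * M) <= _); last first.
  by rewrite -ler_pdivlMr ?mulr_gt0// ltW.
rewrite ler_wpM2l ?rnorm_ge0//; apply: taylor_half => //; exact: ltW.
Qed.

(** If all Taylor coefficients vanish, [u p] is [p ^+ k] times a remainder bounded in [k], hence 0;
    otherwise the first non-zero coefficient dominates the tail near 0. *)
Lemma isolated_zero u : cont_on (@disc R) u ->
  (forall c, rnorm c < 1 -> differentiable u c) -> u 0 = 0 ->
  (forall p, rnorm p < 1 -> u p = 0) \/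
  exists2 r : R, 0 < r & forall p, 0 < rnorm p <= r -> u p != 0.
Proof.
move=> uc ud u0; have uc' := cont_onS (@circle_disc R) uc.
have [M M0 uM] := cont_on_bounded (@compact_disc R) uc.
have {}uM w : circle w -> rnorm (u w) <= M by move/circle_disc; exact: uM.
have [A|/existsNP[k kP]] := pselect (forall k, taylor_rem k u 0 = 0).
  left => p p1; have E k : u p = p ^+ k * taylor_rem k u p.
    elim: k => [|k IH]; first by rewrite expr0 mul1r -taylor_cauchy.
    by rewrite IH taylor_rec// A add0r mulrA exprSr.
  apply/eqP; rewrite -rnorm_eq0; set B := 2 * (M / (1 - rnorm p)).
  have [->|p0] := eqVneq p 0; first by rewrite u0 rnorm0.
  have rp : 0 < rnorm p by rewrite rnorm_gt0.
  apply/negPn/negP => up0; have up : 0 < rnorm (u p) by rewrite lt0r up0 rnorm_ge0.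
  have K k : rnorm (u p) <= rnorm p ^+ k * B.
    by rewrite {1}(E k) rnormM rnormX ler_wpM2l ?exprn_ge0 ?rnorm_ge0//; exact: taylor_norm.
  have B0 : 0 < B by rewrite /B mulr_gt0// divr_gt0// subr_gt0.
  have cv : (fun k => rnorm p ^+ k : R) @ \oo --> (0 : R).
    by apply: cvg_expr; rewrite ger0_norm ?rnorm_ge0.
  move/cvgrPdist_lt: cv => /(_ _ (divr_gt0 up B0))[N _ NH].
  have := NH N (leqnn N); rewrite /= sub0r normrN ger0_norm ?exprn_ge0 ?rnorm_ge0//.
  by rewrite ltr_pdivlMr// ltNge K.
right; have ex : exists k, taylor_rem k u 0 != 0 by exists k; apply/eqP.
case: (ex_minnP ex) => n n0 nmin.
have E j p : (j <= n)%N -> rnorm p < 1 -> u p = p ^+ j * taylor_rem j u p.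
  move=> + p1; elim: j => [|j IH] jn; first by rewrite expr0 mul1r -taylor_cauchy.
  rewrite IH ?(ltnW jn)// taylor_rec//; have -> : taylor_rem j u 0 = 0.
    by apply/eqP/negPn/negP => /nmin; rewrite leqNgt jn.
  by rewrite add0r mulrA exprSr.
have t0 : 0 < rnorm (taylor_rem n u 0) by rewrite rnorm_gt0.
(* By [taylor_half] the tail is at most [4 * M * rnorm p], so this radius keeps it below half of the
   leading coefficient. *)
exists (Num.min (1 / 2) (rnorm (taylor_rem n u 0) / (8 * M))).
  by rewrite lt_min !divr_gt0 ?mulr_gt0.
move=> p /andP[p0]; rewrite le_min => /andP[p1 p2]; have p1' : rnorm p < 1 by lra.
rewrite (E n)//; apply: mulf_neq0; first by rewrite expf_neq0// -rnorm_gt0.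
rewrite -rnorm_gt0 taylor_rec//.
have h1 : rnorm (p * taylor_rem n.+1 u p) <= rnorm (taylor_rem n u 0) / 2.
  rewrite rnormM; apply: le_trans (_ : rnorm p * (4 * M) <= _).
    by rewrite ler_wpM2l ?rnorm_ge0//; exact: taylor_half.
  by move: p2; rewrite ler_pdivlMr ?mulr_gt0//; lra.
have := rnorm_lbB (taylor_rem n u 0) (- (p * taylor_rem n.+1 u p)); rewrite opprK rnormN; lra.
Qed.

Lemma differentiable_scale (u : C1 R -> C1 R) (a b c : C1 R) : differentiable u (a + b * c) ->
  differentiable (fun c : C1 R => u (a + b * c)) c.
Proof.
have d : differentiable (fun c : C1 R => a + b * c : C1 R) c.
  apply: differentiableD; first exact: differentiable_cst.
  by apply: differentiableM; [exact: differentiable_cst|exact: ex_diff].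
by move=> h; have := differentiable_comp d h.
Qed.

Lemma differentiable_cont_on (V W : normedModType R[i]) (K : set V) (f : V -> W) :
  (forall x, K x -> differentiable f x) -> cont_on K f.
Proof. by move=> fd; apply: continuous_cont_on => x /fd; exact: differentiable_continuous. Qed.

Lemma liouville u M : (forall c, differentiable u c) -> (forall c, rnorm (u c) <= M) ->
  forall a, u a = u 0.
Proof.
move=> ud uM a; apply/eqP; rewrite -subr_eq0 -rnorm_eq0 eq_le rnorm_ge0 andbT.
apply/ler_addgt0Pr => e e0; rewrite add0r.
have M0 : 0 <= M := le_trans (rnorm_ge0 _) (uM 0).
(* Rescaling by [r] brings [a] to a point [p] with [rnorm p <= 1 / 2] and [4 * M * rnorm p <= e];
   the final [1] covers [a = 0]. *)
pose r := 2 * rnorm a + 4 * M * rnorm a / e + 1.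
have t1 : 0 <= 4 * M * rnorm a / e by rewrite divr_ge0 ?mulr_ge0 ?rnorm_ge0// ltW.
have r0 : 0 < r by rewrite /r; have := rnorm_ge0 a; lra.
pose v (c : C1 R) := u (0 + r%:C * c).
have vd c : differentiable v c by apply: differentiable_scale; exact: ud.
have vc K : cont_on K v by apply: differentiable_cont_on => x _; exact: vd.
pose p : C1 R := r%:C^-1 * a.
have rC0 : r%:C != 0 :> C1 R by rewrite -rnorm_gt0 rnorm_real normr_gt0 gt_eqF.
have pn : rnorm p = rnorm a / r by rewrite rnormM rnormV rnorm_real ger0_norm 1?mulrC// ltW.
have p1 : rnorm p <= 1 / 2.
  by rewrite pn ler_pdivrMr// /r; have := rnorm_ge0 a; lra.
have p1' : rnorm p < 1 by lra.
have vp : v p = u a by rewrite /v /p add0r mulrA mulfV// mul1r.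
have v0 : v 0 = u 0 by rewrite /v add0r mulr0.
have E1 := taylor_cauchy (vc _) (fun c _ => vd c) p1'; rewrite taylor_rec// in E1.
have E0 : v 0 = taylor_rem 0 v 0 by apply: taylor_cauchy; rewrite ?rnorm0.
rewrite -vp -v0 E1 E0 [_ + p * _]addrC addrK rnormM.
apply: le_trans (_ : rnorm p * (4 * M) <= _).
  by rewrite ler_wpM2l ?rnorm_ge0//; apply: taylor_half => // w _; exact: uM.
rewrite pn mulrAC ler_pdivrMr// /r mulrDr mulrDr mulr1 mulrCA.
rewrite [e * (_ / e)]mulrC divfK ?gt_eqF//.
have : 0 <= e * rnorm a by rewrite mulr_ge0 ?rnorm_ge0// ltW.
lra.
Qed.

(** At 0 the quotient is completed by its Taylor coefficient: near 0 it coincides with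
    [taylor_rem 1 f], which is differentiable at 0. *)
Lemma difference_quotient (f : C1 R -> C1 R) : (forall z, differentiable f z) ->
  exists2 k : C1 R -> C1 R, (forall z, differentiable k z) &
    forall z, f z = f 0 + z * k z.
Proof.
move=> fd; have fc K : cont_on K f by apply: differentiable_cont_on => x _; exact: fd.
pose k (z : C1 R) : C1 R := if z == 0 then taylor_rem 1 f 0 else z^-1 * (f z - f 0).
have fE z : f z = f 0 + z * k z.
  rewrite /k; case: eqVneq => [->|z0]; first by rewrite mul0r addr0.
  by rewrite mulrA mulfV// mul1r addrC subrK.
exists k => // z; have [->|z0] := eqVneq z 0.
  apply: C1_near_differentiable (taylor_differentiable0 1 (fc _)) _; exists 1 => // y.
  rewrite subr0 => y1; rewrite /k; case: eqVneq => [->//|y0].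
  have E1 := taylor_cauchy (fc _) (fun c _ => fd c) y1; rewrite taylor_rec// in E1.
  have E0 : f 0 = taylor_rem 0 f 0 by apply: taylor_cauchy; rewrite ?rnorm0.
  by rewrite E1 E0 [_ + y * _]addrC addrK mulrA mulVf// mul1r.
apply: (@C1_near_differentiable _ (fun z => (0 + 1 * z)^-1 * (f z - f 0))).
  apply: differentiableM; first by apply: differentiable_linear_frac; rewrite add0r mul1r.
  by apply: differentiableB => //; exact: differentiable_cst.
exists (rnorm z); first by rewrite rnorm_gt0.
move=> y yz; rewrite /k add0r mul1r; case: eqVneq => // y0.
by move: yz; rewrite y0 sub0r rnormN ltxx.
Qed.

End Taylor.

(** * The Schwarz integral and the sub-mean value criterion *)

Section Schwarz.
Variable R : realType.

Lemma compact_circle : compact (@circle R).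
Proof.
apply: subclosed_compact (@compact_disc R) (@circle_disc R).
have -> : @circle R = @rnorm R (C1 R) @^-1` [set x | x = 1] by [].
by apply: closed_comp; [move=> ? _; exact: rnorm_continuous|exact: closed_eq].
Qed.

(** As [u] is merely continuous on the circle, Cauchy's formula says nothing here. The kernel is
    expanded to second order in [h] by an algebraic identity, and the mean of the second-order
    factor [g] stays bounded. *)
Lemma cauchy_transform_differentiable (u : C1 R -> C1 R) (p : C1 R) :
  cont_on (@circle R) u -> rnorm p < 1 -> differentiable (taylor_rem 0 u) p.
Proof.
move=> uc p1; have [M M0 uM] := cont_on_bounded compact_circle uc.
pose a := 1 - rnorm p; have a0 : 0 < a by rewrite subr_gt0.
have kc := kernel_cont p1.
have ic q : rnorm q < 1 -> cont_on (@circle R) (fun w => (w - q)^-1 : C1 R).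
  move=> q1; apply: cont_onV; first by apply: cont_onB; [exact: cont_on_id|exact: cont_on_cst].
  by move=> w w1; have [] := kernel_norm q1 w1.
pose D : C1 R := cmeanC (fun w => u w * (w / (w - p)) * (w - p)^-1).
have Dc : cont_on (@circle R) (fun w => u w * (w / (w - p)) * (w - p)^-1 : C1 R).
  by apply: cont_onM (ic _ p1); exact: cont_onM.
apply: (@C1_differentiable _ _ _ D) => e e0; pose B := 2 * (M * a^-1 * a^-1 * (a / 2)^-1).
have B0 : 0 < B by rewrite /B !mulr_gt0 ?invr_gt0 ?divr_gt0.
exists (Num.min (a / 2) (e / B)); first by rewrite lt_min !divr_gt0.
move=> h; rewrite lt_min => /andP[h1 h2].
have ph : rnorm (p + h) <= 1 - a / 2 by have := rnormD p h; rewrite /a in h1 *; lra.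
have ph1 : rnorm (p + h) < 1 by lra.
pose g (w : C1 R) : C1 R := u w * (w / (w - p)) * (w - p)^-1 * (w - (p + h))^-1.
have gc : cont_on (@circle R) g by apply: cont_onM (ic _ ph1).
have -> : taylor_rem 0 u (p + h) - taylor_rem 0 u p - D * h = h * (h * cmeanC g).
  have -> : taylor_rem 0 u (p + h) = cmeanC (fun w => u w * w^-1 ^+ 0 * (w / (w - p)) +
      h * (u w * (w / (w - p)) * (w - p)^-1 + h * g w)).
    apply: eq_cmeanC => w w1; have [k0 _ _] := kernel_norm p1 w1.
    have [k1 _ _] := kernel_norm ph1 w1; rewrite /g expr0; field.
    by rewrite k0 k1.
  have c1 : cont_on (@circle R) (fun w => h * g w : C1 R) by apply: cont_onM => //; exact: cont_on_cst.
  have c2 : cont_on (@circle R) (fun w => u w * (w / (w - p)) * (w - p)^-1 + h * g w : C1 R).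
    exact: cont_onD.
  rewrite cmeanCD; [|exact: taylor_cont|by apply: cont_onM => //; exact: cont_on_cst].
  by rewrite cmeanCZ// cmeanCD// cmeanCZ// -/D -/(taylor_rem 0 u p); ring.
rewrite rnormM [leRHS]mulrC ler_wpM2l ?rnorm_ge0// rnormM.
apply: le_trans (_ : rnorm h * B <= _); last by rewrite -ler_pdivlMr// ltW.
rewrite ler_wpM2l ?rnorm_ge0//; apply: cmeanC_norm => // w w1.
have [_ k1 k2] := kernel_norm p1 w1; have [_ k3 _] := kernel_norm ph1 w1.
rewrite /g !rnormM -rnormM; apply: ler_pM; rewrite ?mulr_ge0 ?rnorm_ge0//.
  apply: ler_pM; rewrite ?mulr_ge0 ?rnorm_ge0//.
    by apply: ler_pM; rewrite ?rnorm_ge0//; exact: uM.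
  by rewrite rnormV lef_pV2// posrE// (lt_le_trans a0).
rewrite rnormV lef_pV2 ?posrE ?divr_gt0//; first by lra.
by apply: lt_le_trans k3; rewrite subr_gt0.
Qed.

(** With [S] the Cauchy transform of [V], [2 * S - S 0] is the Schwarz integral, whose real part is
    the Poisson integral of [V]. Evaluating it at [s c] with [s < 1] makes [q] holomorphic up to the
    circle; for [s] close to 1 the added [e0] puts [Re q] above [V] there, while [Re q] at 0 is the
    mean of [V] plus [e0]. *)
Lemma submean_criterion (V : C1 R -> R) (x : R) : circle_cont V ->
  (forall q : C1 R -> C1 R, (forall c, disc c -> differentiable q c) ->
     (forall w, circle w -> V w <= complex.Re (q w)) -> x <= complex.Re (q 0)) ->
  x <= cmean V.
Proof.
move=> Vc H; apply/ler_addgt0Pr => e0 e00; pose e := e0 / 2.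
have e0' : 0 < e by rewrite divr_gt0.
pose u (w : C1 R) : C1 R := (V w)%:C.
have uc : cont_on (@circle R) u.
  move=> w w1 k k0; have [d d0 dH] := Vc w w1 k k0; exists d => // w' w1' /(dH _ w1').
  by rewrite /u -rmorphB/= rnorm_real.
have [B B0 uB] := cont_on_bounded compact_circle uc.
have VB w : circle w -> `|V w| <= B by move=> /uB; rewrite rnorm_real.
have [d d0 dH] := heine compact_circle uc e0'.
(* The point [p = s w0] is at distance [t] from [w0], so a point [w] at distance at least [d] from
   [w0] is at least [d / 2] from [p]. The Poisson kernel is then at most [8 * t / d ^+ 2], and
   [2 * B] times it at most [e]. *)
pose t := Num.min (1 / 2) (Num.min (d / 2) (e * d ^+ 2 / (16 * B))).
have t0 : 0 < t by rewrite !lt_min !divr_gt0 ?mulr_gt0 ?exprn_gt0.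
have [t1 [t2 t3]] : t <= 1 / 2 /\ t <= d / 2 /\ t * (16 * B) <= e * d ^+ 2.
  split; first by rewrite /t ge_min lexx.
  split; first by rewrite /t !ge_min lexx orbT.
  by rewrite -ler_pdivlMr ?mulr_gt0// /t !ge_min lexx !orbT.
pose s := 1 - t.
pose S := taylor_rem 0 u.
pose q c : C1 R := 2 * S (0 + s%:C * c) - S 0 + e0%:C.
have s01 : 0 < s < 1 by rewrite /s; lra.
have sn c : disc c -> rnorm (s%:C * c : C1 R) < 1.
  case/andP: s01 => s0 s1; rewrite rnorm_scale ?ltW// => c1.
  by apply: le_lt_trans s1; rewrite ler_piMr// ltW.
have S0E : S 0 = (cmean V)%:C.
  rewrite /S /taylor_rem -[RHS](_ : cmeanC u = _).
    by apply: eq_cmeanC => w /circle_neq0 w0; rewrite subr0 divff// expr0 !mulr1.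
  by rewrite /cmeanC /= cmean_cst.
have q0 : complex.Re (q 0) = cmean V + e0.
  by rewrite /q mulr0 addr0 S0E /= ; ring.
rewrite -q0; apply: H.
  move=> c /sn c1; apply: differentiableD; last exact: differentiable_cst.
  apply: differentiableB; last exact: differentiable_cst.
  apply: differentiableM; first exact: differentiable_cst.
  apply: differentiable_scale; rewrite add0r; exact: cauchy_transform_differentiable.
move=> w0 w01; pose p : C1 R := s%:C * w0.
have p1 : rnorm p < 1 by apply: sn; exact: circle_disc.
have pn : rnorm p = s by rewrite rnorm_scale ?w01 ?mulr1// ltW//; case/andP: s01.
have pw0 : rnorm (w0 - p) = t.
  rewrite /p -{1}[w0]mul1r -mulrBl rnormM w01 mulr1 (_ : 1 - s%:C = t%:C) ?rnorm_real ?ger0_norm ?ltW//.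
  by rewrite -(rmorph1 (real_complex R)) -rmorphB/= /s opprB addrC subrK.
pose k w : R := complex.Re (2 * (w / (w - p)) - 1 : C1 R).
have kc : circle_cont k.
  apply: circle_cont_Re; apply: cont_onB; last exact: cont_on_cst.
  by apply: cont_onM; [exact: cont_on_cst|exact: kernel_cont].
have k1 : cmean k = 1.
  have : cmeanC (fun w => 2 * (w / (w - p)) + -1) = 1 :> C1 R.
    rewrite cmeanCD; [|apply: cont_onM; [exact: cont_on_cst|exact: kernel_cont]|exact: cont_on_cst].
    by rewrite cmeanCZ ?kernel_mean ?cmeanC_cst//; [ring|exact: kernel_cont].
  by move=> /(congr1 (@complex.Re R)).
have qE : complex.Re (q w0) = cmean (fun w => V w * k w) + e0.
  rewrite /q add0r -/p; have -> : 2 * S p - S 0 = cmeanC (fun w => u w * (2 * (w / (w - p)) - 1)).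
    have z1 : rnorm (0 : C1 R) < 1 by rewrite rnorm0.
    have cp := taylor_cont 0 uc p1; have c0 := taylor_cont 0 uc z1.
    have cc c (g : C1 R -> C1 R) : cont_on (@circle R) g -> cont_on (@circle R) (fun w => c * g w : C1 R).
      by move=> gc; apply: cont_onM => //; exact: cont_on_cst.
    have := cmeanCD (cc 2 _ cp) (cc (-1) _ c0); rewrite (cmeanCZ 2 cp) (cmeanCZ (-1) c0).
    rewrite -/(taylor_rem 0 u p) -/(taylor_rem 0 u 0) mulN1r => <-.
    apply: eq_cmeanC => w w1; rewrite subr0 divff ?circle_neq0// expr0; ring.
  rewrite raddfD/=; congr (_ + _); apply: eq_cmean => w _; rewrite /k /u.
  by case: (2 * _ - 1) => a b /=; rewrite mul0r subr0.
have kE w : circle w -> k w = (1 - s ^+ 2) / rnorm (w - p) ^+ 2.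
  move=> w1; have [kz _ _] := kernel_norm p1 w1; rewrite /k.
  have n2 : rnorm (w - p) ^+ 2 != 0 by rewrite expf_neq0// rnorm_eq0.
  have w2 := rnormEsq w; have p2 := rnormEsq p; rewrite w1 expr1n in w2; rewrite pn in p2.
  have -> : 2 * (w / (w - p)) - 1 = (w + p) / (w - p) :> C1 R by field.
  apply: (mulIf n2); rewrite divfK// rnormEsq w2 p2.
  move: kz; rewrite -rnorm_eq0 -(@sqrf_eq0 R) rnormEsq {n2 w2 p2 w1}.
  case: (w) => a b; case: (p) => a' b' /= n0.
  by field.
have kpos w : circle w -> 0 <= k w.
  move=> w1; rewrite kE// divr_ge0 ?sqr_ge0// subr_ge0 expr_le1//; by case/andP: s01 => *; exact: ltW.
have fc : circle_cont (fun w => V w * k w).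
  have : cont_on (@circle R) (fun w => u w * (k w)%:C : C1 R).
    apply: cont_onM => // w w1 e1 e10; have [d1 d10 H1] := kc w w1 e1 e10.
    by exists d1 => // w' w1' /(H1 _ w1'); rewrite -rmorphB/= rnorm_real.
  move=> /circle_cont_Re c w w1 e1 e10; have [d1 d10 H1] := c w w1 e1 e10.
  by exists d1 => // w' w1' /(H1 _ w1') /=; rewrite !mul0r !subr0.
rewrite qE.
(* Near [w0] uniform continuity costs [e * k w]; far from it the smallness of the kernel costs [e].
   As [k] has mean 1, integration loses [2 * e = e0] in all. *)
have pt w : circle w -> V w0 * k w <= V w * k w + (e * k w + e).
  move=> w1; have kw := kpos w w1; have [wd|wd] := ltP (rnorm (w - w0)) d.
    have : V w0 - V w <= e.
      have := dH w w0 w1 w01; rewrite rdistC => /(_ wd).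
      by rewrite /u -rmorphB/= rnorm_real => /ltW; apply: le_trans; exact: ler_norm.
    by move=> h; have : (V w0 - V w) * k w <= e * k w by [rewrite ler_wpM2r|]; lra.
  have wp : d / 2 <= rnorm (w - p).
    by have := rnormBD p w w0; have := rdistC p w0; rewrite pw0; lra.
  have wp0 : 0 < rnorm (w - p) by apply: lt_le_trans wp; rewrite divr_gt0.
  have kw2 : 2 * B * k w <= e.
    rewrite kE// mulrA ler_pdivrMr ?exprn_gt0//.
    have h1 : 1 - s ^+ 2 <= 2 * t by rewrite /s; nra.
    have h2 : d ^+ 2 / 4 <= rnorm (w - p) ^+ 2 by nra.
    have h3 : e * (d ^+ 2 / 4) <= e * rnorm (w - p) ^+ 2 by rewrite ler_pM2l.
    have h4 : 2 * B * (1 - s ^+ 2) <= 2 * B * (2 * t) by rewrite ler_pM2l// mulr_gt0.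
    lra.
  have h5 : (V w0 - V w) * k w <= 2 * B * k w.
    rewrite ler_wpM2r//; have := VB w w1; have := VB w0 w01; rewrite !ler_norml; lra.
  have : 0 <= e * k w by rewrite mulr_ge0// ltW.
  lra.
have := le_cmean (circle_contZ (V w0) kc) (circle_contD fc (circle_contD (circle_contZ e kc) (circle_cont_cst e))) pt.
rewrite cmeanZ// k1 cmeanD//; last first.
  by apply: circle_contD; [exact: circle_contZ|exact: circle_cont_cst].
rewrite cmeanD; [|exact: circle_contZ|exact: circle_cont_cst].
rewrite cmeanZ// k1 cmean_cst /e; lra.
Qed.

End Schwarz.

(** * Completeness, Cauchy estimates on lines and Weierstrass's theorem *)

Section Lines.
Variable R : realType.

Lemma real_complete (x : nat -> R) :
  (forall e : R, 0 < e -> exists N, forall n m, (N <= n)%N -> (N <= m)%N -> `|x n - x m| < e) ->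
  exists l, forall e : R, 0 < e -> exists N, forall n, (N <= n)%N -> `|x n - l| < e.
Proof.
move=> H; have cx : cvg (x @ \oo).
  apply/cauchy_cvgP/cauchy_exP => e e0; have [N NH] := H e e0; exists (x N).
  exists N => // n /= Nn; rewrite /ball/=; exact: NH.
exists (lim (x @ \oo)) => e e0; move/cvgrPdist_lt: cx => /(_ e e0)[N _ NH].
by exists N => n Nn; rewrite distrC; exact: NH.
Qed.

Lemma C1_complete (x : nat -> C1 R) :
  (forall e : R, 0 < e -> exists N, forall n m, (N <= n)%N -> (N <= m)%N -> rnorm (x n - x m) < e) ->
  exists l, forall e : R, 0 < e -> exists N, forall n, (N <= n)%N -> rnorm (x n - l) < e.
Proof.
move=> H.
have [a aH] : exists l, forall e : R, 0 < e -> exists N, forall n, (N <= n)%N -> `|complex.Re (x n) - l| < e.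
  apply: real_complete => e /H[N NH]; exists N => n m Nn Nm.
  by rewrite -raddfB; apply: le_lt_trans (ler_Re_rnorm _) _; exact: NH.
have [b bH] : exists l, forall e : R, 0 < e -> exists N, forall n, (N <= n)%N -> `|complex.Im (x n) - l| < e.
  apply: real_complete => e /H[N NH]; exists N => n m Nn Nm.
  by rewrite -raddfB; apply: le_lt_trans (ler_Im_rnorm _) _; exact: NH.
exists (a +i* b) => e e0; have e20 : 0 < e / 2 by rewrite divr_gt0.
have [N1 H1] := aH _ e20; have [N2 H2] := bH _ e20; exists (maxn N1 N2) => n.
rewrite geq_max => /andP[/H1 h1 /H2 h2]; apply: le_lt_trans (rnorm_le_ReIm _) _.
by move: h1 h2; case: (x n) => c d /=; lra.
Qed.

Lemma rnorm_lim_le (V : normedModType R[i]) (x : nat -> V) (l y : V) (B : R) :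
  (forall e : R, 0 < e -> exists N, forall n, (N <= n)%N -> rnorm (x n - l) < e) ->
  (exists N, forall n, (N <= n)%N -> rnorm (x n - y) <= B) -> rnorm (l - y) <= B.
Proof.
move=> H [N NH]; apply/ler_addgt0Pr => e /H[N' NH'].
have := NH _ (leq_maxl N N'); have := NH' _ (leq_maxr N N').
have := rnormBD (x (maxn N N')) l y; rewrite (rdistC l (x _)); lra.
Qed.

Variable V : normedModType R[i].
Implicit Types (u : V -> C1 R) (p b : V).

Lemma line_differentiable u p b (c : C1 R) : differentiable u (p + c *: b) ->
  differentiable (fun c : C1 R => u (p + c *: b)) c.
Proof.
have d : differentiable (fun c : C1 R => p + c *: b) c.
  apply: differentiableD; first exact: differentiable_cst.
  by apply: differentiableZl; exact: ex_diff.
by move=> h; have := differentiable_comp d h.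
Qed.

(** [L] is a bare function, so that differences of differentials can be inserted; [second_order]
    asks only for homogeneity. *)
Definition has_diff u p (L : V -> C1 R) := forall e, 0 < e -> exists2 d : R, 0 < d &
  forall h, rnorm h < d -> rnorm (u (p + h) - u p - L h) <= e * rnorm h.

Lemma differentiable_has_diff u p : differentiable u p ->
  exists L : {linear V -> C1 R}, has_diff u p L.
Proof. by move=> /differentiable_rnorm H; exists ('d u p). Qed.

(* Cauchy estimates on the complex lines through [p] *)
Lemma second_order u p (L : V -> C1 R) (r M : R) : 0 < r ->
  (forall q, rnorm (q - p) <= r -> differentiable u q /\ rnorm (u q) <= M) ->
  (forall (c : C1 R) b, L (c *: b) = c * L b) -> has_diff u p L ->
  (forall b, rnorm (L b) <= 2 * M / r * rnorm b) /\
  (forall h, rnorm h <= r / 2 ->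
     rnorm (u (p + h) - u p - L h) <= 4 * M / r ^+ 2 * rnorm h ^+ 2).
Proof.
move=> r0 uH LZ up.
have L0 : L 0 = 0 by rewrite -(scale0r (0 : V)) LZ mul0r.
have M0 : 0 <= M.
  by apply: le_trans (rnorm_ge0 (u p)) _; apply: (uH p _).2; rewrite subrr rnorm0 ltW.
have key (b : V) : rnorm b = r -> [/\ rnorm (L b) <= 2 * M &
    forall c : C1 R, rnorm c <= 1 / 2 ->
      rnorm (u (p + c *: b) - u p - c * L b) <= 4 * M * rnorm c ^+ 2].
  move=> br; pose v (c : C1 R) := u (p + c *: b).
  have vH c : disc c -> differentiable v c /\ rnorm (v c) <= M.
    move=> c1; have [] := uH (p + c *: b).
      by rewrite addrC addKr rnormZ br ler_piMl// ltW.
    by move=> h ?; split => //; exact: line_differentiable.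
  have vc : cont_on (@disc R) v by apply: differentiable_cont_on => c /vH[].
  have vd c : rnorm c < 1 -> differentiable v c by move=> c1; apply: (vH c _).1; exact: ltW.
  have vM w : circle w -> rnorm (v w) <= M by move/circle_disc => /vH[].
  have vc' := cont_onS (@circle_disc R) vc.
  have z1 : rnorm (0 : C1 R) < 1 by rewrite rnorm0.
  have v0 : v 0 = u p by rewrite /v scale0r addr0.
  have E c : rnorm c <= 1 / 2 -> v c - v 0 - c * taylor_rem 1 v 0 = c ^+ 2 * taylor_rem 2 v c.
    move=> c1; have c1' : rnorm c < 1 by lra.
    rewrite (taylor_cauchy vc vd c1') (taylor_rec 0 vc' c1') (taylor_rec 1 vc' c1').
    by rewrite (taylor_cauchy vc vd z1); ring.
  have N1 c : rnorm c <= 1 / 2 -> rnorm (v c - v 0 - c * taylor_rem 1 v 0) <= 4 * M * rnorm c ^+ 2.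
    move=> c1; rewrite E// rnormM rnormX mulrC ler_wpM2r ?exprn_ge0 ?rnorm_ge0//.
    exact: taylor_half.
  suff TL : taylor_rem 1 v 0 = L b.
    split; first by rewrite -TL; have := taylor_norm 1 vc' z1 vM; rewrite rnorm0 subr0 divr1.
    by move=> c /N1; rewrite v0 TL.
  apply/eqP; rewrite -subr_eq0 -rnorm_eq0 eq_le rnorm_ge0 andbT; apply/ler_addgt0Pr => e e0.
  rewrite add0r; have e20 : 0 < e / (2 * r) by rewrite divr_gt0// mulr_gt0.
  have [d d0 dH] := up _ e20.
  pose t := Num.min (1 / 2) (Num.min (d / (2 * r)) (e / (8 * M + 1))).
  have M8 : 0 < 8 * M + 1 by rewrite ltr_wpDl// mulr_ge0.
  have t0 : 0 < t by rewrite /t !lt_min !divr_gt0 ?mulr_gt0.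
  have [t1 [t2 t3]] : t <= 1 / 2 /\ t * (2 * r) <= d /\ t * (8 * M + 1) <= e.
    split; first by rewrite /t ge_min lexx.
    by rewrite -!ler_pdivlMr ?mulr_gt0// /t !ge_min !lexx !orbT.
  have tn : rnorm (t%:C : C1 R) = t by rewrite rnorm_real ger0_norm// ltW.
  have := N1 t%:C; rewrite tn => /(_ t1) h1.
  have := dH (t%:C *: b); rewrite rnormZ tn br => h2.
  have {h2} : rnorm (v t%:C - v 0 - t%:C * L b) <= e / (2 * r) * (t * r).
    rewrite v0 -LZ; apply: h2.
    have : 0 < t * r by rewrite mulr_gt0.
    lra.
  rewrite (_ : e / (2 * r) * (t * r) = t * (e / 2)); last by field; rewrite gt_eqF.
  move=> h2; have := rnormB (v t%:C - v 0 - t%:C * L b) (v t%:C - v 0 - t%:C * taylor_rem 1 v 0).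
  rewrite (_ : _ - _ - (_ - _ - _) = t%:C * (taylor_rem 1 v 0 - L b)); last by ring.
  rewrite rnormM tn => h3; rewrite -(ler_pM2l t0); apply: le_trans h3 _.
  have : t * (t * (8 * M + 1)) <= t * e by rewrite ler_pM2l.
  have : 0 <= t * t by rewrite mulr_ge0// ltW.
  nra.
have scaleE (b : V) : b != 0 -> exists b' : V, [/\ rnorm b' = r & b = (rnorm b / r)%:C *: b'].
  move=> b0; have nb : rnorm b != 0 by rewrite rnorm_eq0.
  have nb0 : 0 < rnorm b by rewrite rnorm_gt0.
  exists ((r / rnorm b)%:C *: b); split.
    by rewrite rnormZ rnorm_real ger0_norm ?divfK// divr_ge0// ltW.
  rewrite scalerA -rmorphM/= (_ : rnorm b / r * (r / rnorm b) = 1) ?scale1r//.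
  by field; rewrite nb gt_eqF.
split=> [b|h hr].
  have [->|/scaleE[b' [/key[k1 _] {1}->]]] := eqVneq b 0.
    by rewrite L0 !rnorm0 mulr0.
  rewrite LZ rnormM rnorm_real ger0_norm ?divr_ge0 ?rnorm_ge0//; last exact: ltW.
  apply: le_trans (_ : rnorm b / r * (2 * M) <= _).
    by rewrite ler_wpM2l// divr_ge0 ?rnorm_ge0// ltW.
  by rewrite le_eqVlt; apply/orP; left; apply/eqP; field; rewrite gt_eqF.
have [->|/scaleE[b' [/key[_ k1] E]]] := eqVneq h 0.
  by rewrite addr0 L0 !subrr !rnorm0 expr0n mulr0.
have tn : rnorm ((rnorm h / r)%:C : C1 R) = rnorm h / r.
  by rewrite rnorm_real ger0_norm// divr_ge0 ?rnorm_ge0// ltW.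
have := k1 (rnorm h / r)%:C; rewrite tn.
rewrite -LZ -E => k2.
apply: le_trans (k2 _) _; first by rewrite ler_pdivrMr//; lra.
by rewrite le_eqVlt; apply/orP; left; apply/eqP; field; rewrite gt_eqF.
Qed.

(** [second_order] for the uniformly small [u n - u m] shows both that the differentials at [p]
    converge and that the first-order remainders at [h] differ by a small multiple of
    [rnorm h ^+ 2]. The limit of the differentials is therefore the differential of [l]. *)
Lemma weierstrass (u : nat -> V -> C1 R) (l : V -> C1 R) (a : V) (r : R) :
  (exists N, forall n q, (N <= n)%N -> rnorm (q - a) < r -> differentiable (u n) q) ->
  (forall e, 0 < e -> exists N, forall n q, (N <= n)%N -> rnorm (q - a) < r ->
     rnorm (u n q - l q) < e) ->
  forall p, rnorm (p - a) < r -> differentiable l p.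
Proof.
move=> [N0 ud] ul p pa; pose s := (r - rnorm (p - a)) / 2.
have s0 : 0 < s by rewrite /s; lra.
have sball q : rnorm (q - p) <= s -> rnorm (q - a) < r.
  by have := rnormBD p q a; rewrite /s; lra.
have uc e : 0 < e -> exists2 N, (N0 <= N)%N & forall n m q, (N <= n)%N -> (N <= m)%N ->
    rnorm (q - p) <= s -> rnorm (u n q - u m q) <= e.
  move=> e0; have [N NH] := ul _ (divr_gt0 e0 (ltr0Sn _ 1)); exists (maxn N0 N); first exact: leq_maxl.
  move=> n m q; rewrite !geq_max => /andP[_ nN] /andP[_ mN] /sball qr.
  have := NH n q nN qr; have := NH m q mN qr.
  have := rnormBD (l q) (u n q) (u m q); rewrite (rdistC (l q) (u m q)); lra.
have gen (x y z x' y' z' : C1 R) : (x - x') - (y - y') - (z - z') = (x - y - z) - (x' - y' - z').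
  by ring.
have H0 n : exists L : {linear V -> C1 R}, (N0 <= n)%N -> has_diff (u n) p L.
  have [nN|nN] := leqP N0 n; last by exists ('d (u n) p).
  have [|L LH] := @differentiable_has_diff (u n) p; last by exists L.
  by apply: ud => //; apply: sball; rewrite subrr rnorm0 ltW.
have [D DH] := choice H0.
have DZ n (c : C1 R) b : D n (c *: b) = c * D n b by rewrite linearZ.
have est e : 0 < e -> exists2 N, (N0 <= N)%N & forall n m, (N <= n)%N -> (N <= m)%N ->
    (forall b, rnorm (D n b - D m b) <= 2 * e / s * rnorm b) /\
    (forall h, rnorm h <= s / 2 -> rnorm ((u n (p + h) - u n p - D n h) -
       (u m (p + h) - u m p - D m h)) <= 4 * e / s ^+ 2 * rnorm h ^+ 2).
  move=> e0; have [N NN NH] := uc e e0; exists N => // n m nN mN.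
  have [|||] := @second_order (fun q => u n q - u m q : C1 R) p (fun b => D n b - D m b) s e s0.
  - move=> q qs; split; last exact: NH.
    by apply: differentiableB; apply: ud; rewrite ?(leq_trans NN)//; exact: sball.
  - by move=> c b; rewrite !DZ mulrBr.
  - move=> k k0; have k20 : 0 < k / 2 by rewrite divr_gt0.
    have [d1 d10 h1] := DH n (leq_trans NN nN) _ k20; have [d2 d20 h2] := DH m (leq_trans NN mN) _ k20.
    exists (Num.min d1 d2) => [|h]; first by rewrite lt_min d10.
    rewrite lt_min => /andP[/h1 {}h1 /h2 {}h2]; rewrite gen.
    by apply: le_trans (rnormB _ _) _; lra.
  move=> h1 h2; split => // h hh.
  by have := h2 h hh; rewrite gen.
have dcv b : exists L, forall e : R, 0 < e -> exists N, forall n, (N <= n)%N -> rnorm (D n b - L) < e.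
  apply: C1_complete => e e0; pose k := e * s / (2 * (rnorm b + 1)).
  have b1 : 0 < rnorm b + 1 by rewrite ltr_wpDl// rnorm_ge0.
  have k0 : 0 < k by rewrite /k; apply: divr_gt0; apply: mulr_gt0.
  have [N _ NH] := est k k0.
  exists N => n m nN mN; have [h _] := NH n m nN mN; apply: le_lt_trans (h b) _.
  rewrite (_ : 2 * k / s = e / (rnorm b + 1)); last first.
    by rewrite /k; field; rewrite !gt_eqF.
  by rewrite mulrAC ltr_pdivrMr// ltr_pM2l// ltrDl.
have [L LH] := choice dcv.
have Luniq (x : nat -> C1 R) (l1 l2 : C1 R) :
    (forall e, 0 < e -> exists N, forall n, (N <= n)%N -> rnorm (x n - l1) < e) ->
    (forall e, 0 < e -> exists N, forall n, (N <= n)%N -> rnorm (x n - l2) < e) -> l1 = l2.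
  move=> h1 h2; apply/eqP; rewrite -subr_eq0 -rnorm_eq0 eq_le rnorm_ge0 andbT.
  apply/ler_addgt0Pr => e e0; rewrite add0r; apply: (rnorm_lim_le h1).
  by have [N NH] := h2 e e0; exists N => n /NH /ltW.
have Llin : linear (L : V -> C1 R).
  move=> c b b'; apply: (Luniq (fun n => D n (c *: b + b'))); first exact: LH.
  move=> e e0; have c0 : 0 < rnorm (c : C1 R) + 1 by rewrite ltr_wpDl// rnorm_ge0.
  have e20 : 0 < e / 2 by rewrite divr_gt0.
  have [N1 H1] := LH b _ (divr_gt0 e20 c0); have [N2 H2] := LH b' _ e20.
  exists (maxn N1 N2) => n; rewrite geq_max => /andP[/H1 h1 /H2 h2].
  rewrite linearP (_ : _ - _ = c *: (D n b - L b) + (D n b' - L b')); last first.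
    by rewrite scalerBr opprD addrACA.
  apply: le_lt_trans (rnormD _ _) _; rewrite rnormZ; move: h1; rewrite ltr_pdivlMr// => h1.
  have : rnorm (c : C1 R) * rnorm (D n b - L b) <= rnorm (D n b - L b) * (rnorm (c : C1 R) + 1).
    by rewrite mulrC ler_wpM2l ?rnorm_ge0// lerDl.
  lra.
pose LL : {linear V -> C1 R} := HB.pack L (GRing.isLinear.Build _ _ _ _ _ Llin).
have [N1 NN1 H1] := est 1 ltr01.
(* A bound for the one differential [D N1], from [second_order] on a ball where [u N1] is bounded.
   As [L - D N1] is bounded, so is [L]. *)
have [K [K0 KH]] : exists K : R, 0 <= K /\ forall b, rnorm (D N1 b) <= K * rnorm b.
  have cont1 : cont_on [set q | rnorm (q - p) <= s] (u N1).
    apply: differentiable_cont_on => q qs; apply: ud => //; exact: sball.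
  have [|d d0 dH] := cont1 p _ 1 ltr01; first by rewrite /= subrr rnorm0 ltW.
  pose s' := Num.min s (d / 2); have s'0 : 0 < s' by rewrite lt_min s0 divr_gt0.
  have [s's s'd] : s' <= s /\ s' < d.
    by split; rewrite /s'; [rewrite ge_min lexx|rewrite gt_min; apply/orP; right; lra].
  have sH q : rnorm (q - p) <= s' -> differentiable (u N1) q /\ rnorm (u N1 q) <= rnorm (u N1 p) + 1.
    move=> qs; split; first by apply: ud => //; apply: sball; lra.
    have := dH q; rewrite /= => /(_ (le_trans qs s's) (le_lt_trans qs s'd)).
    by have := rnorm_lbB (u N1 q) (u N1 p); lra.
  have [h1 _] := second_order s'0 sH (DZ N1) (DH _ NN1).
  exists (2 * (rnorm (u N1 p) + 1) / s'); split => //.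
  by rewrite divr_ge0 ?mulr_ge0 ?addr_ge0 ?rnorm_ge0// ltW.
apply: (@rnorm_differentiable R _ _ l p LL (2 / s + K)).
  move=> b; apply: le_trans (_ : rnorm (L b - D N1 b) + rnorm (D N1 b) <= _).
    by rewrite -{1}[LL b](subrK (D N1 b)) rnormD.
  rewrite mulrDl lerD//; apply: (rnorm_lim_le (LH b)); exists N1 => n nN.
  by have [h _] := H1 n N1 nN (leqnn _); have := h b; rewrite mulr1.
(* For [rnorm h <= s / 2] the term [4 * k / s ^+ 2 * rnorm h ^+ 2] is then at most
   [e / 2 * rnorm h]. *)
move=> e e0; pose k := e * s / 4; have k0 : 0 < k by rewrite divr_gt0// mulr_gt0.
have [N2 NN2 H2] := est k k0.
have e20 : 0 < e / 2 by rewrite divr_gt0.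
have [d d0 dH] := DH _ NN2 _ e20.
exists (Num.min d (s / 2)); first by rewrite lt_min d0 divr_gt0.
move=> h; rewrite lt_min => /andP[hd hs].
have hs' : rnorm (p + h - p) <= s by rewrite addrC addKr; lra.
have hs2 := ltW hs.
apply: le_trans (_ : 4 * k / s ^+ 2 * rnorm h ^+ 2 + e / 2 * rnorm h <= _); last first.
  rewrite (_ : 4 * k / s ^+ 2 = e / s); last by rewrite /k; field; rewrite gt_eqF.
  have : e / s * rnorm h ^+ 2 <= e / s * (rnorm h * (s / 2)).
    apply: ler_wpM2l; first by rewrite divr_ge0// ltW.
    by rewrite expr2; apply: ler_wpM2l => //; exact: rnorm_ge0.
  rewrite (_ : e / s * (rnorm h * (s / 2)) = e / 2 * rnorm h); last by field; rewrite gt_eqF.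
  lra.
set X := l (p + h) - l p - LL h; set Y := u N2 (p + h) - u N2 p - D N2 h.
apply: le_trans (_ : rnorm (X - Y) + rnorm Y <= _); first by rewrite -{1}[X](subrK Y) rnormD.
rewrite /X /Y; apply: lerD; last exact: dH.
apply: (@rnorm_lim_le _ (fun n => u n (p + h) - u n p - D n h)).
  move=> e1 e10; have e30 : 0 < e1 / 3 by rewrite divr_gt0.
  have [M1 h1] := ul _ e30; have [M2 h2] := LH h _ e30; exists (maxn M1 M2) => n.
  rewrite geq_max => /andP[n1 n2].
  have k1 := h1 n _ n1 (sball _ hs'); have k2 := h2 n n2.
  have k3 : rnorm (u n p - l p) < e1 / 3 by apply: h1 => //; apply: sball; rewrite subrr rnorm0 ltW.
  rewrite -gen.
  apply: le_lt_trans (rnormB _ _) _; have := rnormB (u n (p + h) - l (p + h)) (u n p - l p).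
  rewrite /= in k2 *; lra.
by exists N2 => n nN; have [_ kk] := H2 n N2 nN (leqnn _); exact: kk.
Qed.

End Lines.

(** * Hurwitz's theorem and escaping sequences of discs *)

Section Hurwitz.
Variable R : realType.
Implicit Types (u h : C1 R -> C1 R).

Lemma max_modulus_disc u M : (forall c, disc c -> differentiable u c) ->
  (forall w, circle w -> rnorm (u w) <= M) -> forall p, disc p -> rnorm (u p) <= M.
Proof.
move=> ud uM p pd; apply: max_modulus => //; first exact: differentiable_cont_on.
by move=> c c1; apply: ud; exact: ltW.
Qed.

Lemma min_modulus u (m : R) : (forall c, disc c -> differentiable u c) ->
  (forall c, disc c -> u c != 0) -> 0 < m ->
  (forall w, circle w -> m <= rnorm (u w)) -> forall p, disc p -> m <= rnorm (u p).
Proof.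
move=> ud u0 m0 um p pd.
have := @max_modulus_disc (fun c => (u c)^-1 : C1 R) m^-1 _ _ p pd.
rewrite rnormV lef_pV2 ?posrE ?rnorm_gt0 ?u0//; apply.
- by move=> c cd; apply: differentiableV; [exact: ud|exact: u0].
- move=> w w1; have wd := circle_disc w1.
  by rewrite rnormV lef_pV2 ?posrE ?rnorm_gt0 ?u0//; exact: um.
Qed.

Lemma circle_lower_bound h : cont_on (@circle R) h -> (forall w, circle w -> h w != 0) ->
  exists2 m : R, 0 < m & forall w, circle w -> m <= rnorm (h w).
Proof.
move=> hc h0.
have [M M0 MH] := cont_on_bounded (@compact_circle R) (cont_onV hc h0).
exists M^-1; first by rewrite invr_gt0.
move=> w w1; have := MH w w1; rewrite rnormV => k.
by rewrite -[leRHS]invrK lef_pV2 ?posrE ?invr_gt0 ?rnorm_gt0 ?h0.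
Qed.

Lemma disc_scale (r : R) (c : C1 R) : 0 <= r <= 1 -> disc c -> disc (0 + r%:C * c).
Proof.
move=> /andP[r0 r1] c1; rewrite /disc /= add0r rnorm_scale//.
by apply: le_trans c1; rewrite ler_piMl// rnorm_ge0.
Qed.

(** If the zero of [h] at 0 is isolated, [h] is at least [m] in modulus on a small circle. The
    zero-free [u n] are then at least [m / 2] there and, by the minimum principle, at 0, where they
    tend to 0. *)
Lemma hurwitz (u : nat -> C1 R -> C1 R) h :
  (exists N, forall n c, (N <= n)%N -> disc c -> differentiable (u n) c /\ u n c != 0) ->
  (forall c, disc c -> differentiable h c) ->
  (forall e, 0 < e -> exists N, forall n c, (N <= n)%N -> disc c -> rnorm (u n c - h c) < e) ->
  h 0 = 0 -> forall c, rnorm c < 1 -> h c = 0.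
Proof.
move=> [N0 uH] hd uh h0.
have hc : cont_on (@disc R) h by exact: differentiable_cont_on.
have hd' c : rnorm c < 1 -> differentiable h c by move=> c1; apply: hd; exact: ltW.
have [//|[r r0 rH]] := isolated_zero hc hd' h0.
pose s := Num.min r 1; have s0 : 0 < s by rewrite lt_min r0 ltr01.
have [sr s1] : s <= r /\ s <= 1 by rewrite /s !ge_min !lexx orbT.
have s01 : 0 <= s <= 1 by rewrite ltW.
have sd := disc_scale s01.
have hsc : cont_on (@circle R) (fun w => h (0 + s%:C * w)).
  apply: differentiable_cont_on => w w1; apply: differentiable_scale; apply: hd.
  by apply: sd; exact: circle_disc.
have [m m0 mH] : exists2 m : R, 0 < m & forall w, circle w -> m <= rnorm (h (0 + s%:C * w)).
  apply: (circle_lower_bound hsc) => w w1; apply: rH.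
  by rewrite add0r rnorm_scale ?w1 ?mulr1 ?s0//; exact: ltW.
have m20 : 0 < m / 2 by rewrite divr_gt0.
have [N1 NH] := uh _ m20; pose n := maxn N0 N1.
have nN0 : (N0 <= n)%N := leq_maxl _ _; have nN1 : (N1 <= n)%N := leq_maxr _ _.
have z1 : disc (0 : C1 R) by rewrite /disc /= rnorm0.
have := NH n 0 nN1 z1; rewrite h0 subr0 ltNge => /negP[].
have := @min_modulus (fun c => u n (0 + s%:C * c)) _ _ _ m20 _ 0 z1.
rewrite mulr0 addr0; apply.
- move=> c cd; apply: differentiable_scale.
  by have [] := uH n _ nN0 (sd c cd).
- by move=> c cd; have [] := uH n _ nN0 (sd c cd).
- move=> w w1; have k1 := mH w w1; have k2 := NH n _ nN1 (sd w (circle_disc w1)).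
  by have := rnorm_lbB (h (0 + s%:C * w)) (u n (0 + s%:C * w)); rewrite rdistC; lra.
Qed.

End Hurwitz.

Section EscapingSequence.
Variable R : realType.
Variables (f : C1 R -> C1 R) (delta : C1 R) (z w : nat -> C1 R -> C1 R) (m : R).
Hypothesis fd : forall a, differentiable f a.
Hypothesis zd : forall n c, disc c -> differentiable (z n) c.
Hypothesis wd : forall n c, disc c -> differentiable (w n) c.
Hypothesis w_infty : forall B : R, exists N, forall n c, (N <= n)%N -> disc c -> B <= rnorm (w n c).
Hypothesis zw0 : forall e, 0 < e -> exists N, forall n, (N <= n)%N ->
  rnorm (z n 0) <= e * rnorm (w n 0).
Hypothesis m0 : 0 < m.
Hypothesis zwm : exists N, forall n c, (N <= n)%N -> circle c -> m * rnorm (w n c) <= rnorm (z n c).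

Lemma disc0 : disc (0 : C1 R).
Proof. by rewrite /disc /= rnorm0. Qed.

(** If [z n] omits [a], the quotient of [z n - a] by [w n] is zero-free, at least [m / 2] on the
    circle and smaller at 0, against the minimum principle. *)
Lemma values_attained (a : C1 R) : exists N, forall n, (N <= n)%N -> exists2 c, disc c & z n c = a.
Proof.
(* This makes [rnorm a] at most [m / 4] times [rnorm (w n c)], which leaves [m - m / 4] on the
   circle and [m / 8 + m / 4] at the centre. *)
have [N1 H1] := w_infty (Num.max 1 (4 * rnorm a / m)).
have [N2 H2] := zw0 (divr_gt0 m0 (ltr0Sn _ 7)); have [N3 H3] := zwm.
exists (maxn N1 (maxn N2 N3)) => n; rewrite !geq_max => /and3P[n1 n2 n3].
apply: contrapT => nc.
have za c : disc c -> z n c != a by move=> cd; apply/eqP => E; apply: nc; exists c.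
have wb c : disc c -> 1 <= rnorm (w n c) /\ rnorm a <= m / 4 * rnorm (w n c).
  move=> cd; have := H1 n c n1 cd; rewrite ge_max => /andP[-> h]; split => //.
  by move: h; rewrite ler_pdivrMr//; lra.
have w0 c : disc c -> w n c != 0.
  by move=> /wb[h _]; rewrite -rnorm_gt0; apply: lt_le_trans h.
have m20 : 0 < m / 2 by rewrite divr_gt0.
have := @min_modulus R (fun c => (z n c - a) * (w n c)^-1 : C1 R) _ _ _ m20 _ 0 disc0.
have [h1 h2] := wb _ disc0; have h3 := H2 n n2.
suff : rnorm ((z n 0 - a) * (w n 0)^-1 : C1 R) < m / 2.
  move=> h4 h5; have : m / 2 <= rnorm ((z n 0 - a) * (w n 0)^-1 : C1 R).
    apply: h5.
    - move=> c cd; apply: differentiableM; last by apply: differentiableV; [exact: wd|exact: w0].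
      by apply: differentiableB; [exact: zd|exact: differentiable_cst].
    - by move=> c cd; apply: mulf_neq0; rewrite ?invr_eq0 ?w0// subr_eq0 za.
    - move=> c c1; have cd := circle_disc c1; have [k1 k2] := wb c cd.
      rewrite rnormM rnormV ler_pdivlMr; last exact: lt_le_trans k1.
      have mw : 0 <= m * rnorm (w n c) by rewrite mulr_ge0 ?rnorm_ge0// ltW.
      have := H3 n c n3 c1; have := rnorm_lbB (z n c) a; lra.
  by rewrite leNgt h4.
rewrite rnormM rnormV ltr_pdivrMr; last exact: lt_le_trans h1.
have : m * 1 <= m * rnorm (w n 0) by rewrite ler_pM2l.
have := rnormB (z n 0) a; lra.
Qed.

(** On the circle [z * k z = (f z - delta * w) + delta * w - f 0] is at most [B * rnorm z], because
    [w] and [f 0] are controlled by [z] through [m]. The maximum principle for [k] composed with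
    [z n] carries the bound inside, where every value [a] is attained. *)
Lemma affine_of_linear_growth : (exists (C : R) N, forall n c, (N <= n)%N -> circle c ->
    rnorm (f (z n c) - delta * w n c) <= C * rnorm (z n c)) ->
  exists k0, forall a, f a = f 0 + a * k0.
Proof.
move=> [C [N3 H3]]; have [k kd fE] := difference_quotient fd.
have [N2 H2] := zwm; have [N1 H1] := w_infty (Num.max 1 (rnorm (f 0) / m)).
pose B := C + rnorm delta / m + 1.
suff kB a : rnorm (k a) <= B.
  by exists (k 0) => a; rewrite {1}fE (liouville kd kB).
have [N4 H4] := values_attained a; pose n := maxn (maxn N1 N2) (maxn N3 N4).
have n1 : (N1 <= n)%N by rewrite /n !leq_max leqnn.
have n2 : (N2 <= n)%N by rewrite /n !leq_max leqnn orbT.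
have n3 : (N3 <= n)%N by rewrite /n !leq_max leqnn !orbT.
have n4 : (N4 <= n)%N by rewrite /n !leq_max leqnn !orbT.
have [c cd <-] := H4 n n4.
apply: (@max_modulus_disc _ (fun c => k (z n c))) => //.
  move=> c' c'd; have := zd n c'd => h; have := differentiable_comp h (kd (z n c')); exact.
move=> c' c'1; have := H1 n c' n1 (circle_disc c'1); rewrite ge_max => /andP[h1 h2].
have h3 := H2 n c' n2 c'1; have h4 := H3 n c' n3 c'1.
have z0 : 0 < rnorm (z n c').
  by apply: lt_le_trans h3; rewrite mulr_gt0//; exact: lt_le_trans h1.
rewrite -(ler_pM2r z0) -rnormM mulrC.
have -> : z n c' * k (z n c') = (f (z n c') - delta * w n c') + delta * w n c' - f 0.
  by rewrite (fE (z n c')); ring.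
apply: le_trans (rnormB _ _) _; apply: le_trans (lerD (rnormD _ _) (lexx _)) _.
rewrite /B !mulrDl mul1r; apply: lerD; first apply: lerD => //.
  by rewrite rnormM -mulrA ler_wpM2l ?rnorm_ge0// mulrC ler_pdivlMr// mulrC.
by apply: le_trans h3; move: h2; rewrite ler_pdivrMr// mulrC.
Qed.

(** With [y = f z - delta * w], the maximum principle extends [rnorm (w / y) <= (2 * K)^-1] from the
    circle to a point where [z = 0]. There [y = f 0 - delta * w] is at most [K * rnorm w], a
    contradiction. *)
Lemma next_ratio_not_small : delta != 0 ->
  (forall e, 0 < e -> exists N, forall n c, (N <= n)%N -> disc c ->
     f (z n c) - delta * w n c != 0 /\
     rnorm (z n c) <= e * rnorm (f (z n c) - delta * w n c)) -> False.
Proof.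
move=> delta0 H; pose K := rnorm delta + 1.
have K0 : 0 < K by rewrite /K ltr_wpDl// rnorm_ge0.
have e0 : 0 < m / (2 * K) by rewrite divr_gt0// mulr_gt0.
have [N1 H1] := w_infty (Num.max 1 (rnorm (f 0))).
have [N2 H2] := zwm; have [N3 H3] := H _ e0; have [N4 H4] := values_attained 0.
pose n := maxn (maxn N1 N2) (maxn N3 N4).
have n1 : (N1 <= n)%N by rewrite /n !leq_max leqnn.
have n2 : (N2 <= n)%N by rewrite /n !leq_max leqnn orbT.
have n3 : (N3 <= n)%N by rewrite /n !leq_max leqnn !orbT.
have n4 : (N4 <= n)%N by rewrite /n !leq_max leqnn !orbT.
have [c cd zc] := H4 n n4.
pose y c := f (z n c) - delta * w n c.
have y0 c' : disc c' -> y c' != 0 by move=> c'd; have [] := H3 n c' n3 c'd.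
have : rnorm (w n c / y c : C1 R) <= (2 * K)^-1.
  apply: (@max_modulus_disc _ (fun c => w n c / y c : C1 R)) => //.
    move=> c' c'd; apply: differentiableM; first exact: wd.
    apply: differentiableV; last exact: y0.
    apply: differentiableB.
      by have h := zd n c'd; have := differentiable_comp h (fd (z n c')); exact.
    by apply: differentiableM; [exact: differentiable_cst|exact: wd].
  move=> c' c'1; have c'd := circle_disc c'1; have [_ h3] := H3 n c' n3 c'd.
  have h2 := H2 n c' n2 c'1; have yp : 0 < rnorm (y c') by rewrite rnorm_gt0 y0.
  rewrite rnormM rnormV ler_pdivrMr// -(ler_pM2l m0); apply: le_trans h2 _.
  by rewrite mulrA.
have yp : 0 < rnorm (y c) by rewrite rnorm_gt0 y0.
rewrite rnormM rnormV ler_pdivrMr//.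
have := H1 n c n1 cd; rewrite ge_max => /andP[h1 h2].
have : rnorm (y c) <= K * rnorm (w n c).
  rewrite /y zc; apply: le_trans (rnormB _ _) _; rewrite rnormM /K; lra.
move=> h3 h4; have : rnorm (w n c) <= (2 * K)^-1 * (K * rnorm (w n c)).
  by apply: le_trans h4 _; rewrite ler_pM2l// invr_gt0 mulr_gt0.
rewrite (_ : (2 * K)^-1 * _ = rnorm (w n c) / 2); last by field; rewrite gt_eqF.
lra.
Qed.

End EscapingSequence.

(** * The projective plane *)

Section Chordal.
Variable R : realType.
Implicit Types (u v : 'rV[R[i]]_3).

Lemma sqnormE (x : C1 R) : sqnorm x = rnorm x ^+ 2.
Proof. by rewrite rnormEsq. Qed.

Lemma sqnorm_ge0 (x : R[i]) : 0 <= sqnorm x.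
Proof. by rewrite /sqnorm addr_ge0 ?sqr_ge0. Qed.

Let nsq u : R := \sum_(i < 3) sqnorm (u 0 i).
Let wedge u v : R := \sum_(i < 3) \sum_(j < 3 | (i < j)%N)
  sqnorm (u 0 i * v 0 j - u 0 j * v 0 i).

Lemma nsq_ge (u : 'rV[R[i]]_3) (i : 'I_3) : rnorm (u 0 i : C1 R) ^+ 2 <= nsq u.
Proof.
by rewrite -sqnormE /nsq (bigD1 i)//= lerDl sumr_ge0// => k _; exact: sqnorm_ge0.
Qed.

Lemma nsq_le u (C : R) : (forall i, rnorm (u 0 i : C1 R) <= C) -> nsq u <= (3 * C) ^+ 2.
Proof.
move=> uC; have C0 : 0 <= C := le_trans (rnorm_ge0 _) (uC ord0).
apply: le_trans (_ : \sum_(i < 3) C ^+ 2 <= _).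
  by apply: ler_sum => i _; rewrite sqnormE lerXn2r ?nnegrE ?rnorm_ge0.
rewrite sumr_const card_ord -mulr_natl; nra.
Qed.

Lemma wedge_ge u v (i k : 'I_3) :
  rnorm (u 0 i * v 0 k - u 0 k * v 0 i : C1 R) ^+ 2 <= wedge u v.
Proof.
wlog ik : i k / (i < k)%N => [H|].
  have [ik|ki|/ord_inj ->] := ltngtP i k; [exact: H|rewrite rdistC; exact: H|].
  rewrite subrr rnorm0 expr0n /wedge sumr_ge0// => a _; rewrite sumr_ge0// => b _.
  exact: sqnorm_ge0.
rewrite -sqnormE /wedge (bigD1 i)//= (bigD1 k)//= -addrA lerDl addr_ge0//.
  by rewrite sumr_ge0// => b _; exact: sqnorm_ge0.
by rewrite sumr_ge0// => a _; rewrite sumr_ge0// => b _; exact: sqnorm_ge0.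
Qed.

Lemma wedge_le u v (B : R) :
  (forall i k, rnorm (u 0 i * v 0 k - u 0 k * v 0 i : C1 R) <= B) -> wedge u v <= (3 * B) ^+ 2.
Proof.
move=> uB; have B0 : 0 <= B := le_trans (rnorm_ge0 _) (uB ord0 ord0).
apply: le_trans (_ : \sum_(i < 3) \sum_(k < 3) B ^+ 2 <= _); last first.
  have -> : \sum_(i < 3) \sum_(k < 3) B ^+ 2 = 9 * B ^+ 2.
    by rewrite !sumr_const !card_ord -mulrnA mulr_natl.
  by have := sqr_ge0 B; rewrite exprMn; lra.
apply: ler_sum => i _; rewrite big_mkcond/=; apply: ler_sum => k _; case: ifP => _.
  by rewrite sqnormE lerXn2r ?nnegrE ?rnorm_ge0.
exact: sqr_ge0.
Qed.

Lemma wedge_chordal u v (a b : 'I_3) (e : R) : u 0 b = 1 -> v 0 a = 1 -> 0 < e ->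
  chordal u v < e -> wedge u v <= e ^+ 2 * (nsq u * nsq v).
Proof.
move=> ub va e0.
have u1 : 1 <= nsq u by have := nsq_ge u b; rewrite ub rnorm1 expr1n.
have v1 : 1 <= nsq v by have := nsq_ge v a; rewrite va rnorm1 expr1n.
have uv : 0 < nsq u * nsq v by rewrite mulr_gt0// (lt_le_trans ltr01).
rewrite /chordal -/(nsq u) -/(nsq v) -/(wedge u v) -ler_pdivrMr// => h.
have w0 : 0 <= wedge u v / (nsq u * nsq v).
  rewrite divr_ge0//; last exact: ltW.
  by have := wedge_ge u v ord0 ord0; rewrite subrr rnorm0 expr0n.
by rewrite -(sqr_sqrtr w0) lerXn2r ?nnegrE ?sqrtr_ge0//; exact: ltW.
Qed.

(** The 2 x 2 minors put [u 0 i] within [3 * C * e * S] of [u 0 a * v 0 i], where [S] is the sum of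
    the moduli in [u]. Summing over [i], the condition on [18 * C * e] absorbs half of [S], so
    [S <= 6 * C * rnorm (u 0 a)]; dividing by [u 0 a] gives [18 = 3 * 6]. *)
Lemma chordal_small u v (a b : 'I_3) (C e : R) : u 0 b = 1 -> v 0 a = 1 ->
  (forall i, rnorm (v 0 i : C1 R) <= C) -> 0 < e -> 18 * C * e <= 1 -> chordal u v < e ->
  u 0 a != 0 /\ forall i, rnorm (u 0 i / u 0 a - v 0 i : C1 R) <= 18 * C ^+ 2 * e.
Proof.
move=> ub va vC e0 Ce uve.
have Cg : 1 <= C by have := vC a; rewrite va rnorm1.
pose S := rnorm (u 0 ord0 : C1 R) + rnorm (u 0 (inord 1) : C1 R) + rnorm (u 0 (inord 2) : C1 R).
have iS i : rnorm (u 0 i : C1 R) <= S.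
  have n0 := rnorm_ge0 (u 0 ord0 : C1 R); have n1 := rnorm_ge0 (u 0 (inord 1) : C1 R).
  have n2 := rnorm_ge0 (u 0 (inord 2) : C1 R).
  case: i => [[|[|[|//]]] hi].
  - by rewrite (_ : Ordinal hi = ord0) ?/S; [lra|apply: val_inj].
  - by rewrite (_ : Ordinal hi = inord 1) ?/S; [lra|apply: val_inj; rewrite /= inordK].
  - by rewrite (_ : Ordinal hi = inord 2) ?/S; [lra|apply: val_inj; rewrite /= inordK].
have S1 : 1 <= S by have := iS b; rewrite ub rnorm1.
have nu : nsq u <= S ^+ 2.
  rewrite /nsq /S (_ : \sum_(i < 3) _ = sqnorm (u 0 ord0) + sqnorm (u 0 (inord 1)) + sqnorm (u 0 (inord 2))).
    rewrite !sqnormE; have n0 := rnorm_ge0 (u 0 ord0 : C1 R); have n1 := rnorm_ge0 (u 0 (inord 1) : C1 R).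
    have n2 := rnorm_ge0 (u 0 (inord 2) : C1 R); nra.
  rewrite !big_ord_recr big_ord0 /= add0r; congr (sqnorm (u 0 _) + sqnorm (u 0 _) + sqnorm (u 0 _));
    by apply: val_inj; rewrite /= ?inordK.
have nv := nsq_le vC.
have err i : rnorm (u 0 i - u 0 a * v 0 i : C1 R) <= e * S * (3 * C).
  have h0 : 0 <= e * S * (3 * C) by rewrite !mulr_ge0//; lra.
  rewrite -(@ler_pXn2r _ 2)// ?nnegrE ?rnorm_ge0//.
  have := wedge_ge u v i a; rewrite va mulr1 => h; apply: le_trans h _.
  apply: le_trans (wedge_chordal ub va e0 uve) _.
  rewrite (_ : (e * S * (3 * C)) ^+ 2 = e ^+ 2 * (S ^+ 2 * (3 * C) ^+ 2)); last by ring.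
  rewrite ler_pM2l ?exprn_gt0//.
  apply: ler_pM => //; apply: sumr_ge0 => k _; exact: sqnorm_ge0.
have SC : S <= 6 * C * rnorm (u 0 a : C1 R).
  have b1 i : rnorm (u 0 i : C1 R) <= rnorm (u 0 a : C1 R) * C + e * S * (3 * C).
    have := rnorm_lbB (u 0 i : C1 R) (u 0 a * v 0 i); rewrite rnormM.
    have : rnorm (u 0 a : C1 R) * rnorm (v 0 i : C1 R) <= rnorm (u 0 a : C1 R) * C.
      by rewrite ler_wpM2l ?rnorm_ge0.
    have := err i; lra.
  have := b1 ord0; have := b1 (inord 1); have := b1 (inord 2).
  have : 18 * C * e * S <= 1 * S by rewrite ler_wpM2r//; lra.
  rewrite -/S /S; set x := rnorm (u 0 ord0 : C1 R); set y := rnorm _; set t := rnorm _.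
  set s := rnorm (u 0 a : C1 R).
  lra.
have a0 : 0 < rnorm (u 0 a : C1 R).
  rewrite lt_neqAle rnorm_ge0 andbT; apply/eqP => E; move: SC; rewrite -E mulr0; lra.
have ua : (u 0 a : C1 R) != 0 by rewrite -rnorm_gt0.
split => // i; rewrite (_ : u 0 i / u 0 a - v 0 i = (u 0 i - u 0 a * v 0 i) / u 0 a :> C1 R); last by field.
rewrite rnormM rnormV ler_pdivrMr//; apply: le_trans (err i) _.
have : e * S * (3 * C) <= e * (6 * C * rnorm (u 0 a : C1 R)) * (3 * C).
  by rewrite ler_wpM2r ?ler_pM2l//; lra.
lra.
Qed.

Lemma chordal_upper u v (a b : 'I_3) (B e : R) : u 0 b = 1 -> v 0 a = 1 -> 0 < e ->
  (forall i k, rnorm (u 0 i * v 0 k - u 0 k * v 0 i : C1 R) <= B) -> 3 * B < e ->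
  chordal u v < e.
Proof.
move=> ub va e0 uB Be.
have u1 : 1 <= nsq u by have := nsq_ge u b; rewrite ub rnorm1 expr1n.
have v1 : 1 <= nsq v by have := nsq_ge v a; rewrite va rnorm1 expr1n.
have uv : 1 <= nsq u * nsq v by rewrite -[1]mulr1 ler_pM.
have uv0 : 0 < nsq u * nsq v by apply: lt_le_trans uv.
have B0 : 0 <= B := le_trans (rnorm_ge0 _) (uB ord0 ord0).
have w0 : 0 <= wedge u v.
  by have := wedge_ge u v ord0 ord0; rewrite subrr rnorm0 expr0n.
rewrite /chordal -/(nsq u) -/(nsq v) -/(wedge u v).
apply: le_lt_trans Be; rewrite -[leRHS]ger0_norm ?mulr_ge0// -sqrtr_sqr ler_wsqrtr//.
apply: le_trans (wedge_le uB); rewrite ler_pdivrMr//.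
by rewrite -[leLHS]mulr1 ler_wpM2l.
Qed.

End Chordal.

Section Ratios.
Variable R : realType.

(* homogeneous coordinates [1 : z : w], so that the line at infinity is the
   vanishing locus of the coordinate 0 *)
Definition hcoord (i : nat) (q : C2 R) : C1 R := nth 0 [:: 1; q.1; q.2] i.

Definition ratio (i j : nat) (q : C2 R) : C1 R := hcoord i q / hcoord j q.

(** The position of coordinate [i] of [[1 : z : w]] in [affine_vec], which is ordered as
    [[z : w : 1]]. *)
Definition cidx (i : nat) : 'I_3 := inord ((i + 2) %% 3).

Lemma cidxP (a : 'I_3) : exists2 i, (i < 3)%N & a = cidx i.
Proof.
case: a => [[|[|[|//]]] h]; [exists 1%N|exists 2%N|exists 0%N] => //;
  by apply: val_inj; rewrite /= inordK.
Qed.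

Lemma affine_vecE i (q : C2 R) : (i < 3)%N -> affine_vec q 0 (cidx i) = hcoord i q.
Proof. by case: i => [|[|[|//]]] _; rewrite mxE /= inordK. Qed.

Lemma vline_scale (a : R[i]) (v : 'rV[R[i]]_3) : a != 0 -> (<[a *: v]> = <[v]>)%VS.
Proof.
move=> a0; apply/eqP; rewrite eqEsubv -!memvE memvZ ?memv_line//=.
by rewrite -{1}[v](scalerK a0) memvZ// memv_line.
Qed.

Lemma compact_C2_cball (p : C2 R) (r : R) : compact [set q : C2 R | rnorm (q - p) <= r].
Proof.
apply: subclosed_compact (@compact_C2_ball R (rnorm p + r)) _.
  have -> : [set q : C2 R | rnorm (q - p) <= r] =
      (fun q : C2 R => rnorm (q - p)) @^-1` [set x | x <= r] by [].
  apply: closed_comp; last exact: closed_le.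
  move=> q _; apply: (@continuous_comp _ _ _ (fun q : C2 R => q - p) (@rnorm R (C2 R))).
    by apply: continuousB; [exact: id|exact: cst_continuous].
  exact: rnorm_continuous.
by move=> q /= qr; rewrite -lerBlDl; exact: le_trans (rnorm_lbB q p) qr.
Qed.

(* Near [p], the sequence converges in P^2 to [L 0 : L 1 : L 2] with [L j = 1],
   where [j] is the first non-zero coordinate of the limit at [p]. *)
Definition local_limit (E : nat -> C2 R -> C2 R) (p : C2 R) (j : nat) (d : R)
    (L : nat -> C2 R -> C1 R) := [/\ (j < 3)%N, 0 < d,
  forall i q, (i < 3)%N -> rnorm (q - p) < d -> differentiable (L i) q,
  forall i, (i < j)%N -> L i p = 0 &
  forall e, 0 < e -> exists N, forall n q, (N <= n)%N -> rnorm (q - p) < d ->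
    hcoord j (E n q) != 0 /\
    forall i, (i < 3)%N -> rnorm (ratio i j (E n q) - L i q) < e].

(** The local lift [h] of the limit is divided by its first coordinate that is non-zero at [p];
    [chordal_small] turns chordal convergence into convergence of ratios. *)
Lemma P2_local_limit (E : nat -> C2 R -> C2 R) (G : C2 R -> P2 R) (U : set (C2 R)) (p : C2 R) :
  open U -> U p -> P2_holomorphic_on U G ->
  P2_cvg_compacts U (fun n q => affine_chart (E n q)) G ->
  exists j d L, local_limit E p j d L.
Proof.
move=> Uo Up /(_ p Up)[h /nbhs_rnorm[d1 d10 H1]] cvgK.
have [d0 d00 H0] := (nbhs_rnorm p U).1 (open_nbhs_nbhs (conj Uo Up)).
pose hh i := h (cidx i).
have hhd i q : rnorm (q - p) < d1 -> differentiable (hh i) q by move=> /H1[+ _]; apply.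
have ex : exists i, (i < 3)%N && (hh i p != 0).
  apply: contrapT => nex; have pp : rnorm (p - p) < d1 by rewrite subrr rnorm0.
  have [_ GE] := H1 p pp.
  have : \dim (sval (G p)) == 1%N by case: (G p).
  rewrite GE dim_vline; suff -> : (\row_j h j p : 'rV[R[i]]_3) = 0 by rewrite eqxx.
  apply/rowP => a; rewrite !mxE; have [i i3 ->] := cidxP a.
  by apply/eqP/negPn/negP => k; apply: nex; exists i; rewrite i3.
case: (ex_minnP ex) => j /andP[j3 jp] jmin.
have [d2 d20 H2] : exists2 d2 : R, 0 < d2 & forall q, rnorm (q - p) < d2 -> hh j q != 0.
  have pp : rnorm (p - p) < d1 by rewrite subrr rnorm0.
  have hc := differentiable_continuous (hhd j p pp).
  have jp0 : 0 < rnorm (hh j p) by rewrite rnorm_gt0.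
  have [d2 d20 H2] := (cvg_rnorm _ _).1 hc _ jp0; exists d2 => //.
  by move=> q /H2; apply: contraTneq => ->; rewrite sub0r rnormN ltxx.
pose L i q : C1 R := hh i q / hh j q.
have Ld i q : rnorm (q - p) < Num.min d1 d2 -> differentiable (L i) q.
  rewrite lt_min => /andP[q1 q2]; apply: differentiableM; first exact: hhd.
  by apply: differentiableV; [exact: hhd|exact: H2].
have [C [d3 [C1 d30 H3]]] : exists C d3 : R, [/\ 1 <= C, 0 < d3 &
    forall i q, (i < 3)%N -> rnorm (q - p) < d3 -> rnorm (L i q) <= C].
  have bnd i : exists2 d3 : R, 0 < d3 & forall q, rnorm (q - p) < d3 -> rnorm (L i q) <= rnorm (L i p) + 1.
    have hc : differentiable (L i) p by apply: Ld; rewrite subrr rnorm0 lt_min d10.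
    have [d3 d30 H3] := (cvg_rnorm _ _).1 (differentiable_continuous hc) 1 ltr01.
    by exists d3 => // q /H3; have := rnorm_lbB (L i q) (L i p); lra.
  have [a0 a00 b0] := bnd 0%N; have [a1 a10 b1] := bnd 1%N; have [a2 a20 b2] := bnd 2%N.
  exists (rnorm (L 0%N p) + rnorm (L 1%N p) + rnorm (L 2%N p) + 1), (Num.min a0 (Num.min a1 a2)).
  have n0 := rnorm_ge0 (L 0%N p); have n1 := rnorm_ge0 (L 1%N p); have n2 := rnorm_ge0 (L 2%N p).
  split; [lra|by rewrite !lt_min a00 a10|].
  move=> i q i3; rewrite !lt_min => /and3P[/b0 k0 /b1 k1 /b2 k2].
  by case: i i3 => [|[|[|//]]] _; lra.
(* Halved, so that the closed ball of radius [d], which is compact, lies within all four radii. *)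
pose d := Num.min (Num.min d0 d1) (Num.min d2 d3) / 2.
have dd : 0 < Num.min (Num.min d0 d1) (Num.min d2 d3) by rewrite !lt_min d00 d10 d20.
have d'0 : 0 < d by rewrite /d divr_gt0.
have dlt : d < Num.min (Num.min d0 d1) (Num.min d2 d3) by rewrite /d; lra.
move: (dlt); rewrite !lt_min => /andP[/andP[l0 l1] /andP[l2 l3]].
exists j, d, L; split => //.
- by move=> i q _ qd; apply: Ld; rewrite lt_min !(lt_trans qd).
- move=> i ij; rewrite /L; suff -> : hh i p = 0 by rewrite mul0r.
  by apply/eqP/negPn/negP => k; have := jmin i; rewrite k (ltn_trans ij j3) leqNgt ij => /(_ isT).
move=> e e0; pose e' := Num.min (1 / (18 * C)) (e / (18 * C ^+ 2 + 1)).
have C0 : 0 < C by lra.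
have Cg2 : 0 < 18 * C ^+ 2 + 1 by rewrite ltr_wpDl// mulr_ge0// exprn_ge0// ltW.
have e'0 : 0 < e' by rewrite lt_min !divr_gt0// mulr_gt0.
have [e'1 e'2] : 18 * C * e' <= 1 /\ (18 * C ^+ 2 + 1) * e' <= e.
  split; rewrite mulrC -ler_pdivlMr ?mulr_gt0// /e' ge_min lexx ?orbT//.
have KU : [set q : C2 R | rnorm (q - p) <= d] `<=` U.
  by move=> q /= qd; apply: H0; apply: le_lt_trans l0.
have [N _ NH] := cvgK _ (@compact_C2_cball p d) KU e' e'0.
exists N => n q nN qd; have := NH n nN q (ltW qd).
have qd1 : rnorm (q - p) < d1 := lt_trans qd l1.
have qd2 : rnorm (q - p) < d2 := lt_trans qd l2.
have [_ GE] := H1 q qd1.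
have GE' : sval (G q) = <[\row_a (h a q / hh j q)]>%VS.
  rewrite GE (_ : \row_a (h a q / hh j q) = (hh j q)^-1 *: \row_a h a q).
    by apply/esym/vline_scale; rewrite invr_eq0 H2.
  by apply/rowP => a; rewrite !mxE mulrC.
rewrite (P2_distE (u := affine_vec (E n q)) _ GE')// => ch.
have [|||h1 h2] := @chordal_small R _ _ (cidx j) (cidx 0) C e' _ _ _ e'0 e'1 ch.
- by rewrite affine_vecE.
- by rewrite mxE mulfV// H2.
- by move=> a; rewrite mxE; have [i i3 ->] := cidxP a; apply: (H3 i) => //; exact: lt_trans l3.
rewrite affine_vecE// in h1; split => // i i3.
have := h2 (cidx i); rewrite !affine_vecE// mxE => k.
by apply: le_lt_trans k _; apply: lt_le_trans e'2; rewrite ltr_pM2r// ltrDl.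
Qed.

End Ratios.

(** * Limits of iterates in the projective plane *)

(* Unfolding the norm of a product makes failed unifications very costly. *)
Opaque rnorm.

Section Types.
Variable R : realType.

Lemma rnorm_near_le (V : normedModType R[i]) (x l : V) (e B : R) :
  rnorm (x - l) < e -> rnorm l <= B -> rnorm x <= B + e.
Proof. by have := rnorm_lbB x l; lra. Qed.

Lemma rnorm_near_ge (V : normedModType R[i]) (x l : V) (e m : R) :
  rnorm (x - l) < e -> m <= rnorm l -> m - e <= rnorm x.
Proof. by have := rnorm_lbB l x; rewrite rdistC; lra. Qed.

Lemma half_lt1 (x : R) : x <= 1 -> 2^-1 * x < 1.
Proof. lra. Qed.

Lemma rnormBD_C2 (q x p : C2 R) : rnorm (x - p) <= rnorm (x - q) + rnorm (q - p).
Proof. exact: (@rnormBD R (C2 R) q x p). Qed.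

(* [typ E j p]: near [p] the ratios to the coordinate [j] converge uniformly, and
   the coordinates before [j] are negligible with respect to it. *)
Definition typ (E : nat -> C2 R -> C2 R) (j : nat) (p : C2 R) := exists d : R, [/\ 0 < d,
  exists (C : R) N, forall n q i, (N <= n)%N -> rnorm (q - p) < d -> (i < 3)%N ->
    hcoord j (E n q) != 0 /\ rnorm (ratio i j (E n q)) <= C,
  forall e, 0 < e -> exists N, forall n k q i, (N <= n)%N -> (N <= k)%N ->
    rnorm (q - p) < d -> (i < 3)%N -> rnorm (ratio i j (E n q) - ratio i j (E k q)) < e &
  forall i, (i < j)%N -> forall e, 0 < e -> exists N, forall n, (N <= n)%N ->
    forall q, rnorm (q - p) < d -> rnorm (ratio i j (E n q)) < e].

Lemma typ_near E j p : typ E j p ->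
  exists2 d : R, 0 < d & forall q, rnorm (q - p) < d -> typ E j q.
Proof.
case=> d [d0 [C [N bd]] cd sd]; exists (d / 2); first by rewrite divr_gt0.
move=> q qp; have qd x : rnorm (x - q) < d / 2 -> rnorm (x - p) < d.
  by move=> h; apply: le_lt_trans (rnormBD_C2 q x p) _; rewrite (splitr d); exact: ltrD h qp.
exists (d / 2); split; first by rewrite divr_gt0.
- by exists C, N => n x i nN /qd; exact: bd.
- by move=> e /cd[M H]; exists M => n k x i nM kM /qd; exact: H.
- by move=> i ij e /(sd i ij)[M H]; exists M => n nM x /qd; exact: H.
Qed.

Lemma ratioM (i j : nat) (q : C2 R) : hcoord i q != 0 -> hcoord j q != 0 ->
  ratio i j q * ratio j i q = 1.
Proof. by move=> h1 h2; rewrite /ratio; field; rewrite h1 h2. Qed.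

(** For [j < k], [ratio j k] would tend to 0 while its inverse [ratio k j] stays bounded. *)
Lemma typ_inj E j k p : (j < 3)%N -> (k < 3)%N -> typ E j p -> typ E k p -> j = k.
Proof.
wlog jk : j k / (j < k)%N => [H j3 k3 tj tk|].
  by have [h|h|//] := ltngtP j k; [exact: H|apply/esym; exact: H].
move=> j3 k3 [d [d0 [C [N bd]] _ _]] [d' [d'0 [C' [N' bd']] _ sd]].
have pd : rnorm (p - p) < d by rewrite subrr rnorm0.
have pd' : rnorm (p - p) < d' by rewrite subrr rnorm0.
have C0 : 0 < `|C| + 1 by rewrite ltr_wpDl.
have e0 : 0 < (`|C| + 1)^-1 by rewrite invr_gt0.
have [M HM] := sd j jk _ e0; pose n := maxn M (maxn N N').
have nM : (M <= n)%N by rewrite /n !leq_max leqnn.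
have nN : (N <= n)%N by rewrite /n !leq_max leqnn orbT.
have nN' : (N' <= n)%N by rewrite /n !leq_max leqnn !orbT.
have [hj hkj] := bd n p k nN pd k3; have [hk _] := bd' n p j nN' pd' j3.
have := HM n nM p pd'; have := ratioM hj hk => /(congr1 (@rnorm R (C1 R))).
rewrite rnormM rnorm1 => E1 h; exfalso.
have : rnorm (ratio j k (E n p)) * rnorm (ratio k j (E n p)) < 1.
  apply: le_lt_trans (_ : rnorm (ratio j k (E n p)) * (`|C| + 1) < 1).
    by apply: ler_wpM2l; [exact: rnorm_ge0|rewrite (le_trans hkj)// (le_trans (ler_norm C))// lerDl].
  by rewrite -ltr_pdivlMr// div1r.
by rewrite E1 ltxx.
Qed.

Lemma local_limit_typ E p j d L (d' : R) : local_limit E p j d L -> 0 < d' -> d' <= d ->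
  (forall i q, (i < j)%N -> rnorm (q - p) < d' -> L i q = 0) -> typ E j p.
Proof.
case=> j3 d0 Ld L0 LH d'0 d'd Lz.
have bnd i : (i < 3)%N -> exists2 a : R, 0 < a & forall q, rnorm (q - p) < a -> rnorm (L i q) <= rnorm (L i p) + 1.
  move=> i3; have pd : rnorm (p - p) < d by rewrite subrr rnorm0.
  have [a a0 H] := (cvg_rnorm _ _).1 (differentiable_continuous (Ld i p i3 pd)) 1 ltr01.
  exists a => // q /H h; rewrite -lerBlDl.
  by apply: le_trans (rnorm_lbB _ _) _; exact: ltW.
have [a0 a00 b0] := bnd 0%N isT; have [a1 a10 b1] := bnd 1%N isT; have [a2 a20 b2] := bnd 2%N isT.
exists (Num.min d' (Num.min a0 (Num.min a1 a2))).
split; first by rewrite !lt_min d'0 a00 a10.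
- have [N NH] := LH 1 ltr01.
  exists (rnorm (L 0%N p) + rnorm (L 1%N p) + rnorm (L 2%N p) + 1 + 1), N => n q i nN.
  rewrite !lt_min => /and4P[q1 /b0 k0 /b1 k1 /b2 k2] i3.
  have [h1 h2] := NH n q nN (lt_le_trans q1 d'd); split => //.
  have n0 := rnorm_ge0 (L 0%N p); have n1 := rnorm_ge0 (L 1%N p); have n2 := rnorm_ge0 (L 2%N p).
  have := rnorm_near_le (h2 i i3) (B := rnorm (L 0%N p) + rnorm (L 1%N p) + rnorm (L 2%N p) + 1).
  apply; move: k0 k1 k2 n0 n1 n2.
  case: i i3 {h2} => [|[|[|//]]] _; clear; lra.
- move=> e e0; have e20 : 0 < e / 2 by rewrite divr_gt0.
  have [N NH] := LH _ e20; exists N => n k q i nN kN.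
  rewrite !lt_min => /and4P[q1 _ _ _] i3; have qd := lt_le_trans q1 d'd.
  have [_ /(_ i i3) h1] := NH n q nN qd; have [_ /(_ i i3) h2] := NH k q kN qd.
  apply: le_lt_trans (rnormBD (L i q) _ _) _; rewrite (rdistC (L i q)) (splitr e); exact: ltrD h1 h2.
- move=> i ij e e0; have [N NH] := LH _ e0; exists N => n nN q.
  rewrite !lt_min => /and4P[q1 _ _ _].
  have [_ /(_ i (ltn_trans ij j3))] := NH n q nN (lt_le_trans q1 d'd).
  by rewrite Lz// subr0.
Qed.

Variables (f : C1 R -> C1 R) (delta : C1 R).
Variables (E E' : nat -> C2 R -> C2 R) (p : C2 R).
Hypothesis fd : forall a, differentiable f a.
Hypothesis f_nonaffine : ~ exists k0, forall a, f a = f 0 + a * k0.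
Hypothesis delta0 : delta != 0.
Hypothesis Ed : forall n i q, differentiable (fun q => hcoord i (E n q)) q.
Hypothesis EE' : forall n q, E' n q = (f (E n q).1 - delta * (E n q).2, (E n q).1).

Lemma line_near (q : C2 R) (d : R) (c : C1 R) : disc c -> rnorm (q - p) < d ->
  rnorm (p + c *: (2 *: (q - p)) - p) < 2 * d.
Proof.
move=> c1 qd; rewrite addrC addKr scalerA rnormZ.
have -> : rnorm (c * 2 : C1 R) = 2 * rnorm c.
  rewrite mulrC rnormM; congr (_ * _).
  by have := rnorm_real (2 : R); rewrite rmorph_nat ger0_norm.
apply: le_lt_trans (_ : 2 * rnorm (q - p) < _); last by rewrite ltr_pM2l.
by rewrite -mulrA ler_pM2l// ler_piMl// rnorm_ge0.
Qed.

(** Discs towards [q] have direction [2 (q - p)], which places [q] at the parameter [1 / 2], inside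
    the open disc where [hurwitz] and [isolated_zero] conclude. *)
Lemma half_point (q : C2 R) : p + (2^-1 : C1 R) *: (2 *: (q - p)) = q.
Proof. by rewrite scalerA mulVf ?pnatr_eq0// scale1r addrC subrK. Qed.

Lemma rnorm_half : rnorm (2^-1 : C1 R) = 2^-1.
Proof. by rewrite rnormV; have := rnorm_real (2 : R); rewrite rmorph_nat ger0_norm// => ->. Qed.

(** The ratio of coordinate 0 to coordinate [j] is the inverse of [hcoord j], hence zero-free, and
    Hurwitz applies on the line from [p] to [q]. *)
Lemma local_limit_infty j d L : local_limit E p j d L -> (0 < j)%N ->
  forall q, rnorm (q - p) < d / 2 -> L 0%N q = 0.
Proof.
case=> j3 d0 Ld L0 LH j0 q qd.
have near c : disc c -> rnorm (p + c *: (2 *: (q - p)) - p) < d.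
  by move=> c1; have := line_near c1 qd; rewrite mulrC divfK.
have := @hurwitz R (fun n c => ratio 0 j (E n (p + c *: (2 *: (q - p)))))
  (fun c => L 0%N (p + c *: (2 *: (q - p)))) _ _ _ _ (2^-1).
rewrite half_point rnorm_half scale0r addr0; apply.
- have [N NH] := LH 1 ltr01; exists N => n c nN cd.
  have [h _] := NH n _ nN (near c cd); split; last by rewrite /ratio mulf_neq0 ?invr_eq0// oner_eq0.
  apply: (@line_differentiable R _ (fun q => ratio 0 j (E n q))).
  by apply: differentiableM => //; apply: differentiableV.
- move=> c cd; apply: (@line_differentiable R _ (L 0%N)); exact: Ld (near c cd).
- move=> e e0; have [N NH] := LH e e0; exists N => n c nN cd.
  by have [_] := NH n _ nN (near c cd); apply.
- exact: L0.
- by rewrite invf_lt1// ltr1n.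
Qed.

(** If [L 1] is non-zero at [q], its restriction [g] to the line through [p] and [q] has an isolated
    zero at [p], so small discs around [p] satisfy the hypotheses on escaping sequences. Each of the
    three possible leading coordinates [j'] of the limit of [E'] is then excluded. *)
Lemma local_limit_horizontal d L j' d' L' : local_limit E p 2 d L -> local_limit E' p j' d' L' ->
  forall q, rnorm (q - p) < d / 4 -> L 1%N q = 0.
Proof.
move=> lE [j'3 d'0 L'd L'0 L'H] q qd.
have Linf := local_limit_infty lE isT; case: lE => _ d0 Ld L0 LH.
apply: contrapT => /eqP Lq; pose b := 2 *: (q - p); pose pt (c : C1 R) := p + c *: b.
have near c : disc c -> rnorm (pt c - p) < d / 2.
  by move=> c1; have := line_near c1 qd; rewrite (_ : 2 * (d / 4) = d / 2)//; field.
have near' c : disc c -> rnorm (pt c - p) < d.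
  by move/near => h; apply: lt_trans h _; rewrite ltr_pdivrMr// ltr_pMr// ltr1n.
pose zz n c := (E n (pt c)).1; pose ww n c := (E n (pt c)).2.
have zzd n c : differentiable (zz n) c.
  exact: (@line_differentiable R _ (fun q => hcoord 1 (E n q))).
have wwd n c : differentiable (ww n) c.
  exact: (@line_differentiable R _ (fun q => hcoord 2 (E n q))).
pose g (c : C1 R) := L 1%N (pt c).
have gd c : disc c -> differentiable g c.
  by move=> cd; apply: (@line_differentiable R _ (L 1%N)); exact: Ld (near' c cd).
have pt0 : pt 0 = p by rewrite /pt scale0r addr0.
have g0 : g 0 = 0 by rewrite /g pt0; exact: L0.
have cv e : 0 < e -> exists N, forall n c, (N <= n)%N -> disc c ->
    [/\ ww n c != 0, rnorm (zz n c / ww n c - g c) < e & rnorm (ww n c)^-1 < e].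
  move=> /LH[N NH]; exists N => n c nN cd; have [h1 h2] := NH n _ nN (near' c cd).
  split => //; first by have := h2 1%N isT.
  by have := h2 0%N isT; rewrite Linf ?subr0 /ratio ?div1r//; exact: near.
have [r0 [r00 r01 gr]] : exists r0 : R, [/\ 0 < r0, r0 <= 1 & forall c, 0 < rnorm c <= r0 -> g c != 0].
  have gd1 c : rnorm c < 1 -> differentiable g c by move=> /ltW; exact: gd.
  have [H|[r r_0 rH]] := isolated_zero (differentiable_cont_on gd) gd1 g0.
    exfalso; move/eqP: Lq; apply; rewrite -(half_point q); apply: H.
    by rewrite rnorm_half invf_lt1// ltr1n.
  exists (Num.min r 1); split; rewrite ?lt_min ?ge_min ?r_0 ?ltr01 ?lexx ?orbT//.
  by move=> c /andP[c0]; rewrite le_min => /andP[cr _]; apply: rH; rewrite c0.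
have sd (r : R) c : 0 < r -> r <= r0 -> disc c -> disc (0 + r%:C * c : C1 R).
  by move=> r_0 rr0; apply: disc_scale; rewrite ltW//=; exact: le_trans r01.
(* The assumptions on escaping sequences hold on the disc of any radius [r <= r0], the constant
   being half of a lower bound of [g] on its boundary. *)
have hyps r : 0 < r -> r <= r0 -> exists2 m : R, 0 < m & [/\
    (forall B : R, exists N, forall n c, (N <= n)%N -> disc c -> B <= rnorm (ww n (0 + r%:C * c))),
    (forall e, 0 < e -> exists N, forall n, (N <= n)%N ->
      rnorm (zz n (0 + r%:C * 0)) <= e * rnorm (ww n (0 + r%:C * 0))) &
    (exists N, forall n c, (N <= n)%N -> circle c ->
      m * rnorm (ww n (0 + r%:C * c)) <= rnorm (zz n (0 + r%:C * c)))].
  move=> r_0 rr0.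
  have [m m0 mH] : exists2 m : R, 0 < m & forall w, circle w -> m <= rnorm (g (0 + r%:C * w)).
    apply: (@circle_lower_bound R (fun w => g (0 + r%:C * w))) => [|w w1].
      apply: differentiable_cont_on => w w1; apply: differentiable_scale; apply: gd.
      by apply: sd => //; exact: circle_disc.
    by apply: gr; rewrite add0r rnorm_scale ?w1 ?mulr1 ?r_0//; exact: ltW.
  have m20 : 0 < m / 2 by rewrite divr_gt0.
  exists (m / 2) => //; split.
  - move=> B; have B0 : 0 < `|B| + 1 by rewrite ltr_wpDl.
    have eB : 0 < (`|B| + 1)^-1 by rewrite invr_gt0.
    have [N NH] := cv _ eB; exists N => n c nN cd; have [w0 _] := NH n _ nN (sd r c r_0 rr0 cd).
    rewrite rnormV ltf_pV2 ?posrE ?rnorm_gt0// => h.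
    by apply: le_trans (ltW h); rewrite (le_trans (ler_norm B))// lerDl.
  - move=> e e0; have [N NH] := cv e e0; exists N => n nN; rewrite mulr0 addr0.
    have [w0 h _] := NH n 0 nN (disc0 R); move: h; rewrite g0 subr0 rnormM rnormV.
    by rewrite ltr_pdivrMr ?rnorm_gt0// => /ltW.
  - have [N NH] := cv _ m20; exists N => n c nN c1.
    have cd := sd r c r_0 rr0 (circle_disc c1); have [w0 h _] := NH n _ nN cd.
    have := rnorm_near_ge h (mH c c1); rewrite {1}(splitr m) addrK rnormM rnormV.
    by rewrite ler_pdivlMr ?rnorm_gt0.
have b1 : 0 < rnorm b + 1 by rewrite ltr_wpDl// rnorm_ge0.
pose r1 := Num.min r0 (d' / (rnorm b + 1)).
have r10 : 0 < r1 by rewrite lt_min r00 divr_gt0.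
have r1r0 : r1 <= r0 by rewrite /r1 ge_min lexx.
have near1 (r : R) (c : C1 R) : 0 < r -> r <= r1 -> disc c -> rnorm (pt (0 + r%:C * c) - p) < d'.
  move=> r_0 rr cd; rewrite /pt addrC addKr rnormZ add0r rnorm_scale ?ltW//.
  have h : r1 * (rnorm b + 1) <= d' by rewrite -ler_pdivlMr// /r1 ge_min lexx orbT.
  apply: lt_le_trans h; apply: le_lt_trans (_ : r1 * rnorm b < _).
    apply: ler_wpM2r; first exact: rnorm_ge0.
    by apply: le_trans rr; rewrite ler_piMr// ltW.
  by rewrite ltr_pM2l// ltrDl.
have dsc (u : C1 R -> C1 R) (r : R) (c : C1 R) : (forall c, differentiable u c) -> differentiable (fun c : C1 R => u (0 + r%:C * c) : C1 R) c.
  by move=> ud; apply: differentiable_scale.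
have affine r : 0 < r -> r <= r1 -> (exists (C : R) N, forall n c, (N <= n)%N -> circle c ->
    rnorm (f (zz n (0 + r%:C * c)) - delta * ww n (0 + r%:C * c)) <= C * rnorm (zz n (0 + r%:C * c))) -> False.
  move=> r_0 rr H; apply: f_nonaffine; have [m m0 [h1 h2 h3]] := hyps r r_0 (le_trans rr r1r0).
  exact: (@affine_of_linear_growth R f delta (fun n c => zz n (0 + r%:C * c)) (fun n c => ww n (0 + r%:C * c)) m fd
    (fun n c _ => dsc _ _ _ (zzd n)) (fun n c _ => dsc _ _ _ (wwd n)) h1 h2 m0 h3 H).
case: j' j'3 L'0 L'H => [|[|[|//]]] _ L'0 L'H.
(* The next iterate has a finite limit: [z] and [f z - delta * w] are bounded at [p], hence so is
   [w], because [delta] is not 0. *)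
- have pd' : rnorm (p - p) < d' by rewrite subrr rnorm0.
  have [N1 H1] := L'H 1 ltr01.
  pose Z := L' 2%N p; pose Y := L' 1%N p.
  have [k k0 kH] := (cvg_rnorm _ _).1 (differentiable_continuous (fd Z)) 1 ltr01.
  have [N2 H2] := L'H k k0.
  pose B := (rnorm (f Z) + rnorm Y + 2) / rnorm delta.
  have dn0 : 0 < rnorm delta by rewrite rnorm_gt0.
  have B1 : 0 < `|B| + 1 by rewrite ltr_wpDl.
  have eB : 0 < (`|B| + 1)^-1 by rewrite invr_gt0.
  have [N3 H3] := cv _ eB.
  pose n := maxn N1 (maxn N2 N3).
  have n1 : (N1 <= n)%N by rewrite /n !leq_max leqnn.
  have n2 : (N2 <= n)%N by rewrite /n !leq_max leqnn orbT.
  have n3 : (N3 <= n)%N by rewrite /n !leq_max leqnn !orbT.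
  have [_ /(_ 1%N isT) h1] := H1 n p n1 pd'.
  have [_ /(_ 2%N isT) h2] := H2 n p n2 pd'.
  have [w0 _ h3] := H3 n 0 n3 (disc0 R).
  move: h1 h2 h3; rewrite /ratio !divr1 EE' /= /ww pt0 -/Z -/Y => h1 /kH h2.
  rewrite rnormV ltf_pV2 ?posrE ?rnorm_gt0//; last by rewrite /ww pt0 in w0.
  set z := (E n p).1 in h1 h2; set w := (E n p).2 in h1 *.
  have : rnorm delta * rnorm w <= rnorm (f Z) + rnorm Y + 2.
    rewrite -rnormM (_ : delta * w = f z - (f z - delta * w)); last by ring.
    apply: le_trans (rnormB _ _) _.
    have := rnorm_near_le h2 (lexx _); have := rnorm_near_le h1 (lexx _); clear; lra.
  rewrite mulrC -ler_pdivlMr// -/B => h4 h5.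
  by have := ler_norm B; move: h4 h5; clear; lra.
(* Here [f z - delta * w] dominates, and [lam] is the limit of [z / (f z - delta * w)]. If [lam] has
   no zero on a small circle, [f z - delta * w] is at most a multiple of [z] there; if [lam]
   vanishes identically, [next_ratio_not_small] applies. *)
- pose lam (c : C1 R) := L' 2%N (pt (0 + r1%:C * c)).
  have lamd c : disc c -> differentiable lam c.
    move=> cd; apply: (@differentiable_scale R (fun c => L' 2%N (pt c))).
    apply: (@line_differentiable R _ (L' 2%N)); apply: L'd => //; exact: near1.
  have lamd1 c : rnorm c < 1 -> differentiable lam c by move=> /ltW; exact: lamd.
  have [[r2 [r20 r21 lr]]|lam0] : (exists r2 : R, [/\ 0 < r2, r2 <= 1 & forall c, 0 < rnorm c <= r2 -> lam c != 0])
      \/ (forall c, rnorm c < 1 -> lam c = 0).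
    have [l0|l0] := eqVneq (lam 0) 0.
      have [H|[r r_0 rH]] := isolated_zero (differentiable_cont_on lamd) lamd1 l0; first by right.
      left; exists (Num.min r 1); split; rewrite ?lt_min ?ge_min ?r_0 ?ltr01 ?lexx ?orbT//.
      by move=> c /andP[c0]; rewrite le_min => /andP[cr _]; apply: rH; rewrite c0.
    left; have z1 : rnorm (0 : C1 R) < 1 by rewrite rnorm0.
    have l00 : 0 < rnorm (lam 0) by rewrite rnorm_gt0.
    have [r r_0 rH] := (cvg_rnorm _ _).1 (differentiable_continuous (lamd1 0 z1)) _ l00.
    exists (Num.min (r / 2) 1); split; rewrite ?lt_min ?ge_min ?divr_gt0 ?ltr01 ?lexx ?orbT//.
    move=> c /andP[c0]; rewrite le_min => /andP[cr _].
    have : rnorm (c - 0) < r by rewrite subr0; apply: le_lt_trans cr _; rewrite ltr_pdivrMr// ltr_pMr// ltr1n.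
    by move/rH; apply: contraTneq => ->; rewrite sub0r rnormN ltxx.
  + have rr0 : 0 < r1 * r2 by rewrite mulr_gt0.
    have rr1 : r1 * r2 <= r1 by rewrite ler_piMr// ltW.
    apply: (affine (r1 * r2)) => //.
    have [m m0 mH] : exists2 m : R, 0 < m & forall w, circle w -> m <= rnorm (lam (0 + r2%:C * w)).
      apply: (@circle_lower_bound R (fun w => lam (0 + r2%:C * w))) => [|w w1].
        apply: differentiable_cont_on => w w1; apply: differentiable_scale; apply: lamd.
        by apply: disc_scale; rewrite ?r21 ?andbT; [exact: ltW|exact: circle_disc].
      by apply: lr; rewrite add0r (rnorm_scale _ (ltW r20)) w1 mulr1 r20 lexx.
    have m20 : 0 < m / 2 by rewrite divr_gt0.
    have [N NH] := L'H _ m20; exists (2 / m), N => n c nN c1.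
    have [h1 /(_ 2%N isT) h2] := NH n _ nN (near1 _ c rr0 rr1 (circle_disc c1)).
    have := mH c c1; rewrite /lam !add0r mulrA -rmorphM/= -[(r1 * r2)%:C * c]add0r.
    move: h1 h2; rewrite /ratio EE' /= -/(zz n _) -/(ww n _).
    set z := zz n _; set w := ww n _; set l := L' 2%N _; set y := f z - _ => h1 h2 h3.
    have y0 : 0 < rnorm y by rewrite rnorm_gt0.
    have : m / 2 * rnorm y <= rnorm z.
      have := rnorm_near_ge h2 h3; rewrite {1}(splitr m) addrK rnormM rnormV.
      by rewrite ler_pdivlMr.
    rewrite mulrC -ler_pdivlMr// invf_div mulrC; exact.
  (* The vanishing of [lam] is known on the open disc only, hence half the radius. *)
  + have r110 : 0 < r1 / 2 by rewrite divr_gt0.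
    have r111 : r1 / 2 <= r1 by rewrite ler_pdivrMr// ler_pMr// ler1n.
    have [m m0 [h1 h2 h3]] := hyps (r1 / 2) r110 (le_trans r111 r1r0).
    apply: (@next_ratio_not_small R f delta (fun n c => zz n (0 + (r1 / 2)%:C * c))
      (fun n c => ww n (0 + (r1 / 2)%:C * c)) m fd
      (fun n c _ => dsc _ _ _ (zzd n)) (fun n c _ => dsc _ _ _ (wwd n)) h1 h2 m0 h3 delta0 _).
    move=> e e0; have [N NH] := L'H e e0; exists N => n c nN cd.
      have [k1 /(_ 2%N isT) k2] := NH n _ nN (near1 _ c r110 r111 cd).
      have l0 : L' 2%N (pt (0 + (r1 / 2)%:C * c)) = 0.
        have := lam0 (2^-1 * c : C1 R); rewrite /lam !add0r mulrA rnormM rnorm_half.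
        have -> : r1%:C * 2^-1 = (r1 / 2)%:C :> R[i] by rewrite rmorphM/= fmorphV rmorph_nat.
        by apply; exact: half_lt1.
      move: k1 k2; rewrite l0 subr0 /ratio EE' /= -/(zz n _) -/(ww n _) => k1 k2; split => //.
      by move: k2; rewrite rnormM rnormV ltr_pdivrMr ?rnorm_gt0// => /ltW.
(* Here [z] dominates, so [f z - delta * w] is at most a constant times [z]. *)
- apply: (affine r1) => //.
  have lc : cont_on (@circle R) (fun c => L' 1%N (pt (0 + r1%:C * c))).
    apply: differentiable_cont_on => c c1; apply: (@differentiable_scale R (fun c => L' 1%N (pt c))).
    apply: (@line_differentiable R _ (L' 1%N)); apply: L'd => //; apply: near1 => //.
    exact: circle_disc.
  have [M M0 MH] := cont_on_bounded (@compact_circle R) lc.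
  have [N NH] := L'H 1 ltr01; exists (M + 1), N => n c nN c1.
  have [k1 /(_ 1%N isT) k2] := NH n _ nN (near1 _ c r10 (lexx _) (circle_disc c1)).
  have k3 := MH c c1; move: k1 k2; rewrite /ratio EE' /= -/(zz n _) -/(ww n _).
  set z := zz n _; set w := ww n _; set l := L' 1%N _ in k3 *; set y := f z - _ => k1 k2.
  by have := rnorm_near_le k2 k3; rewrite rnormM rnormV ler_pdivrMr ?rnorm_gt0.
Qed.

Lemma local_type j d L j' d' L' : local_limit E p j d L -> local_limit E' p j' d' L' ->
  typ E j p.
Proof.
move=> lE lE'; have [j3 d0 _ _ _] := lE.
have d40 : 0 < d / 4 by rewrite divr_gt0.
apply: (local_limit_typ lE d40); first by rewrite ler_pdivrMr// ler_pMr// ler1n.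
have inf q : (0 < j)%N -> rnorm (q - p) < d / 4 -> L 0%N q = 0.
  move=> j0 qd; apply: (local_limit_infty lE j0); apply: lt_le_trans qd _.
  by rewrite ler_pM2l// lef_pV2 ?posrE// ler_nat.
move=> [|[|i]] q ij qd.
- exact: inf.
- case: j j3 ij lE inf {d40} => [|[|[|//]]] // _ _ lE _; exact: (local_limit_horizontal lE lE').
- by have := leq_trans ij j3.
Qed.

End Types.

(** * Types of subsequences of iterates on compact sets *)

Section Subsequences.
Variable R : realType.

Lemma differentiable_fst (q : C2 R) : differentiable (fun q : C2 R => q.1 : C1 R) q.
Proof.
apply: (@rnorm_differentiable R _ _ _ q (@fst (C1 R) (C1 R) : {linear C2 R -> C1 R}) 1).
  by move=> v; rewrite mul1r rnorm_pair le_max lexx.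
move=> e e0; exists 1 => // h _; rewrite [X in rnorm X](_ : _ = 0) ?rnorm0.
  by rewrite mulr_ge0 ?rnorm_ge0 ?ltW.
by rewrite [(q + h).1](_ : _ = h.1 + q.1) ?addrK ?subrr// addrC.
Qed.

Lemma differentiable_snd (q : C2 R) : differentiable (fun q : C2 R => q.2 : C1 R) q.
Proof.
apply: (@rnorm_differentiable R _ _ _ q (@snd (C1 R) (C1 R) : {linear C2 R -> C1 R}) 1).
  by move=> v; rewrite mul1r rnorm_pair le_max lexx orbT.
move=> e e0; exists 1 => // h _; rewrite [X in rnorm X](_ : _ = 0) ?rnorm0.
  by rewrite mulr_ge0 ?rnorm_ge0 ?ltW.
by rewrite [(q + h).2](_ : _ = h.2 + q.2) ?addrK ?subrr// addrC.
Qed.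

Lemma entire_differentiable (f : C1 R -> C1 R) : entire f -> forall a, differentiable f a.
Proof. by move=> fe a; apply/derivable1_diffP/fe. Qed.

Lemma transcendental_nonaffine (f : C1 R -> C1 R) : transcendental f ->
  ~ exists k0, forall a, f a = f 0 + a * k0.
Proof.
move=> ft [k0 H]; apply: ft; exists ((f 0)%:P + k0 *: 'X) => z.
by rewrite !hornerE H mulrC.
Qed.

Lemma iter_differentiable (f : C1 R -> C1 R) (delta : C1 R) : (forall a, differentiable f a) ->
  forall n i q, differentiable (fun q : C2 R => hcoord i (iter n (henon f delta) q)) q.
Proof.
move=> fd; elim=> [|n IH] i q; case: i => [|[|[|i]]] /=.
- exact: differentiable_cst.
- exact: differentiable_fst.
- exact: differentiable_snd.
- by rewrite /hcoord /= nth_nil; exact: differentiable_cst.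
- exact: differentiable_cst.
- apply: differentiableD.
    by apply: (@differentiable_comp _ _ _ _ _ f); [exact: (IH 1%N)|exact: fd].
  apply: differentiableN; apply: differentiableM; first exact: differentiable_cst.
  exact: (IH 2%N).
- exact: (IH 1%N).
- by rewrite /hcoord /= nth_nil; exact: differentiable_cst.
Qed.

Lemma homo_ltn_geq (k : nat -> nat) : {homo k : m n / (m < n)%N} -> forall n, (n <= k n)%N.
Proof. by move=> kh; elim=> // n IH; apply: leq_ltn_trans IH _; exact: kh. Qed.

Lemma local_limit_subseq E (p : C2 R) j d L (k : nat -> nat) : {homo k : m n / (m < n)%N} ->
  local_limit E p j d L -> local_limit (fun n => E (k n)) p j d L.
Proof.
move=> kh [j3 d0 Ld Lz LH]; split => // e /LH[N NH]; exists N => n q nN.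
by apply: NH; apply: leq_trans nN _; exact: homo_ltn_geq.
Qed.

Lemma typ_subseq E j (p : C2 R) (k : nat -> nat) : {homo k : m n / (m < n)%N} ->
  typ E j p -> typ (fun n => E (k n)) j p.
Proof.
move=> kh [d [d0 [C [N bd]] cd sd]].
have kN M n : (M <= n)%N -> (M <= k n)%N by move=> h; apply: leq_trans h _; exact: homo_ltn_geq.
exists d; split => //.
- by exists C, N => n q i /kN; exact: bd.
- by move=> e /cd[M H]; exists M => n n' q i /kN h /kN; exact: H.
- by move=> i ij e /(sd i ij)[M H]; exists M => n /kN; exact: H.
Qed.

(** Connectedness of the segment: [P] and its negation are both relatively open. *)
Lemma segment_locally_constant (P : R -> Prop) :
  (forall t, 0 <= t <= 1 -> exists2 d : R, 0 < d &
     forall s, 0 <= s <= 1 -> `|s - t| < d -> (P s <-> P t)) ->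
  P 0 -> forall t, 0 <= t <= 1 -> P t.
Proof.
move=> lc P0; pose O (Q : R -> Prop) := [set x : R | exists2 d : R, 0 < d &
  forall s, 0 <= s <= 1 -> `|s - x| < d -> Q s].
have Oo Q : open (O Q).
  rewrite openE => x [d d0 H]; apply/nbhs_ballP; exists (d / 2); first by rewrite /= divr_gt0.
  move=> y; rewrite /ball /= => xy; exists (d / 2); first by rewrite divr_gt0.
  move=> s s1 sy; apply: H => //; rewrite -[s - x](subrKA y) (splitr d).
  by apply: le_lt_trans (ler_normD _ _) _; rewrite ltrD// distrC.
have := @segment_connected R 0 1; rewrite /connected => /(_ (`[0, 1] `&` [set t | P t])) cE.
have E : `[0, 1] `&` [set t | P t] = `[0, 1]%classic; last first.
  by move=> t t1; have : `[0, 1]%classic t by []; rewrite -E => -[].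
apply: cE.
- by exists 0; split => //=; rewrite in_itv /= lexx ler01.
- exists (O P) => //; apply/seteqP; split => t /= [t1 Pt]; split => //; rewrite in_itv /= in t1.
    by have [d d0 H] := lc t t1; exists d => // s s1 /(H s s1)[_]; apply.
  by case: Pt => d d0; apply => //; rewrite subrr normr0.
- exists (~` O (fun s => ~ P s)); first exact/open_closedC.
  apply/seteqP; split => t /= [t1 Pt]; split => //; rewrite in_itv /= in t1.
    by case=> d d0 /(_ t t1); apply=> //; rewrite subrr normr0.
  apply: contrapT => nPt; apply: Pt; have [d d0 H] := lc t t1.
  by exists d => // s s1 /(H s s1)[h _] /h.
Qed.

Lemma lt_scale (x y z : R) : 0 < z -> x < y / z -> x * z < y.
Proof. by move=> z0; rewrite ltr_pdivlMr. Qed.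

(** By [typ_near] a type persists nearby and by [typ_inj] no other can hold there, so having type
    [j] is locally constant along the segment. *)
Lemma typ_segment E j (a v : C2 R) : (j < 3)%N ->
  (forall t : R, 0 <= t <= 1 -> exists2 k, (k < 3)%N & typ E k (a + t%:C *: v)) ->
  typ E j a -> typ E j (a + v).
Proof.
move=> j3 H ta; have := @segment_locally_constant (fun t => typ E j (a + t%:C *: v)) _ _ 1.
rewrite scale1r; apply; last by rewrite ler01 lexx.
  move=> t t1; have [k k3 tk] := H t t1; have [d d0 dH] := typ_near tk.
  have v1 : 0 < rnorm v + 1 by rewrite ltr_wpDl ?rnorm_ge0.
  exists (d / (rnorm v + 1)); first by rewrite divr_gt0.
  move=> s _ /(lt_scale v1) st.
  have ks : typ E k (a + s%:C *: v).
    apply: dH; have -> : a + s%:C *: v - (a + t%:C *: v) = (s - t)%:C *: v.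
      by rewrite opprD addrACA subrr add0r -scalerBl rmorphB.
    rewrite rnormZ rnorm_real; apply: le_lt_trans st.
    by rewrite ler_wpM2l// lerDl.
  by split => h; [rewrite (typ_inj j3 k3 h ks)|rewrite (typ_inj j3 k3 h tk)].
by rewrite scale0r addr0.
Qed.

Lemma open_rnorm_ball (p : C2 R) (r : R) : open [set x | rnorm (x - p) < r].
Proof.
rewrite openE => y yr; apply/nbhs_rnorm; exists (r - rnorm (y - p)); first by rewrite subr_gt0.
by move=> z zr; apply: le_lt_trans (rnormBD_C2 y z p) _; move: zr; rewrite ltrBrDr.
Qed.

(** [compact_near_coveringP] for the filter on finite lists generated by the lists in [K] that
    extend a given one. *)
Lemma compact_finite_cover (K : set (C2 R)) (d : C2 R -> R) : compact K ->
  (forall p, K p -> 0 < d p) ->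
  exists2 s : seq (C2 R), (forall p, p \in s -> K p) &
    forall x, K x -> exists2 p, p \in s & rnorm (x - p) < d p.
Proof.
move=> /compact_near_coveringP cK d0.
pose Fs : set_system (seq (C2 R)) := [set A : set (seq (C2 R)) | exists2 s : seq (C2 R), (forall p, p \in s -> K p) &
  forall s' : seq (C2 R), {subset s <= s'} -> (forall p, p \in s' -> K p) -> A s'].
have FF : Filter Fs.
  split.
  - by exists [::].
  - move=> A B [s sK sA] [s' sK' sB]; exists (s ++ s').
      by move=> p; rewrite mem_cat => /orP[/sK|/sK'].
    move=> r sr rK; split; [apply: sA|apply: sB] => // p ps; apply: sr;
      by rewrite mem_cat ps ?orbT.
  - by move=> A B AB [s sK sA]; exists s => // r sr rK; apply: AB; exact: sA.
have [] := cK _ Fs (fun (s : seq (C2 R)) x => exists2 p, p \in s & rnorm (x - p) < d p) FF.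
  move=> x Kx; exists ([set x' | rnorm (x' - x) < d x], [set s : seq (C2 R) | x \in s]).
    split; first by apply/nbhs_rnorm; exists (d x) => //; exact: d0.
    exists [:: x]; first by move=> p; rewrite inE => /eqP ->.
    by move=> s' H _; apply: H; rewrite inE.
  by move=> [x' s] /= [xd xs]; exists x.
move=> s sK H; exists s => // x Kx; exact: (H s (fun _ => id) sK x Kx).
Qed.

Variables (f : C1 R -> C1 R) (delta : C1 R).
Hypothesis fd : forall a, differentiable f a.
Hypothesis f_nonaffine : ~ exists k0, forall a, f a = f 0 + a * k0.
Hypothesis delta0 : delta != 0.
Notation F := (henon f delta).

(** Normality is used twice: for the iterates [m n] and, along the first subsequence, for their
    successors, which [local_type] takes as [E']. The radius [d] does not depend on [m], as the
    successive extractions in [fatou_typ] require. *)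
Lemma fatou_typ_near (p : C2 R) : fatou_set F p -> exists2 d : R, 0 < d &
  forall m : nat -> nat, exists2 k : nat -> nat, {homo k : m n / (m < n)%N} &
    forall x, rnorm (x - p) < d ->
      exists2 j, (j < 3)%N & typ (fun n => iter (m (k n)) F) j x.
Proof.
case=> U [Uo Up UN]; have [d d0 dU] := (nbhs_rnorm p U).1 (open_nbhs_nbhs (conj Uo Up)).
exists d => // m.
have [|k1 [G1 [k1h G1h G1c]]] := UN (fun n => @affine_chart R \o iter (m n) F).
  by move=> n; exists (m n).
have [|k2 [G2 [k2h G2h G2c]]] := UN (fun n => @affine_chart R \o iter (m (k1 n)).+1 F).
  by move=> n; exists (m (k1 n)).+1.
exists (k1 \o k2); first by move=> i j /k2h/k1h.
move=> x /dU Ux.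
have [j [d1 [L lE]]] := P2_local_limit Uo Ux G1h G1c.
have [j' [d2 [L' lE']]] := P2_local_limit Uo Ux G2h G2c.
exists j; first by case: lE.
apply: (@local_type R f delta (fun n => iter (m (k1 (k2 n))) F)
  (fun n => iter (m (k1 (k2 n))).+1 F) x fd f_nonaffine delta0 _ _ j d1 L j' d2 L') => //.
- by move=> n; exact: iter_differentiable.
- exact: (local_limit_subseq k2h lE).
Qed.

(** One extraction for each ball of a finite cover; [typ_subseq] preserves what the earlier
    extractions achieved. *)
Lemma fatou_typ (K : set (C2 R)) : compact K -> K `<=` fatou_set F ->
  forall m : nat -> nat, exists2 k : nat -> nat, {homo k : m n / (m < n)%N} &
    forall x, K x -> exists2 j, (j < 3)%N & typ (fun n => iter (m (k n)) F) j x.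
Proof.
move=> cK KS.
pose near (p : C2 R) (d : R) := K p -> 0 < d /\
  forall m : nat -> nat, exists2 k : nat -> nat, {homo k : m n / (m < n)%N} &
    forall x, rnorm (x - p) < d ->
      exists2 j, (j < 3)%N & typ (fun n => iter (m (k n)) F) j x.
have [|d dP] := @choice _ _ near.
  move=> p; have [Kp|nKp] := pselect (K p); last by exists 0.
  by have [d d0 H] := fatou_typ_near (KS p Kp); exists d.
have [s sK KD] := compact_finite_cover cK (fun p Kp => (dP p Kp).1).
move=> m; suff [k kh H] : exists2 k : nat -> nat, {homo k : m n / (m < n)%N} &
    forall p x, p \in s -> rnorm (x - p) < d p ->
      exists2 j, (j < 3)%N & typ (fun n => iter (m (k n)) F) j x.
  by exists k => // x /KD[p pD]; exact: H.
elim: s sK {KD} => [|p s IH] sK; first by exists id.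
have [|k kh H] := IH; first by move=> q qs; apply: sK; rewrite in_cons qs orbT.
have [_ /(_ (m \o k))[k' kh' H']] := dP p (sK p (mem_head _ _)).
exists (k \o k'); first by move=> i j /kh'/kh.
move=> q x; rewrite in_cons => /predU1P[->|qs xq]; first exact: H'.
have [j j3 tj] := H q x qs xq; exists j => //.
exact: (@typ_subseq (fun n => iter (m (k n)) F) j x k' kh' tj).
Qed.
End Subsequences.

(** * The continuity principle for the Fatou set *)

Section Discs.
Variable R : realType.
Variables (a b : C2 R) (q : C1 R -> C1 R).
Hypothesis qd : forall c, disc c -> differentiable q c.

Definition exp_disc (c : C1 R) (v : C2 R) : C2 R := a + c *: b + cexp (- q c) *: v.

Lemma differentiable_cexpN (c : C1 R) : disc c -> differentiable (fun c : C1 R => cexp (- q c)) c.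
Proof.
move=> /qd qc; apply: (@differentiable_comp _ _ _ _ (fun c : C1 R => - q c) (@cexp R)).
  exact: differentiableN.
exact: differentiable_cexp.
Qed.

Lemma exp_disc_differentiable (v : C2 R) (c : C1 R) : disc c -> differentiable (exp_disc^~ v) c.
Proof.
move=> c1; apply: differentiableD.
  apply: differentiableD; first exact: differentiable_cst.
  by apply: (@differentiableZl _ _ _ (fun c : C1 R => c)).
by apply: (@differentiableZl _ _ _ (fun c : C1 R => cexp (- q c))); exact: differentiable_cexpN.
Qed.

Lemma differentiable_exp_disc (h : C2 R -> C1 R) (v : C2 R) (c : C1 R) : disc c ->
  differentiable h (exp_disc c v) -> differentiable (fun c => h (exp_disc c v)) c.
Proof.
move=> c1 hd; apply: (@differentiable_comp _ _ _ _ (exp_disc^~ v) h); [exact: exp_disc_differentiable|exact: hd].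
Qed.

Lemma exp_disc_bounded : exists2 M : R, 0 < M & forall c, disc c -> rnorm (cexp (- q c) : C1 R) <= M.
Proof.
apply: cont_on_bounded; first exact: compact_disc.
by apply: differentiable_cont_on => c; exact: differentiable_cexpN.
Qed.

Lemma exp_disc_radius (t : R) : exists M : R, forall c v, disc c -> rnorm v <= t -> rnorm (exp_disc c v - 0) <= M.
Proof.
have [M M0 MH] := exp_disc_bounded; exists (rnorm a + rnorm b + M * t) => c v c1 vt.
rewrite subr0 /exp_disc; apply: le_trans (rnormD _ _) _; apply: lerD.
  apply: le_trans (rnormD _ _) _; rewrite lerD2l rnormZ ler_piMl ?rnorm_ge0//.
rewrite rnormZ; apply: ler_pM; [exact: rnorm_ge0|exact: rnorm_ge0|exact: MH|exact: vt].
Qed.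

Lemma exp_discB (c : C1 R) (s s' : R) (v : C2 R) :
  exp_disc c (s'%:C *: v) - exp_disc c (s%:C *: v) = cexp (- q c) *: ((s' - s)%:C *: v).
Proof. by rewrite /exp_disc opprD addrACA subrr add0r -scalerBr -scalerBl rmorphB. Qed.

Lemma exp_discZ (c : C1 R) (s : R) (v : C2 R) :
  exp_disc c (s%:C *: v) = a + c *: b + s%:C *: (cexp (- q c) *: v).
Proof. by congr (_ + _); rewrite !scalerA [X in X *: _]mulrC. Qed.

Lemma exp_disc_near (c : C1 R) (s s' M d : R) (v : C2 R) : 0 < M -> rnorm (cexp (- q c) : C1 R) <= M ->
  `|s' - s| < d / (M * (rnorm v + 1)) ->
  rnorm (exp_disc c (s'%:C *: v) - exp_disc c (s%:C *: v)) < d.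
Proof.
move=> M0 cM ss; have v10 : 0 < rnorm v + 1 by rewrite ltr_wpDl ?rnorm_ge0.
have := lt_scale (mulr_gt0 M0 v10) ss; rewrite exp_discB !rnormZ rnorm_real.
apply: le_lt_trans; rewrite [X in _ <= X]mulrCA.
apply: ler_pM; [exact: rnorm_ge0|by rewrite mulr_ge0 ?rnorm_ge0|exact: cM|].
by apply: ler_wpM2l => //; rewrite lerDl.
Qed.

Lemma exp_disc0 (c : C1 R) : exp_disc c 0 = a + c *: b.
Proof. by rewrite /exp_disc scaler0 addr0. Qed.

Lemma rnorm_scale_le (t s : R) (v : C2 R) : 0 <= s <= 1 -> rnorm v <= t -> rnorm (s%:C *: v) <= t.
Proof.
move=> /andP[s0 s1] vt; rewrite rnormZ rnorm_real ger0_norm//.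
by apply: le_trans vt; rewrite ler_piMl ?rnorm_ge0.
Qed.

(* Moving the disc [exp_disc^~ (s *: v)] from [s = 0] to [s = 1], no zero can enter it,
   because the minimum principle keeps [h] away from 0. *)
Lemma exp_disc_lower_bound (h : C2 R -> C1 R) (t m : R) : (forall x, differentiable h x) -> 0 < m ->
  (forall c, disc c -> m <= rnorm (h (a + c *: b))) ->
  (forall c v, circle c -> rnorm v <= t -> m <= rnorm (h (exp_disc c v))) ->
  forall c v, disc c -> rnorm v <= t -> m <= rnorm (h (exp_disc c v)).
Proof.
move=> hd m0 h0 h1 c v c1 vt.
have [M MH] := exp_disc_radius t; have [M1 M10 M1H] := exp_disc_bounded.
have m20 : 0 < m / 2 by rewrite divr_gt0.
have [d d0 dH] := heine (@compact_C2_cball R 0 M)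
  (differentiable_cont_on (fun x _ => hd x) : cont_on _ h) m20.
pose P (s : R) := forall c, disc c -> m <= rnorm (h (exp_disc c (s%:C *: v))).
pose d' := d / (M1 * (rnorm v + 1)).
have d'0 : 0 < d' by rewrite divr_gt0// mulr_gt0// ltr_wpDl ?rnorm_ge0.
have near s s' : 0 <= s <= 1 -> 0 <= s' <= 1 -> `|s' - s| < d' -> P s -> P s'.
  move=> s01 s'01 ss Ps z zd.
  (* Uniform continuity leaves [h] at least [m / 2], hence zero-free, on the disc for [s']; the
     minimum principle with the boundary bound restores the full [m], so that the step length [d']
     never shrinks. *)
  apply: (@min_modulus R (fun c => h (exp_disc c (s'%:C *: v))) m _ _ m0 _ z zd).
  - by move=> w wd; apply: differentiable_exp_disc; [exact: wd|exact: hd].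
  - move=> w wd; have k1 := rnorm_scale_le s01 vt; have k2 := rnorm_scale_le s'01 vt.
    have : rnorm (h (exp_disc w (s'%:C *: v)) - h (exp_disc w (s%:C *: v))) < m / 2.
      exact: (dH _ _ (MH _ _ wd k1) (MH _ _ wd k2) (exp_disc_near M10 (M1H w wd) ss)).
    move=> k3; rewrite -rnorm_gt0; apply: lt_le_trans (rnorm_near_ge k3 (Ps w wd)).
    by rewrite [X in X - _](splitr m) addrK.
  - by move=> w w1; apply: h1; [exact: w1|exact: rnorm_scale_le].
have P1 : P 1.
  apply: (@segment_locally_constant R P); last by rewrite ler01 lexx.
    move=> s s01; exists d' => // s' s'01 ss; split; first by apply: near => //; rewrite distrC.
    exact: near.
  by move=> w wd; rewrite scale0r exp_disc0; exact: h0.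
by have := P1 c c1; rewrite scale1r.
Qed.

(** As [v] varies, the centres of the discs fill a ball around [a], because [cexp] has no zero. *)
Lemma exp_disc_center (x : C2 R) : x = exp_disc 0 ((cexp (- q 0))^-1 *: (x - a)).
Proof. by rewrite /exp_disc scale0r addr0 scalerA mulfV ?cexp_neq0// scale1r addrC subrK. Qed.

Lemma exp_disc_center_norm (x : C2 R) (t : R) : rnorm (x - a) < t * rnorm (cexp (- q 0) : C1 R) ->
  rnorm ((cexp (- q 0))^-1 *: (x - a)) <= t.
Proof.
move=> xt; rewrite rnormZ rnormV mulrC ler_pdivrMr ?rnorm_gt0 ?cexp_neq0//; exact: ltW.
Qed.

Lemma exp_disc_max (u : C2 R -> C1 R) (t M : R) (x : C2 R) :
  (forall c v, disc c -> rnorm v <= t -> differentiable u (exp_disc c v)) ->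
  (forall c v, circle c -> rnorm v <= t -> rnorm (u (exp_disc c v)) <= M) ->
  rnorm (x - a) < t * rnorm (cexp (- q 0) : C1 R) -> rnorm (u x) <= M.
Proof.
move=> ud uM /exp_disc_center_norm; rewrite {2}(exp_disc_center x); move: (_ *: _) => v vt.
apply: (@max_modulus_disc R (fun c => u (exp_disc c v)) M _ _ 0 (@disc0 R)).
  by move=> c c1; apply: differentiable_exp_disc; [exact: c1|exact: ud].
by move=> c c1; exact: uM.
Qed.

(** A Hartogs figure: the boundaries of all the discs, together with the full disc for [v = 0]. *)
Definition exp_disc_boundary (t : R) : set (C2 R) :=
  (fun cv : C1 R * C2 R => exp_disc cv.1 cv.2) @` (@circle R `*` [set v : C2 R | rnorm v <= t])
  `|` (fun c : C1 R => exp_disc c 0) @` @disc R.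

Lemma exp_disc_boundary_circle (t : R) (c : C1 R) (v : C2 R) : circle c -> rnorm v <= t ->
  exp_disc_boundary t (exp_disc c v).
Proof. by move=> c1 vt; left; apply: (@imageP _ _ _ _ (c, v)); split; [exact: c1|exact: vt]. Qed.

Lemma exp_disc_boundary_disc (t : R) (c : C1 R) : disc c -> exp_disc_boundary t (a + c *: b).
Proof. by move=> c1; right; exists c; [exact: c1|exact: exp_disc0]. Qed.

Lemma exp_disc_boundaryP (t : R) (S : set (C2 R)) :
  (forall c v, circle c -> rnorm v <= t -> S (exp_disc c v)) ->
  (forall c, disc c -> S (a + c *: b)) -> exp_disc_boundary t `<=` S.
Proof.
move=> S1 S2 y [[[c v] [/= c1 vt] <-]|[c c1 <-]]; first exact: S1.
by rewrite exp_disc0; exact: S2.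
Qed.

Lemma compact_exp_disc_boundary (t : R) : compact (exp_disc_boundary t).
Proof.
apply: compactU.
  apply: continuous_compact; last first.
    by apply: compact_setX; [exact: compact_circle|exact: compact_C2_ball].
  apply: continuous_in_subspaceT => -[c v] /set_mem[/= /circle_disc c1 _].
  have ec : {for c, continuous (fun c : C1 R => cexp (- q c))}.
    by apply: differentiable_continuous; exact: differentiable_cexpN.
  apply: cvgD.
    apply: cvgD; first exact: cvg_cst.
    by apply: cvgZ; [exact: cvg_fst|exact: cvg_cst].
  apply: cvgZ; last exact: cvg_snd.
  apply: (@cvg_comp _ _ _ fst (fun c : C1 R => cexp (- q c)) _ (nbhs c)); last exact: ec.
  exact: cvg_fst.
apply: continuous_compact; last exact: compact_disc.
apply: continuous_in_subspaceT => c /set_mem c1.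
by apply: differentiable_continuous; exact: exp_disc_differentiable.
Qed.
End Discs.

Section Limits.
Variable R : realType.

Lemma ratio_diag (j : nat) (p : C2 R) : hcoord j p != 0 -> ratio j j p = 1.
Proof. by move=> h; rewrite /ratio divff. Qed.

Lemma wedge_close (u1 u2 v1 v2 : C1 R) (C e : R) : rnorm v1 <= C -> rnorm v2 <= C ->
  rnorm (u1 - v1) <= e -> rnorm (u2 - v2) <= e -> rnorm (u1 * v2 - u2 * v1) <= 2 * (C * e).
Proof.
move=> c1 c2 e1 e2; have -> : u1 * v2 - u2 * v1 = (u1 - v1) * v2 - (u2 - v2) * v1.
  rewrite !mulrBl [v2 * v1]mulrC opprB addrA addrNK //.
apply: le_trans (rnormB _ _) _; rewrite [2 * _]mulr_natl mulr2n [C * e]mulrC !rnormM.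
by apply: lerD; apply: ler_pM => //; exact: rnorm_ge0.
Qed.

Lemma lt_of_seventh (c e : R) : 0 < c -> 0 < e -> 3 * (2 * (c * (e / (7 * c)))) < e.
Proof.
move=> c0 e0; have -> : 2 * (c * (e / (7 * c))) = e * (2 / 7) by field; rewrite gt_eqF.
by lra.
Qed.

(** The limits of the ratios exist by completeness and are holomorphic by [weierstrass]; since
    coordinate [j] of the limit is 1, they define a point of P^2. *)
Lemma ratio_limit (E : nat -> C2 R -> C2 R) (a : C2 R) (r C : R) (j N : nat) : (j < 3)%N ->
  (forall n i q, differentiable (fun q => hcoord i (E n q)) q) ->
  (forall n x i, (N <= n)%N -> rnorm (x - a) < r -> (i < 3)%N ->
     hcoord j (E n x) != 0 /\ rnorm (ratio i j (E n x)) <= C) ->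
  (forall e, 0 < e -> exists M, forall n k x i, (M <= n)%N -> (M <= k)%N ->
     rnorm (x - a) < r -> (i < 3)%N -> rnorm (ratio i j (E n x) - ratio i j (E k x)) <= e) ->
  exists2 G, P2_holomorphic_on [set x | rnorm (x - a) < r] G &
    P2_cvg_compacts [set x | rnorm (x - a) < r] (fun n x => affine_chart (E n x)) G.
Proof.
move=> j3 Ed bd cd.
pose isl (ix : nat * C2 R) (l : C1 R) := (ix.1 < 3)%N -> rnorm (ix.2 - a) < r ->
  forall e : R, 0 < e -> exists M, forall n, (M <= n)%N -> rnorm (ratio ix.1 j (E n ix.2) - l) < e.
have [|l0 l0P] := @choice _ _ isl.
  move=> [i x]; have [i3|i3] := boolP (i < 3)%N; last by exists 0 => /= h; rewrite h in i3.
  have [xr|xr] := boolP (rnorm (x - a) < r); last by exists 0 => /= _ h; rewrite h in xr.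
  have [e e0|l lP] := @C1_complete R (fun n => ratio i j (E n x)).
    have e20 : 0 < e / 2 by rewrite divr_gt0.
    have [M MH] := cd _ e20; exists M => n m nM mM.
    by apply: le_lt_trans (MH n m x i nM mM xr i3) _; rewrite gtr_pMr// invf_lt1// ltr1n.
  by exists l => _ _.
(* Coordinate [j] is set to 1 everywhere, so that [lv x] spans a line also outside the ball, where
   [l0] is arbitrary. *)
pose l i x : C1 R := if i == j then 1 else l0 (i, x).
have lu e : 0 < e -> exists M, forall n x i, (M <= n)%N -> rnorm (x - a) < r -> (i < 3)%N ->
    rnorm (ratio i j (E n x) - l i x) <= e.
  move=> e0; have [M MH] := cd e e0; exists (maxn M N) => n x i.
  rewrite geq_max => /andP[nM nN] xr i3; rewrite /l; case: eqP => [->|_].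
    by rewrite ratio_diag ?subrr ?rnorm0 ?ltW//; exact: (bd n x i nN xr i3).1.
  rewrite rdistC; apply: (rnorm_lim_le (l0P (i, x) i3 xr)); exists M => k kM.
  exact: MH.
have ld i x : (i < 3)%N -> rnorm (x - a) < r -> differentiable (l i) x.
  move=> i3; apply: (@weierstrass R _ (fun n x => ratio i j (E n x)) (l i) a r).
    exists N => n x' nN xr; apply: differentiableM; first exact: Ed.
    by apply: differentiableV; [exact: Ed|exact: (bd n x' i nN xr i3).1].
  move=> e e0; have e20 : 0 < e / 2 by rewrite divr_gt0.
  have [M MH] := lu _ e20; exists M => n x' nM xr.
  by apply: le_lt_trans (MH n x' i nM xr i3) _; rewrite gtr_pMr// invf_lt1// ltr1n.
have lC i x : (i < 3)%N -> rnorm (x - a) < r -> rnorm (l i x) <= C.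
  move=> i3 xr; apply/ler_addgt0Pr => e e0; have [M MH] := lu e e0.
  have h1 := MH _ x i (leq_maxl M N) xr i3; have [_ h2] := bd _ x i (leq_maxr M N) xr i3.
  have := rnorm_lbB (l i x) (ratio i j (E (maxn M N) x)); rewrite rdistC => h3.
  by rewrite addrC -lerBlDr; apply: le_trans (le_trans _ h3) h1; rewrite lerB.
pose idx (k : 'I_3) := ((k + 1) %% 3)%N.
have idx3 k : (idx k < 3)%N by rewrite ltn_mod.
have idxK i : (i < 3)%N -> idx (cidx i) = i.
  by case: i => [|[|[|//]]] _; rewrite /idx /cidx inordK.
pose lv x : 'rV[R[i]]_3 := \row_k l (idx k) x.
have lvE i x : (i < 3)%N -> lv x 0 (cidx i) = l i x by move=> i3; rewrite mxE idxK.
have lj x : lv x 0 (cidx j) = 1 by rewrite lvE// /l eqxx.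
have lv0 x : \dim <[lv x]>%VS == 1%N.
  rewrite dim_vline; suff -> : lv x != 0 by [].
  by apply/eqP => /rowP/(_ (cidx j)); rewrite lj mxE => /eqP; rewrite oner_eq0.
exists (fun x => exist _ <[lv x]>%VS (lv0 x) : P2 R).
  move=> p pr; exists (fun k => l (idx k)); apply/nbhs_rnorm.
  exists (r - rnorm (p - a)); first by rewrite subr_gt0.
  move=> q; rewrite ltrBrDr => qr; split; last exact: erefl.
  by move=> k; apply: ld; [exact: idx3|exact: le_lt_trans (rnormBD_C2 p q a) qr].
move=> K _ Kr e e0; have C1' : 0 < `|C| + 1 by rewrite ltr_wpDl.
(* [chordal_upper] loses a factor 3 and [wedge_close] a factor 2; 7 exceeds their product. *)
have e'0 : 0 < e / (7 * (`|C| + 1)) by rewrite divr_gt0// mulr_gt0.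
have [M MH] := lu _ e'0; exists (maxn M N) => // n /=.
rewrite geq_max => /andP[nM nN] x /Kr /= xr.
have hj := (bd n x j nN xr j3).1.
rewrite (P2_distE (u := (hcoord j (E n x))^-1 *: affine_vec (E n x)) (v := lv x)) //; last first.
  by rewrite vline_scale// invr_eq0.
have uE i : (i < 3)%N -> ((hcoord j (E n x))^-1 *: affine_vec (E n x)) 0 (cidx i) = ratio i j (E n x).
  by move=> i3; rewrite mxE affine_vecE// mulrC.
apply: (@chordal_upper R _ _ (cidx j) (cidx j) (2 * ((`|C| + 1) * (e / (7 * (`|C| + 1)))))) => //.
- by rewrite uE// ratio_diag.
- move=> i k; have [i' i3 ->] := cidxP i; have [k' k3 ->] := cidxP k.
  rewrite !uE// !lvE//; apply: wedge_close; [| |exact: MH|exact: MH].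
    by apply: le_trans (lC _ _ i3 xr) _; apply: le_trans (ler_norm C) _; rewrite lerDl.
  by apply: le_trans (lC _ _ k3 xr) _; apply: le_trans (ler_norm C) _; rewrite lerDl.
- exact: lt_of_seventh.
Qed.

(** A bound on the ratio of coordinate 0 to coordinate [j] is a lower bound on [hcoord j].
    [exp_disc_lower_bound] spreads it over all the discs; there the ratios are holomorphic, and the
    maximum principle applies to them and to their differences. *)
Lemma exp_disc_extension (E : nat -> C2 R -> C2 R) (a b : C2 R) (q : C1 R -> C1 R) (t : R) (j : nat) :
  (j < 3)%N -> 0 < t -> (forall c, disc c -> differentiable q c) ->
  (forall n i q, differentiable (fun q => hcoord i (E n q)) q) ->
  (forall x, exp_disc_boundary a b q t x -> typ E j x) ->
  exists2 G, P2_holomorphic_on [set x | rnorm (x - a) < t * rnorm (cexp (- q 0) : C1 R)] G &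
    P2_cvg_compacts [set x | rnorm (x - a) < t * rnorm (cexp (- q 0) : C1 R)]
      (fun n x => affine_chart (E n x)) G.
Proof.
move=> j3 t0 qd Ed tK; have cK := @compact_exp_disc_boundary R a b q qd t.
have K1 := @exp_disc_boundary_circle R a b q t.
have K2 := @exp_disc_boundary_disc R a b q t.
have [|N NH] := compact_uniform (P := fun N x => forall n i, (N <= n)%N -> (i < 3)%N ->
    hcoord j (E n x) != 0 /\ rnorm (ratio i j (E n x)) <= N%:R) cK.
  move=> x /tK[d [d0 [C [N bd]] _ _]]; exists d => //.
  exists (maxn N (archimedean.Num.bound `|C|)) => x' M _ xd.
  rewrite geq_max => /andP[NM CM] n i Mn i3.
  have [h1 h2] := bd n x' i (leq_trans NM Mn) xd i3; split => //; apply: (le_trans h2).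
  apply: le_trans (ler_norm C) _; apply: le_trans (ltW (archimedean.Num.Theory.archi_boundP _)) _ => //.
  by rewrite ler_nat.
have {}NH n x i : (N <= n)%N -> exp_disc_boundary a b q t x -> (i < 3)%N ->
    hcoord j (E n x) != 0 /\ rnorm (ratio i j (E n x)) <= N.+1%:R.
  move=> nN Kx i3; have [h1 h2] := NH N x (leqnn N) Kx n i nN i3; split => //.
  by apply: le_trans h2 _; rewrite ler_nat.
have m0 : 0 < N.+1%:R^-1 :> R by rewrite invr_gt0.
have hK n x : (N <= n)%N -> exp_disc_boundary a b q t x -> N.+1%:R^-1 <= rnorm (hcoord j (E n x)).
  move=> nN Kx; have [h1 h2] := NH n x 0%N nN Kx isT.
  move: h2; rewrite /ratio div1r rnormV => h2.
  by rewrite -[leRHS]invrK lef_pV2 ?posrE ?invr_gt0 ?rnorm_gt0.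
have hD n c v : (N <= n)%N -> disc c -> rnorm v <= t -> hcoord j (E n (exp_disc a b q c v)) != 0.
  move=> nN c1 vt; rewrite -rnorm_gt0; apply: (lt_le_trans m0).
  apply: (@exp_disc_lower_bound R a b q qd (fun x => hcoord j (E n x)) t _ _ m0 _ _ c v c1 vt).
  - exact: Ed.
  - by move=> z /K2; exact: hK.
  - by move=> z w z1 /(K1 z w z1); exact: hK.
have rD n i c v : (N <= n)%N -> disc c -> rnorm v <= t ->
    differentiable (fun x => ratio i j (E n x)) (exp_disc a b q c v).
  move=> nN c1 vt; apply: differentiableM; first exact: Ed.
  by apply: differentiableV; [exact: Ed|exact: hD].
apply: (@ratio_limit E a _ N.+1%:R j N j3 Ed).
  move=> n x i nN xr i3; split.
    rewrite (exp_disc_center a b q x); apply: hD => //; first exact: disc0.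
    exact: exp_disc_center_norm.
  apply: (@exp_disc_max R a b q qd (fun x => ratio i j (E n x)) t _ x _ _ xr).
    by move=> c v; exact: rD.
  by move=> c v c1 vt; exact: (NH n _ i nN (K1 c v c1 vt) i3).2.
move=> e e0; have [|M MH] := compact_uniform (P := fun M x => forall n k i, (M <= n)%N -> (M <= k)%N ->
    (i < 3)%N -> rnorm (ratio i j (E n x) - ratio i j (E k x)) < e) cK.
  move=> x /tK[d [d0 _ /(_ e e0)[M MH] _]]; exists d => //; exists M => x' M' _ xd MM n k i nM kM i3.
  by apply: MH; [exact: leq_trans nM|exact: leq_trans kM|exact: xd|exact: i3].
exists (maxn M N) => n k x i; rewrite !geq_max => /andP[nM nN] /andP[kM kN] xr i3.
apply: (@exp_disc_max R a b q qd (fun x => ratio i j (E n x) - ratio i j (E k x)) t _ x _ _ xr).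
  by move=> c v c1 vt; apply: differentiableB; exact: rD.
by move=> c v c1 vt; apply/ltW/(MH M _ (leqnn M) (K1 c v c1 vt)).
Qed.

Variables (f : C1 R -> C1 R) (delta : C1 R).
Hypothesis fd : forall a, differentiable f a.
Hypothesis f_nonaffine : ~ exists k0, forall a, f a = f 0 + a * k0.
Hypothesis delta0 : delta != 0.
Notation F := (henon f delta).

Lemma fatou_extension (a b : C2 R) (q : C1 R -> C1 R) (t : R) :
  0 < t -> (forall c, disc c -> differentiable q c) ->
  (forall c, disc c -> fatou_set F (a + c *: b)) ->
  (forall c v, circle c -> rnorm v <= t -> fatou_set F (exp_disc a b q c v)) ->
  forall x, rnorm (x - a) < t * rnorm (cexp (- q 0) : C1 R) -> fatou_set F x.
Proof.
move=> t0 qd S1 S2 x xr; exists [set x | rnorm (x - a) < t * rnorm (cexp (- q 0) : C1 R)].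
split; [exact: open_rnorm_ball|exact: xr|].
move=> g gF; have [m mP] : {m : nat -> nat & forall n, @affine_chart R \o iter (m n) F = g n}.
  by apply: (@choice _ _ (fun n i => @affine_chart R \o iter i F = g n)) => n; have [i _ gi] := gF n; exists i.
have cK := @compact_exp_disc_boundary R a b q qd t.
have [k kh kt] := fatou_typ fd f_nonaffine delta0 cK (exp_disc_boundaryP S2 S1) m.
pose E n := iter (m (k n)) F.
have K1 := @exp_disc_boundary_circle R a b q t.
have K2 := @exp_disc_boundary_disc R a b q t.
have [|j j3 ja] := kt a; first by have := K2 0 (@disc0 R); rewrite scale0r addr0.
(* From the centre [a], type [j] is carried along the radii of the central disc, and then along the
   segments in [v] over each boundary point; both stay in [exp_disc_boundary]. *)
have jd c : disc c -> typ E j (a + c *: b).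
  move=> c1; apply: typ_segment ja => // s s01; apply: kt; rewrite scalerA; apply: K2.
  rewrite -[s%:C * c]add0r; exact: disc_scale.
have [G Gh Gc] : exists2 G, P2_holomorphic_on [set x | rnorm (x - a) < t * rnorm (cexp (- q 0) : C1 R)] G &
    P2_cvg_compacts [set x | rnorm (x - a) < t * rnorm (cexp (- q 0) : C1 R)]
      (fun n x => affine_chart (E n x)) G.
  apply: (@exp_disc_extension E a b q t j j3 t0 qd).
    by move=> n; exact: iter_differentiable.
  apply: (@exp_disc_boundaryP R a b q t (typ E j) _ jd) => c v c1 vt.
  apply: typ_segment j3 _ (jd c (circle_disc c1)).
  by move=> s s01; rewrite -exp_discZ; exact: kt _ (K1 _ _ c1 (rnorm_scale_le s01 vt)).
exists k, G; split => //; rewrite (_ : g \o k = fun n x => affine_chart (E n x))//.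
by apply/funext => n /=; rewrite -mP.
Qed.
End Limits.

(** * The exhaustion function *)

Section Pseudoconvexity.
Variable R : realType.

Lemma oppr_ln_le (x y : R) : 0 < y -> (- ln y <= x) = (expR (- x) <= y).
Proof. by move=> y0; rewrite lerNl -{2}[y]lnK ?posrE// ler_expR. Qed.

Lemma ltr_dist_of_le (x y d e : R) : x - d <= y -> y - d <= x -> d < e -> `|x - y| < e.
Proof. by rewrite ltr_norml => *; apply/andP; split; lra. Qed.

Lemma rnorm_fst_le (p : C2 R) : rnorm p.1 <= rnorm p.
Proof. by rewrite rnorm_pair le_max lexx. Qed.

Lemma rnorm_snd_le (p : C2 R) : rnorm p.2 <= rnorm p.
Proof. by rewrite rnorm_pair le_max lexx orbT. Qed.

Variables (S : set (C2 R)) (p0 : C2 R).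
Hypothesis S_open : open S.
Hypothesis S_extension : forall (a b : C2 R) (q : C1 R -> C1 R) (t : R),
  0 < t -> (forall c, disc c -> differentiable q c) ->
  (forall c, disc c -> S (a + c *: b)) ->
  (forall c v, circle c -> rnorm v <= t -> S (exp_disc a b q c v)) ->
  forall x, rnorm (x - a) < t * rnorm (cexp (- q 0) : C1 R) -> S x.

Notation Omega := (connected_component S p0).

Lemma segment_image_connected (a v : C2 R) :
  connected ((fun s : R => a + s%:C *: v) @` `[0, 1]).
Proof.
apply: connected_continuous_connected; first exact: segment_connected.
apply: continuous_in_subspaceT => s _ A /nbhs_rnorm[e e0 eA]; apply/nbhs_ballP.
have v1 : 0 < rnorm v + 1 by rewrite ltr_wpDl ?rnorm_ge0.
exists (e / (rnorm v + 1)); first by rewrite /= divr_gt0.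
move=> s'; rewrite /ball /= distrC => /(lt_scale v1) ss; apply: eA.
have -> : a + s'%:C *: v - (a + s%:C *: v) = (s' - s)%:C *: v.
  by rewrite opprD addrACA subrr add0r -scalerBl rmorphB.
rewrite rnormZ rnorm_real; apply: le_lt_trans ss.
by rewrite ler_wpM2l// lerDl.
Qed.

Lemma component_ball (a : C2 R) (r : R) : Omega a ->
  (forall x, rnorm (x - a) < r -> S x) -> forall x, rnorm (x - a) < r -> Omega x.
Proof.
move=> Oa Sr x xr; apply: (connected_component_trans Oa).
exists ((fun s : R => a + s%:C *: (x - a)) @` `[0, 1]).
  split; last exact: segment_image_connected.
    by exists 0; [rewrite /= in_itv /= lexx ler01|rewrite scale0r addr0].
  move=> y [s + <-]; rewrite /= in_itv /= => /andP[s0 s1]; apply: Sr.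
  rewrite addrC addKr rnormZ rnorm_real ger0_norm//; apply: le_lt_trans xr.
  by rewrite ler_piMl ?rnorm_ge0.
by exists 1; [rewrite /= in_itv /= lexx ler01|rewrite scale1r addrC subrK].
Qed.

Lemma component_near (p : C2 R) : Omega p ->
  exists2 d : R, 0 < d & forall x, rnorm (x - p) < d -> Omega x.
Proof.
move=> Op; have Sp := connected_component_sub Op.
have [d d0 dS] := (nbhs_rnorm p S).1 (open_nbhs_nbhs (conj S_open Sp)).
by exists d => //; exact: component_ball.
Qed.

Lemma component_open : open Omega.
Proof. by rewrite openE => p /component_near[d d0 H]; apply/nbhs_rnorm; exists d. Qed.

Definition inner_radii (p : C2 R) :=
  [set r : R | 0 <= r <= 1 /\ forall x, rnorm (x - p) < r -> Omega x].

Definition bdist (p : C2 R) : R := sup (inner_radii p).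

Lemma inner_radii_neq0 p : inner_radii p !=set0.
Proof. by exists 0; split; [rewrite lexx ler01|move=> x; rewrite ltNge rnorm_ge0]. Qed.

Lemma inner_radii_ub p : ubound (inner_radii p) 1.
Proof. by move=> r [/andP[]]. Qed.

Lemma bdist_le1 p : bdist p <= 1.
Proof. exact: ge_sup (inner_radii_neq0 p) (@inner_radii_ub p). Qed.

Lemma bdist_ge p (r : R) : r <= 1 -> (forall x, rnorm (x - p) < r -> Omega x) -> r <= bdist p.
Proof.
move=> r1 rO; have ub : has_ubound (inner_radii p) by exists 1; exact: inner_radii_ub.
have [r0|r0] := leP 0 r; first by apply: ub_le_sup => //; split => //; rewrite r0.
apply: (le_trans (ltW r0)); apply: ub_le_sup => //; split; first by rewrite lexx ler01.
by move=> x; rewrite ltNge rnorm_ge0.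
Qed.

Lemma bdist_ball p x : rnorm (x - p) < bdist p -> Omega x.
Proof. by move=> /(sup_gt (inner_radii_neq0 p))[r [_ rO]]; exact: rO. Qed.

Lemma bdist_lip p x : bdist p - rnorm (x - p) <= bdist x.
Proof.
apply: bdist_ge; first by rewrite lerBlDr (le_trans (bdist_le1 p))// lerDl rnorm_ge0.
move=> y; rewrite ltrBrDr => yx; apply: bdist_ball; apply: le_lt_trans yx.
exact: rnormBD_C2.
Qed.

Lemma bdist_gt0 p : (0 < bdist p) <-> Omega p.
Proof.
split=> [h|Op]; first by apply: (@bdist_ball p); rewrite subrr rnorm0.
have [d d0 dO] := component_near Op.
apply: (@lt_le_trans _ _ (Num.min d 1)); first by rewrite lt_min d0 ltr01.
apply: bdist_ge; first by rewrite ge_min lexx orbT.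
by move=> x; rewrite lt_min => /andP[/dO].
Qed.

Lemma bdist_continuous : continuous bdist.
Proof.
move=> p; apply/cvgrPdist_lt => e e0; apply: (@nbhs_rnorm R (C2 R) p _).2; exists e => // x xp.
have h1 := bdist_lip p x; have h2 := bdist_lip x p; rewrite rdistC in h2.
exact: ltr_dist_of_le h1 h2 xp.
Qed.

Definition exhaustion (p : C2 R) : R := Num.max (rnorm p) (- ln (bdist p)).

Lemma exhaustion_continuous p : Omega p -> {for p, continuous exhaustion}.
Proof.
move=> Op; apply: continuous_max; first exact: rnorm_continuous.
apply: continuousN; apply: (@continuous_comp _ _ _ bdist (@ln R)); first exact: bdist_continuous.
by apply: continuous_ln; exact/bdist_gt0.
Qed.

(** [expR (- c) <= bdist p] already forces [p] into the component, so the sublevel set is closed in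
    the whole space. *)
Lemma exhaustion_compact (c : R) : compact (Omega `&` [set p | exhaustion p <= c]).
Proof.
have -> : Omega `&` [set p | exhaustion p <= c] =
    [set p | rnorm p <= c] `&` [set p | expR (- c) <= bdist p].
  apply/seteqP; split => p /=.
    by move=> [/bdist_gt0 Op]; rewrite /exhaustion ge_max oppr_ln_le// => /andP.
  move=> [pc bp]; have b0 : 0 < bdist p := lt_le_trans (expR_gt0 _) bp.
  by split; [exact/bdist_gt0|rewrite /exhaustion ge_max oppr_ln_le// pc].
apply: compact_closedI; first exact: compact_C2_ball.
have -> : [set p | expR (- c) <= bdist p] = bdist @^-1` [set x | expR (- c) <= x] by [].
by apply: closed_comp; [move=> p _; exact: bdist_continuous|exact: closed_ge].
Qed.

(** Once [th] rotates [u 0] onto the positive axis, [cexp (th * u - q)] has modulus at most 1 on the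
    circle, hence at the centre. *)
Lemma rnorm_subharmonic (u q : C1 R -> C1 R) : (forall c, disc c -> differentiable u c) ->
  (forall c, disc c -> differentiable q c) ->
  (forall w, circle w -> rnorm (u w) <= complex.Re (q w)) -> rnorm (u 0) <= complex.Re (q 0).
Proof.
move=> ud qd uq.
have [th th1 thu] : exists2 th : C1 R, rnorm th = 1 & complex.Re (th * u 0) = rnorm (u 0).
  have [->|u0] := eqVneq (u 0) 0; first by exists 1; rewrite ?rnorm1// mulr0 rnorm0.
  exists ((rnorm (u 0))%:C / u 0); last by rewrite divfK.
  by rewrite rnormM rnormV rnorm_real ger0_norm ?rnorm_ge0// mulfV// rnorm_eq0.
have : rnorm (cexp (th * u 0 - q 0) : C1 R) <= 1.
  apply: (@max_modulus_disc R (fun c => cexp (th * u c - q c)) 1 _ _ 0 (@disc0 R)).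
    move=> c c1; apply: (@differentiable_comp _ _ _ _ (fun c : C1 R => th * u c - q c : C1 R) (@cexp R)).
      apply: differentiableB; last exact: qd.
      by apply: differentiableM; [exact: differentiable_cst|exact: ud].
    exact: differentiable_cexp.
  move=> w w1; rewrite rnorm_cexp -expR0 ler_expR raddfB subr_le0; apply: le_trans (uq w w1).
  apply: le_trans (ler_norm _) _; apply: le_trans (ler_Re_rnorm _) _.
  by rewrite rnormM th1 mul1r.
by rewrite rnorm_cexp -expR0 ler_expR raddfB /= subr_le0 thu.
Qed.

Lemma neg_ln_bdist_subharmonic (a b : C2 R) (q : C1 R -> C1 R) : (forall c, disc c -> Omega (a + c *: b)) ->
  (forall c, disc c -> differentiable q c) ->
  (forall w, circle w -> - ln (bdist (a + w *: b)) <= complex.Re (q w)) ->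
  - ln (bdist a) <= complex.Re (q 0).
Proof.
move=> Ob qd bq.
have Oa : Omega a by have := Ob 0 (@disc0 R); rewrite scale0r addr0.
have a0 : 0 < bdist a by exact/bdist_gt0.
have psi_bdist w : circle w -> rnorm (cexp (- q w) : C1 R) <= bdist (a + w *: b).
  move=> w1; have b0 : 0 < bdist (a + w *: b) by exact/bdist_gt0/Ob/circle_disc.
  by rewrite rnorm_cexp raddfN -oppr_ln_le//; exact: bq.
rewrite oppr_ln_le// -raddfN -rnorm_cexp leNgt; apply/negP.
set s := rnorm _ => bs; have s0 : 0 < s := lt_trans a0 bs.
(* The midpoint of [bdist a / s] and 1, so that [bdist a < t * s] while [t < 1]; a ball of radius
   [t * s] in the component contradicts the choice of [bdist a]. *)
pose t := (bdist a / s + 1) / 2; have t1 : bdist a / s < 1 by rewrite ltr_pdivrMr// mul1r.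
have t0 : 0 < t by rewrite /t divr_gt0// addr_gt0// divr_gt0.
have tlt1 : t < 1 by move: t1; rewrite /t; clear; lra.
(* The cap of [bdist] passes to the centre by the maximum principle; it keeps [t * s] among the
   admissible radii. *)
have s1 : s <= 1.
  apply: (@max_modulus_disc R (fun c => cexp (- q c)) 1 _ _ 0 (@disc0 R)).
    by move=> c c1; exact: differentiable_cexpN.
  by move=> w w1; exact: le_trans (psi_bdist w w1) (bdist_le1 _).
have ball_S x : rnorm (x - a) < t * s -> S x.
  apply: (@S_extension a b q t t0 qd); first by move=> c /Ob/connected_component_sub.
  move=> c v c1 vt; apply: (@connected_component_sub _ S p0).
  apply: (@bdist_ball (a + c *: b)).
  rewrite /exp_disc addrC addKr rnormZ; apply: (@lt_le_trans _ _ (rnorm (cexp (- q c) : C1 R))); last exact: psi_bdist.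
  by rewrite gtr_pMr ?rnorm_gt0 ?cexp_neq0//; exact: le_lt_trans vt tlt1.
have : t * s <= bdist a.
  apply: bdist_ge; last exact: component_ball.
  by apply: mulr_ile1 => //; exact: ltW.
apply/negP; rewrite -ltNge /t.
have -> : (bdist a / s + 1) / 2 * s = (bdist a + s) / 2 by field; rewrite gt_eqF.
by move: bs; clear; lra.
Qed.

Lemma exhaustion_circle_cont (a b : C2 R) : (forall c, disc c -> Omega (a + c *: b)) ->
  circle_cont (fun w => exhaustion (a + w *: b)).
Proof.
move=> Ob w w1 e e0; have /cvgrPdist_lt/(_ e e0) := exhaustion_continuous (Ob w (circle_disc w1)).
move=> /(@nbhs_rnorm R (C2 R) _ _)[d d0 H].
have b1 : 0 < rnorm b + 1 by rewrite ltr_wpDl ?rnorm_ge0.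
exists (d / (rnorm b + 1)); first by rewrite divr_gt0.
move=> w' w'1 /(lt_scale b1) ww; rewrite distrC; apply: H.
have -> : a + w' *: b - (a + w *: b) = (w' - w) *: b.
  by rewrite opprD addrACA subrr add0r -scalerBl.
by rewrite rnormZ; apply: le_lt_trans ww; rewrite ler_wpM2l ?rnorm_ge0// lerDl.
Qed.

Lemma circle_meanE (u : C2 R -> R) (a b : C2 R) : circle_cont (fun w => u (a + w *: b)) ->
  circle_mean (EFin \o u) a b = (cmean (fun w => u (a + w *: b)))%:E.
Proof.
move=> /circle_cont_integrable iu; rewrite /circle_mean /cmean EFinM; congr (_ * _)%E.
by rewrite /itg /Rintegral fineK//; exact: integrable_fin_num.
Qed.

Lemma affine_coord_differentiable (x y c : C1 R) : differentiable (fun c : C1 R => x + c * y : C1 R) c.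
Proof.
apply: differentiableD; first exact: differentiable_cst.
by apply: differentiableM; [|exact: differentiable_cst].
Qed.

(** The criterion passes to maxima: a [q] whose real part dominates the maximum on the circle
    dominates both coordinate moduli and [- ln bdist], and each is compared with [q] at the centre
    separately. *)
Lemma exhaustion_submean (a b : C2 R) : (forall c, disc c -> Omega (a + c *: b)) ->
  ((exhaustion a)%:E <= circle_mean (EFin \o exhaustion) a b)%E.
Proof.
move=> Ob; have uc := exhaustion_circle_cont Ob; rewrite circle_meanE// lee_fin.
apply: submean_criterion uc _ => q qd uq; rewrite /exhaustion ge_max; apply/andP; split.
  have nq w : circle w -> rnorm (a + w *: b) <= complex.Re (q w).
    by move=> /uq; rewrite /exhaustion ge_max => /andP[].
  rewrite rnorm_pair ge_max; apply/andP; split.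
    have := @rnorm_subharmonic (fun c => a.1 + c * b.1 : C1 R) q _ qd; rewrite mul0r addr0; apply.
      by move=> c _; exact: affine_coord_differentiable.
    by move=> w /nq; exact: le_trans (rnorm_fst_le (a + w *: b)).
  have := @rnorm_subharmonic (fun c => a.2 + c * b.2 : C1 R) q _ qd; rewrite mul0r addr0; apply.
    by move=> c _; exact: affine_coord_differentiable.
  by move=> w /nq; exact: le_trans (rnorm_snd_le (a + w *: b)).
apply: neg_ln_bdist_subharmonic Ob qd _ => w /uq.
by rewrite /exhaustion ge_max => /andP[].
Qed.

Lemma exhaustion_usc (p : C2 R) (c : R) : Omega p -> exhaustion p < c ->
  \forall q \near within Omega (nbhs p), exhaustion q < c.
Proof.
move=> Op pc; have /cvgr_lt/(_ c pc) h := exhaustion_continuous Op.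
by apply: cvg_within; exact: h.
Qed.

Lemma component_pseudoconvex : pseudoconvex Omega.
Proof.
split; first exact: component_open.
exists exhaustion; split; last exact: exhaustion_compact.
  by apply: continuous_in_subspaceT => p /set_mem; exact: exhaustion_continuous.
split.
- by move=> p _; rewrite /= ltry.
- by move=> p c Op pc; exact: (exhaustion_usc Op pc).
- move=> a b Ob; apply: exhaustion_submean => c c1; apply: Ob.
  have : `|c : C1 R| <= 1 by rewrite rnormE lecR.
  exact.
Qed.
End Pseudoconvexity.

Lemma fatou_set_open (R : realType) (F : C2 R -> C2 R) : open (fatou_set F).
Proof.
rewrite openE => p [U [Uo Up UN]]; have Unb := open_nbhs_nbhs (conj Uo Up).
by apply: filterS Unb => q Uq; exists U.
Qed.

Theorem proposition1p4 (R : realType) (f : C1 R -> C1 R) (delta : R[i])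
    (f_entire : entire f) (f_transc : transcendental f) (delta_neq0 : delta <> 0)
    (Omega : set (C2 R)) :
  fatou_component (henon f delta) Omega -> pseudoconvex Omega.
Proof.
case=> p _ ->; apply: component_pseudoconvex; first exact: fatou_set_open.
apply: fatou_extension; [exact: entire_differentiable|exact: transcendental_nonaffine|exact/eqP].
Qed.
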